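(* Let $F=\alpha^2/\beta$ be a Kropina metric with $\|\beta\|_\alpha=1$ and define $\widetilde{F}=F+\eta$, where $\eta$ is a closed $1$-form with $\|\eta\|_\alpha$ sufficiently small. (i) If $F$ is of scalar flag curvature, then $\widetilde{F}$ is also a Kropina metric of scalar flag curvature. (ii) Let $F$ be of constant flag curvature. Then $\widetilde{F}$ is locally projectively flat if and only if $F$ is flat-parallel, or equivalently, $\widetilde{F}$ can be locally written in the form $$\widetilde{F}=\frac{|y|^2}{y^1}+\eta ,$$ where $|y|$ is the Euclidean norm of $y=(y^1,\dots,y^n)$ in the local coordinates.
   Context: $\alpha=\sqrt{a_{ij}(x)y^iy^j}$ is a Riemannian metric and $\beta=b_i(x)y^i$ a $1$-form on a manifold of dimension $n\ge2$. A Kropina metric is a (singular) Finsler metric of the form $F=\alpha^2/\beta$, considered on the conic region $\beta>0$. $F=\alpha^2/\beta$ (with $\|\beta\|_\alpha=1$) is flat-parallel if $\alpha$ is locally flat and $\beta$ is parallel with respect to $\alpha$. With $g_{ij}=\frac12[F^2]_{y^iy^j}$, the spray coefficients are $G^i=\frac14 g^{il}\{[F^2]_{x^ky^l}y^k-[F^2]_{x^l}\}$ and the Riemann curvature is $R^i_{\ k}=2\frac{\partial G^i}{\partial x^k}-y^j\frac{\partial^2G^i}{\partial x^j\partial y^k}+2G^j\frac{\partial^2G^i}{\partial y^j\partial y^k}-\frac{\partial G^i}{\partial y^j}\frac{\partial G^j}{\partial y^k}$. $F$ is of scalar flag curvature if $R^i_{\ k}=KF^2(\delta^i_k-F^{-2}y^iy_k)$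 for some function $K=K(x,y)$, where $y_k=(F^2/2)_{y^iy^k}y^i$; of constant flag curvature if moreover $K$ is constant. $F$ is locally projectively flat if around every point there are local coordinates in which $G^i=Py^i$ for some $P=P(x,y)$ with $P(x,\lambda y)=\lambda P(x,y)$ for $\lambda>0$. *)

(* Defs.v *)
From HB Require Import structures.
From mathcomp Require Import all_boot all_order all_algebra.
From mathcomp Require Import all_classical all_reals all_analysis.
Set Implicit Arguments.
Unset Strict Implicit.
Unset Printing Implicit Defensive.
Import Order.TTheory GRing.Theory Num.Theory.
Import numFieldNormedType.Exports.
Local Open Scope classical_set_scope.
Local Open Scope ring_scope.

Definition partial (R : realType) (n : nat) (V : normedModType R)
    (i : 'I_n) (f : 'rV[R]_n -> V) (x : 'rV[R]_n) : V :=
  'D_(delta_mx 0 i) f x.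

(* C^infty on the open set U: every iterated partial derivative is Frechet
   differentiable at every point of U *)
Definition smooth (R : realType) (n : nat) (V : normedModType R)
    (U : set 'rV[R]_n) (f : 'rV[R]_n -> V) : Prop :=
  forall (s : seq 'I_n) (x : 'rV[R]_n), U x ->
    differentiable (foldr (fun i g => partial i g) f s) x.

(* The values of [coord] outside [dom], and of [point] outside
   [coord @` dom], are irrelevant. *)
Record chart (R : realType) (n : nat) (T : topologicalType) := Chart {
  dom : set T;
  coord : T -> 'rV[R]_n;
  point : 'rV[R]_n -> T;
  dom_open : open dom;
  range_open : open (coord @` dom);
  coordK : forall p, dom p -> point (coord p) = p;
  coord_continuous : {within dom, continuous coord};
  point_continuous : {within coord @` dom, continuous point}
}.

Definition chart_range (R : realType) (n : nat) (T : topologicalType)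
    (c : chart R n T) : set 'rV[R]_n := coord c @` dom c.

Definition transition (R : realType) (n : nat) (T : topologicalType)
    (c c' : chart R n T) : 'rV[R]_n -> 'rV[R]_n := coord c' \o point c.

Definition overlap (R : realType) (n : nat) (T : topologicalType)
    (c c' : chart R n T) : set 'rV[R]_n := coord c @` (dom c `&` dom c').

Definition compatible (R : realType) (n : nat) (T : topologicalType)
    (c c' : chart R n T) : Prop :=
  smooth (overlap c c') (transition c c') /\
  smooth (overlap c' c) (transition c' c).

(* As the atlas is maximal, "local coordinates around p" are the charts of the
   atlas whose domain contains p. *)
Record manifold (R : realType) (n : nat) := Manifold {
  carrier : topologicalType;
  space_hausdorff : hausdorff_space carrier;
  space_second_countable : @second_countable carrier;
  atlas : set (chart R n carrier);
  atlas_cover : forall p : carrier, exists2 c, atlas c & dom c p;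
  atlas_compatible : forall c c', atlas c -> atlas c' -> compatible c c';
  atlas_maximal : forall c,
    (forall c', atlas c' -> compatible c c') -> atlas c
}.

(* Tensor fields are given by their components in the charts of the atlas.
   With the row-vector convention of ['J], a tangent vector with components y
   in c has components y *m J in c', where J is the Jacobian matrix of the
   transition map from c to c'. *)
Record one_form (R : realType) (n : nat) (M : manifold R n) := OneForm {
  form_comp : chart R n (carrier M) -> 'rV[R]_n -> 'rV[R]_n;
  form_smooth : forall c, atlas c -> smooth (chart_range c) (form_comp c);
  form_change : forall c c' x, atlas c -> atlas c' -> overlap c c' x ->
    form_comp c x =
      form_comp c' (transition c c' x) *m ('J (transition c c') x)^T
}.

Record riemannian_metric (R : realType) (n : nat) (M : manifold R n) :=
  RiemannianMetric {
  metric_comp : chart R n (carrier M) -> 'rV[R]_n -> 'M[R]_n;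
  metric_smooth : forall c, atlas c -> smooth (chart_range c) (metric_comp c);
  metric_sym : forall c x, atlas c -> chart_range c x ->
    (metric_comp c x)^T = metric_comp c x;
  metric_pos : forall c x (y : 'rV[R]_n), atlas c -> chart_range c x -> y != 0 ->
    0 < \sum_i \sum_j metric_comp c x i j * y 0 i * y 0 j;
  metric_change : forall c c' x, atlas c -> atlas c' -> overlap c c' x ->
    metric_comp c x =
      'J (transition c c') x *m metric_comp c' (transition c c' x)
        *m ('J (transition c c') x)^T
}.

Definition form_eval (R : realType) (n : nat) (M : manifold R n)
    (b : one_form M) (c : chart R n (carrier M)) (x y : 'rV[R]_n) : R :=
  \sum_i form_comp b c x 0 i * y 0 i.

Definition alpha (R : realType) (n : nat) (M : manifold R n)
    (a : riemannian_metric M) (c : chart R n (carrier M)) (x y : 'rV[R]_n) : R :=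
  Num.sqrt (\sum_i \sum_j metric_comp a c x i j * y 0 i * y 0 j).

Definition form_norm (R : realType) (n : nat) (M : manifold R n)
    (a : riemannian_metric M) (b : one_form M)
    (c : chart R n (carrier M)) (x : 'rV[R]_n) : R :=
  Num.sqrt (\sum_i \sum_j invmx (metric_comp a c x) i j
                 * form_comp b c x 0 i * form_comp b c x 0 j).

Definition closed_form (R : realType) (n : nat) (M : manifold R n)
    (e : one_form M) : Prop :=
  forall c x (i j : 'I_n), atlas c -> chart_range c x ->
    partial i (fun z => form_comp e c z 0 j) x =
    partial j (fun z => form_comp e c z 0 i) x.

Definition christoffel (R : realType) (n : nat) (M : manifold R n)
    (a : riemannian_metric M) (c : chart R n (carrier M)) (k i j : 'I_n)
    (x : 'rV[R]_n) : R :=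
  2^-1 * \sum_l invmx (metric_comp a c x) k l *
    (partial i (fun z => metric_comp a c z j l) x
     + partial j (fun z => metric_comp a c z i l) x
     - partial l (fun z => metric_comp a c z i j) x).

Definition parallel (R : realType) (n : nat) (M : manifold R n)
    (a : riemannian_metric M) (b : one_form M) : Prop :=
  forall c x (i j : 'I_n), atlas c -> chart_range c x ->
    partial j (fun z => form_comp b c z 0 i) x
    - \sum_k christoffel a c k i j x * form_comp b c x 0 k = 0.

Definition locally_flat (R : realType) (n : nat) (M : manifold R n)
    (a : riemannian_metric M) : Prop :=
  forall p : carrier M, exists c, [/\ atlas c, dom c p &
    forall x, chart_range c x -> metric_comp a c x = 1%:M].

Definition flat_parallel (R : realType) (n : nat) (M : manifold R n)
    (a : riemannian_metric M) (b : one_form M) : Prop :=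
  locally_flat a /\ parallel a b.

(* A function F(x, y) considered on a conic region of the tangent bundle, in
   the coordinates of each chart; values outside the region are irrelevant. *)
Record conic_metric (R : realType) (n : nat) (M : manifold R n) :=
  ConicMetric {
  region : chart R n (carrier M) -> 'rV[R]_n -> set 'rV[R]_n;
  value : chart R n (carrier M) -> 'rV[R]_n -> 'rV[R]_n -> R
}.

Definition kropina (R : realType) (n : nat) (M : manifold R n)
    (a : riemannian_metric M) (b : one_form M) : conic_metric M :=
  ConicMetric (fun c x => [set y | 0 < form_eval b c x y])
              (fun c x y => alpha a c x y ^+ 2 / form_eval b c x y).

Definition add_form (R : realType) (n : nat) (M : manifold R n)
    (F : conic_metric M) (e : one_form M) : conic_metric M :=
  ConicMetric (region F) (fun c x y => value F c x y + form_eval e c x y).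

Definition is_kropina (R : realType) (n : nat) (M : manifold R n)
    (F : conic_metric M) : Prop :=
  exists (a : riemannian_metric M) (b : one_form M),
    forall c x, atlas c -> chart_range c x ->
      region F c x = region (kropina a b) c x /\
      (forall y, region F c x y -> value F c x y = value (kropina a b) c x y).

Definition dx (R : realType) (n : nat) (k : 'I_n)
    (L : 'rV[R]_n -> 'rV[R]_n -> R) (x y : 'rV[R]_n) : R :=
  partial k (fun z : 'rV[R]_n => L z y) x.

Definition dy (R : realType) (n : nat) (k : 'I_n)
    (L : 'rV[R]_n -> 'rV[R]_n -> R) (x y : 'rV[R]_n) : R :=
  partial k (L x) y.

Definition sqr_fun (R : realType) (n : nat)
    (L : 'rV[R]_n -> 'rV[R]_n -> R) (x y : 'rV[R]_n) : R := L x y ^+ 2.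

Definition fundamental_tensor (R : realType) (n : nat)
    (L : 'rV[R]_n -> 'rV[R]_n -> R) (x y : 'rV[R]_n) : 'M[R]_n :=
  \matrix_(i, j) (2^-1 * dy j (dy i (sqr_fun L)) x y).

Definition spray (R : realType) (n : nat)
    (L : 'rV[R]_n -> 'rV[R]_n -> R) (i : 'I_n) (x y : 'rV[R]_n) : R :=
  4^-1 * \sum_l invmx (fundamental_tensor L x y) i l *
    (\sum_k dy l (dx k (sqr_fun L)) x y * y 0 k - dx l (sqr_fun L) x y).

Definition riemann_curvature (R : realType) (n : nat)
    (L : 'rV[R]_n -> 'rV[R]_n -> R) (i k : 'I_n) (x y : 'rV[R]_n) : R :=
  2 * dx k (spray L i) x y
  - \sum_j y 0 j * dy k (dx j (spray L i)) x y
  + 2 * \sum_j spray L j x y * dy k (dy j (spray L i)) x y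
  - \sum_j dy j (spray L i) x y * dy k (spray L j) x y.

Definition lower_y (R : realType) (n : nat)
    (L : 'rV[R]_n -> 'rV[R]_n -> R) (k : 'I_n) (x y : 'rV[R]_n) : R :=
  \sum_i fundamental_tensor L x y i k * y 0 i.

Definition flag_curvature_at (R : realType) (n : nat)
    (L : 'rV[R]_n -> 'rV[R]_n -> R) (K : R) (x y : 'rV[R]_n) : Prop :=
  forall i k : 'I_n, riemann_curvature L i k x y =
    K * L x y ^+ 2 *
      ((i == k)%:R - (L x y ^+ 2)^-1 * y 0 i * lower_y L k x y).

(* K is written in coordinates; where n >= 2 and F <> 0 the equation
   determines it, so that it descends to the tangent bundle. *)
Definition scalar_flag_curvature (R : realType) (n : nat) (M : manifold R n)
    (F : conic_metric M) : Prop :=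
  exists K : chart R n (carrier M) -> 'rV[R]_n -> 'rV[R]_n -> R,
    forall c x y, atlas c -> chart_range c x -> region F c x y ->
      flag_curvature_at (value F c) (K c x y) x y.

Definition constant_flag_curvature (R : realType) (n : nat)
    (M : manifold R n) (F : conic_metric M) : Prop :=
  exists K : R,
    forall c x y, atlas c -> chart_range c x -> region F c x y ->
      flag_curvature_at (value F c) K x y.

Definition locally_projectively_flat (R : realType) (n : nat)
    (M : manifold R n) (F : conic_metric M) : Prop :=
  forall p : carrier M, exists c, [/\ atlas c, dom c p &
    exists P : 'rV[R]_n -> 'rV[R]_n -> R,
      (forall x y (t : R), chart_range c x -> region F c x y -> 0 < t ->
         P x (t *: y) = t * P x y) /\
      (forall x y (i : 'I_n), chart_range c x -> region F c x y ->
         spray (value F c) i x y = P x y * y 0 i)].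

(* Locally F = |y|^2 / y^1 + e on y^1 > 0, with y^1 the component of index i1;
   |y| is the Euclidean norm, whereas the library norm of row vectors is the
   maximum norm. *)
Definition locally_standard (R : realType) (n : nat) (M : manifold R n)
    (i1 : 'I_n) (F : conic_metric M) (e : one_form M) : Prop :=
  forall p : carrier M, exists c, [/\ atlas c, dom c p &
    forall x, chart_range c x ->
      region F c x = [set y | 0 < y 0 i1] /\
      (forall y, region F c x y ->
         value F c x y =
           (\sum_i y 0 i ^+ 2) / y 0 i1 + form_eval e c x y)].

(* Main.v *)
Require Import Defs.
From HB Require Import structures.
From mathcomp Require Import all_boot all_order all_algebra.
From mathcomp Require Import all_classical all_reals all_analysis.
From mathcomp Require Import ring lra.

(** The proof works in the ring of smooth functions on the cone [beta > 0] over a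
    chart, with the commuting derivations given by the coordinates. The spray is
    characterised there by the geodesic equations of [F ^ 2], so sprays can be
    guessed and checked without inverting the fundamental tensor. Adding a closed
    form to [F] changes the spray [G] to [G + P y] with a function [P]
    ([euler_lagrange_add], [spray_add]).

    Part (i). Since [eta = beta eta / beta], the sum is the Kropina metric of
    [alpha ^ 2 + beta eta] and [beta]; by Cauchy-Schwarz the numerator is positive
    definite if [eta] has length less than 1/2. A change of the spray by [P y]
    changes the curvature by [A delta^i_k + tau_k y^i] ([curv_projective]).
    Conservation of the energy forces the gradient of the squared metric to
    annihilate the curvature ([curv_energy]), which determines [tau] in terms of
    [A]; what remains is the formula of scalar flag curvature
    ([scalar_curvature_add]).

    Part (ii). The hard implication starts from coordinates in which the spray of
    the sum is a multiple of [y]. The spray of [F] then is one too, [G = p y], and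
    constant curvature [K] reads [p ^ 2 - y^k p_{x^k} = K F ^ 2]. Cleared of
    denominators the equations are polynomial in [y] and hold beyond the cone. On
    the hyperplane [beta = 0] they give [K = 0] ([curvature_eq0]). Then the
    quadric [alpha ^ 2] divides the cubic [y^k (alpha ^ 2)_{x^k}] on every plane
    ([quadratic_dvd_cubic]), so [p] is linear in [y]
    ([projective_factor_additive]), and Hamel's equations together with the unit
    length of [beta] become a closed first-order system for the components of
    [alpha], [beta] and [p] ([metric_form_ode], [projective_covector_ode]). Its
    solutions are explicit along rays ([ray_metric], [ray_form]): in the
    coordinates of a central projection both tensors are constant
    ([ode_constant_chart]).

    All other conditions in (ii) are compared with the existence of such charts.
    A flat metric with a parallel form has them, an orthonormal frame turns
    constants into the identity matrix and the first basis covector, and in that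
    normal form flatness and parallelism, the local expression of the metric and
    projective flatness of the sum are visible. Conversely, the local expression
    determines both tensors: the half space fixes the ray of [beta], the values
    fix [alpha], and the unit length fixes the scale. *)

Set Implicit Arguments.
Unset Strict Implicit.
Unset Printing Implicit Defensive.
Import Order.TTheory GRing.Theory Num.Theory.
Import numFieldNormedType.Exports.
Import Defs.
Local Open Scope classical_set_scope.
Local Open Scope ring_scope.

(** * Smooth functions on open sets of row vectors *)

Section Smooth.
Context {R : realType} {n : nat}.
Implicit Types (V : normedModType R) (U W : set 'rV[R]_n).

Lemma partial_near V i (f g : 'rV[R]_n -> V) x :
  (\near x, f x = g x) -> partial i f x = partial i g x.
Proof. by move=> fg; rewrite /partial; apply: near_eq_derive. Qed.

Lemma partial_on V U i (f g : 'rV[R]_n -> V) x :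
  open U -> U x -> (forall z, U z -> f z = g z) ->
  partial i f x = partial i g x.
Proof.
move=> oU Ux fg; apply: partial_near.
by apply: filterS (open_nbhs_nbhs (conj oU Ux)) => z; apply: fg.
Qed.

Lemma differentiable_near V (f g : 'rV[R]_n -> V) x :
  (\near x, f x = g x) -> differentiable f x -> differentiable g x.
Proof.
move=> fg df; have gx : f x = g x by exact: (nbhs_singleton fg).
have [cd eqf] := (diff_locallyP _ _).1 df.
have h : g \o shift x = cst (g x) + 'd f x +o_ 0 id.
  apply/eqaddoP => e e0; have /eqaddoP /(_ e e0) := eqf.
  have fg' : \forall y \near (0 : 'rV[R]_n), f (y + x) = g (y + x).
    have h0 : (fun y => y + x) @ (0 : 'rV[R]_n) --> (0 + x).
      by apply: (@cvgD _ _ _ _ (nbhs_filter _)); [exact: cvg_id|exact: cvg_cst].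
    by move: h0; rewrite add0r => /(_ _ fg).
  by move: fg'; apply: filterS2 => y; rewrite /= !fctE /= gx => -> .
by apply/diff_locallyP; rewrite (diff_unique cd h).
Qed.

(** Smoothness of finite order, on which the closure properties are proved by
    induction; the iterated partials of [smooth] are composed in the other
    order. *)
Fixpoint smoothk (k : nat) (V : normedModType R) (U : set 'rV[R]_n)
    (f : 'rV[R]_n -> V) : Prop :=
  (forall x, U x -> differentiable f x) /\
  (if k is k'.+1 then forall i, smoothk k' U (partial i f) else True).

Lemma smoothkW k V U (f : 'rV[R]_n -> V) :
  smoothk k.+1 U f -> smoothk k U f.
Proof.
elim: k f => [|k IH] f [df sf]; first by split.
by split => // i; apply: IH; exact: sf.
Qed.

Lemma smooth_diff V U (f : 'rV[R]_n -> V) x :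
  smooth U f -> U x -> differentiable f x.
Proof. by move=> sf; apply: (sf [::]). Qed.

Lemma smooth_partial V U (f : 'rV[R]_n -> V) i :
  smooth U f -> smooth U (partial i f).
Proof. by move=> sf s x Ux; have := sf (rcons s i) x Ux; rewrite foldr_rcons. Qed.

Lemma smoothP V U (f : 'rV[R]_n -> V) :
  smooth U f <-> forall k, smoothk k U f.
Proof.
split=> [sf k|sf s].
  elim: k f sf => [|k IH] f sf; first by split=> // x; apply: smooth_diff.
  by split=> [x|i]; [exact: smooth_diff|apply: IH; exact: smooth_partial].
elim/last_ind: s f sf => [|s i IH] f sf x Ux; first exact: (sf 0%N).1.
by rewrite foldr_rcons; apply: IH => // k; exact: (sf k.+1).2.
Qed.

Lemma smoothk_ext k V U (f g : 'rV[R]_n -> V) :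
  open U -> (forall x, U x -> f x = g x) -> smoothk k U f -> smoothk k U g.
Proof.
move=> oU; elim: k f g => [|k IH] f g fg [df sf];
  (split=> [x Ux|]; first by apply: differentiable_near (df _ Ux);
    apply: filterS (open_nbhs_nbhs (conj oU Ux))) => //.
by move=> i; apply: IH (sf i) => x Ux; apply: partial_on fg.
Qed.

Lemma smooth_ext V U (f g : 'rV[R]_n -> V) :
  open U -> (forall x, U x -> f x = g x) -> smooth U f -> smooth U g.
Proof.
move=> oU fg /smoothP sf; apply/smoothP => k; exact: smoothk_ext (sf k).
Qed.

Lemma smooth_sub V U W (f : 'rV[R]_n -> V) :
  U `<=` W -> smooth W f -> smooth U f.
Proof. by move=> UW sf s x /UW; apply: sf. Qed.

Section Rules.
Context (V : normedModType R) (x : 'rV[R]_n).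
Implicit Types f g : 'rV[R]_n -> R.

Lemma partialD i (f g : 'rV[R]_n -> V) :
  differentiable f x -> differentiable g x ->
  partial i (fun z => f z + g z) x = partial i f x + partial i g x.
Proof. by move=> df dg; apply: deriveD; apply: diff_derivable. Qed.

Lemma partialM i f g : differentiable f x -> differentiable g x ->
  partial i (fun z => f z * g z) x = f x * partial i g x + g x * partial i f x.
Proof. by move=> df dg; apply: deriveM; apply: diff_derivable. Qed.

Lemma partialV i f : differentiable f x -> f x != 0 ->
  partial i (fun z => (f z)^-1) x = - partial i f x * ((f x)^-1 * (f x)^-1).
Proof.
move=> df f0; rewrite /partial deriveV //; last exact: diff_derivable.
by rewrite expr2 invfM /GRing.scale /= mulrC mulrN mulNr.
Qed.

Lemma partial_cst i (a : V) : partial i (fun=> a) x = 0.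
Proof. exact: derive_cst. Qed.

Lemma partial_coord i j : partial i (fun z : 'rV[R]_n => z 0 j) x = (i == j)%:R.
Proof.
rewrite /partial.
have -> : 'D_(delta_mx 0 i) (fun z : 'rV[R]_n => z 0 j) x
        = ('D_(delta_mx 0 i) (id : 'rV[R]_n -> 'rV[R]_n) x) 0 j.
  by rewrite derive_mx ?mxE //; apply: derivable_id.
by rewrite derive_id mxE eqxx eq_sym.
Qed.

End Rules.

Lemma smoothk_cst k V U (a : V) :
  smoothk k U (fun _ : 'rV[R]_n => a).
Proof.
elim: k a => [|k IH] a; split=> //; try by move=> *; exact: differentiable_cst.
move=> i; rewrite (_ : partial i _ = fun=> 0); first exact: IH.
by apply/funext => x; rewrite partial_cst.
Qed.

Lemma smoothkD k V U (f g : 'rV[R]_n -> V) : open U ->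
  smoothk k U f -> smoothk k U g -> smoothk k U (fun x => f x + g x).
Proof.
move=> oU; elim: k f g => [|k IH] f g [df sf] [dg sg];
  (split=> [x Ux|]; first by apply: differentiableD; [exact: df|exact: dg]) => //.
move=> i; apply: smoothk_ext (IH _ _ (sf i) (sg i)) => // x Ux.
by rewrite partialD //; [exact: df|exact: dg].
Qed.

Lemma smoothkM k U (f g : 'rV[R]_n -> R) : open U ->
  smoothk k U f -> smoothk k U g -> smoothk k U (fun x => f x * g x).
Proof.
move=> oU; elim: k f g => [|k IH] f g sf sg;
  (split=> [x Ux|]; first by apply: differentiableM; [exact: sf.1|exact: sg.1]) => //.
move=> i; pose h x := f x * partial i g x + g x * partial i f x.
apply: (@smoothk_ext _ _ _ h) => //.
  by move=> x Ux; rewrite partialM //; [exact: sf.1|exact: sg.1].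
by apply: smoothkD => //; apply: IH => //;
  [exact: smoothkW|exact: sg.2|exact: smoothkW|exact: sf.2].
Qed.

Lemma smoothkV k U (f : 'rV[R]_n -> R) : open U -> (forall x, U x -> f x != 0) ->
  smoothk k U f -> smoothk k U (fun x => (f x)^-1).
Proof.
move=> oU f0; elim: k f f0 => [|k IH] f f0 sf;
  (split=> [x Ux|]; first by apply: differentiableV; [exact: sf.1|exact: f0]) => //.
move=> i; pose h x := (-1 * partial i f x) * ((f x)^-1 * (f x)^-1).
apply: (@smoothk_ext _ _ _ h) => //.
  by move=> x Ux; rewrite /h partialV // ?mulN1r //; [exact: sf.1|exact: f0].
have fV : smoothk k U (fun x => (f x)^-1) by apply: IH => //; exact: smoothkW.
apply: smoothkM => //; apply: smoothkM => //; [exact: smoothk_cst|exact: sf.2].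
Qed.

Lemma smooth_cst V U (a : V) :
  smooth U (fun _ : 'rV[R]_n => a).
Proof. by apply/smoothP => k; exact: smoothk_cst. Qed.

Lemma smoothD V U (f g : 'rV[R]_n -> V) : open U ->
  smooth U f -> smooth U g -> smooth U (fun x => f x + g x).
Proof.
by move=> oU /smoothP sf /smoothP sg; apply/smoothP => k; exact: smoothkD.
Qed.

Lemma smoothM U (f g : 'rV[R]_n -> R) : open U ->
  smooth U f -> smooth U g -> smooth U (fun x => f x * g x).
Proof.
by move=> oU /smoothP sf /smoothP sg; apply/smoothP => k; exact: smoothkM.
Qed.

Lemma smoothN U (f : 'rV[R]_n -> R) : open U ->
  smooth U f -> smooth U (fun x => - f x).
Proof.
move=> oU sf; apply: (@smooth_ext _ _ (fun x => -1 * f x)) => //.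
  by move=> x _; rewrite mulN1r.
by apply: smoothM => //; exact: smooth_cst.
Qed.

Lemma smoothV U (f : 'rV[R]_n -> R) : open U -> (forall x, U x -> f x != 0) ->
  smooth U f -> smooth U (fun x => (f x)^-1).
Proof. by move=> oU f0 /smoothP sf; apply/smoothP => k; exact: smoothkV. Qed.

Lemma smoothk_sum k V U (I : Type) (r : seq I)
    (f : I -> 'rV[R]_n -> V) : open U ->
  (forall i, smoothk k U (f i)) -> smoothk k U (fun x => \sum_(i <- r) f i x).
Proof.
move=> oU sf; elim: r => [|i r IH].
  by apply: smoothk_ext (smoothk_cst k U 0) => // x _; rewrite big_nil.
apply: smoothk_ext (smoothkD oU (sf i) IH) => // x _; by rewrite big_cons.
Qed.

Lemma smooth_sum V U (I : Type) (r : seq I)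
    (f : I -> 'rV[R]_n -> V) : open U ->
  (forall i, smooth U (f i)) -> smooth U (fun x => \sum_(i <- r) f i x).
Proof.
move=> oU sf; apply/smoothP => k; apply: smoothk_sum => // i.
by have /smoothP := sf i; apply.
Qed.

Lemma smooth_coord U j : smooth U (fun z : 'rV[R]_n => z 0 j).
Proof.
apply/smoothP; case=> [|k]; split=> //;
  try by move=> x _; exact: differentiable_coord.
move=> i; rewrite (_ : partial i _ = fun=> (i == j)%:R :> R); first exact: smoothk_cst.
by apply/funext => x; rewrite partial_coord.
Qed.

Lemma partial_entry p q (f : 'rV[R]_n -> 'M[R]_(p, q)) i x k l :
  differentiable f x -> partial i (fun z => f z k l) x = partial i f x k l.
Proof.
by move=> df; rewrite /partial derive_mx ?mxE //; exact: diff_derivable.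
Qed.

Lemma differentiable_mx p q (f : 'rV[R]_n -> 'M[R]_(p, q)) x :
  (forall k l, differentiable (fun z => f z k l) x) -> differentiable f x.
Proof.
move=> df.
rewrite (_ : f = \sum_k \sum_l (fun z => f z k l *: delta_mx k l)).
  by apply: differentiable_sum => k; apply: differentiable_sum => l;
     exact: differentiableZl.
apply/funext => z; rewrite fct_sumE.
under eq_bigr do rewrite fct_sumE.
exact: matrix_sum_delta.
Qed.

Lemma differentiable_entry p q (f : 'rV[R]_n -> 'M[R]_(p, q)) x k l :
  differentiable f x -> differentiable (fun z => f z k l) x.
Proof.
by move=> df; exact: (differentiable_comp df (differentiable_coord _ k l)).
Qed.

Lemma smoothk_mxP p q k U (f : 'rV[R]_n -> 'M[R]_(p, q)) : open U ->
  smoothk k U f <-> forall r c, smoothk k U (fun z => f z r c).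
Proof.
move=> oU; elim: k f => [|k IH] f; split=> [sf|sf].
- by move=> r c; split=> // x Ux; apply: differentiable_entry; exact: sf.1.
- by split=> // x Ux; apply: differentiable_mx => r c; exact: (sf r c).1.
- move=> r c; split=> [x Ux|i].
    by apply: differentiable_entry; exact: sf.1.
  apply: (@smoothk_ext _ _ _ (fun z => partial i f z r c)) => //.
    by move=> x Ux; rewrite partial_entry //; exact: sf.1.
  by have /IH := sf.2 i; apply.
- have df x : U x -> differentiable f x.
    by move=> Ux; apply: differentiable_mx => r c; exact: (sf r c).1.
  split=> // i; apply/IH => r c.
  apply: smoothk_ext ((sf r c).2 i) => // x Ux.
  by rewrite partial_entry //; exact: df.
Qed.

Lemma smooth_mxP p q U (f : 'rV[R]_n -> 'M[R]_(p, q)) : open U ->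
  smooth U f <-> forall r c, smooth U (fun z => f z r c).
Proof.
move=> oU; split=> [/smoothP sf r c|sf]; apply/smoothP => k.
  by have /(smoothk_mxP _ _ oU) := sf k; apply.
by apply/(smoothk_mxP _ _ oU) => r c; have /smoothP := sf r c; apply.
Qed.

End Smooth.

Lemma partial_comp (R : realType) (n m : nat) (f : 'rV[R]_n -> 'rV[R]_m)
    (g : 'rV[R]_m -> R) i x :
  differentiable f x -> differentiable g (f x) ->
  partial i (fun z => g (f z)) x =
    \sum_j partial j g (f x) * partial i (fun z => f z 0 j) x.
Proof.
move=> df dg; rewrite {1}/partial deriveE; last exact: differentiable_comp.
rewrite (_ : (fun z => g (f z)) = g \o f) // diff_comp //=.
have -> : 'd f x (delta_mx 0 i) = \sum_j partial i (fun z => f z 0 j) x *: delta_mx 0 j.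
  rewrite -deriveE // [LHS]row_sum_delta; apply: eq_bigr => j _.
  by rewrite partial_entry.
rewrite linear_sum; apply: eq_bigr => j _.
by rewrite linearZ /= /partial (deriveE _ dg) mulrC.
Qed.

Lemma smooth_comp (R : realType) (n m : nat) U W (f : 'rV[R]_n -> 'rV[R]_m)
    (g : 'rV[R]_m -> R) : open U -> open W -> (forall x, U x -> W (f x)) ->
  smooth U f -> smooth W g -> smooth U (fun x => g (f x)).
Proof.
move=> oU oW UW /(smooth_mxP _ oU) sf /smoothP sg.
have df x : U x -> differentiable f x.
  by move=> Ux; apply: differentiable_mx => r c; exact: smooth_diff (sf r c) Ux.
apply/smoothP => k; elim: k g sg => [|k IH] g sg;
  (split=> [x Ux|]; first by apply: differentiable_comp (df _ Ux) _;
    apply: (sg 0%N).1; exact: UW) => //.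
move=> i; pose h x := \sum_j partial j g (f x) * partial i (fun z => f z 0 j) x.
apply: (@smoothk_ext _ _ _ _ _ h) => //.
  by move=> x Ux; rewrite (partial_comp _ (df _ Ux)) //; apply: (sg 0%N).1; exact: UW.
apply: smoothk_sum => // j; apply: smoothkM => //.
  by apply: IH => k'; exact: (sg k'.+1).2.
by have /smoothP := smooth_partial i (sf 0 j); apply.
Qed.

(** * Functions along lines *)

Section Line.
Context {R : realType} {n : nat}.
Implicit Types (V : normedModType R) (U : set 'rV[R]_n) (x v : 'rV[R]_n).

Lemma is_derive_line V (f : 'rV[R]_n -> V) x v (s : R) :
  differentiable f (x + s *: v) ->
  is_derive s 1 (fun t => f (x + t *: v)) ('D_v f (x + s *: v)).
Proof.
move=> df; have dv : derivable f (x + s *: v) v by exact: diff_derivable.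
have e : (fun h : R => h^-1 *: (((fun t : R => f (x + t *: v)) \o shift s) (h *: 1)
            - f (x + s *: v)))
   = (fun h : R => h^-1 *: ((f \o shift (x + s *: v)) (h *: v) - f (x + s *: v))).
  apply/funext => h /=; congr (_ *: (f _ - _)).
  by rewrite [h *: 1]mulr1 scalerDl addrCA.
by split; rewrite /derivable /derive e.
Qed.

Lemma derive_sum_partial (f : 'rV[R]_n -> R) x v : differentiable f x ->
  'D_v f x = \sum_k v 0 k * partial k f x.
Proof.
move=> df; rewrite deriveE // {1}(row_sum_delta v) linear_sum.
by apply: eq_bigr => k _; rewrite linearZ /partial deriveE.
Qed.

Lemma is_derive0_segment (g : R -> R) :
  (forall t : R, 0 <= t <= 1 -> is_derive t 1 g 0) -> forall t : R, 0 <= t <= 1 -> g t = g 0.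
Proof.
move=> dg t /andP[t0 t1].
have d (s : R) : 0 <= s <= t -> is_derive s 1 g 0.
  by move=> /andP[s0 st]; apply: dg; rewrite s0 (le_trans st).
have gc : {within `[0, t], continuous g}.
  apply: derivable_within_continuous => s; rewrite in_itv /= => /d ds.
  exact: ex_derive.
have [|c _] := @MVT_segment R g (fun=> 0) 0 t t0 _ gc.
  by move=> s; rewrite in_itv /= => /andP[s0 st]; apply: d; rewrite !ltW.
by rewrite mul0r => /subr0_eq.
Qed.

Lemma norm_delta_le (i : 'I_n) (t : R) : `|t *: (delta_mx 0 i : 'rV[R]_n)| <= `|t|.
Proof.
rewrite {1}/Num.Def.normr /= mx_normrE; apply: bigmax_le => //= -[k l] _ /=.
by rewrite !mxE normrM; case: (_ && _); rewrite ?normr1 ?mulr1 // normr0 mulr0.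
Qed.

(** The mean value theorem in the direction [i], then in the direction [j]. *)
Lemma second_difference_mean U (f : 'rV[R]_n -> R) x i j (h : R) : smooth U f -> 0 < h ->
  (forall v, `|v| <= h + h -> U (x + v)) ->
  exists2 v, `|v| <= h + h & f (x + h *: delta_mx 0 i + h *: delta_mx 0 j)
    - f (x + h *: delta_mx 0 i) - f (x + h *: delta_mx 0 j) + f x
    = h * h * partial j (partial i f) (x + v).
Proof.
set ei := delta_mx 0 i; set ej := delta_mx 0 j => sf h0 inU.
have nh (k : 'I_n) (t : R) : 0 <= t <= h -> `|t *: (delta_mx 0 k : 'rV[R]_n)| <= h.
  by move=> /andP[t0 th]; rewrite (le_trans (norm_delta_le k t)) // ger0_norm.
have U2 s t : 0 <= s <= h -> 0 <= t <= h -> U (x + (s *: ei + t *: ej)).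
  by move=> sh th; apply: inU; rewrite (le_trans (ler_normD _ _)) // lerD ?nh.
have h00 : (0 : R) <= 0 <= h by rewrite lexx ltW.
have hh : 0 <= h <= h by rewrite lexx ltW.
have mean (g dg : R -> R) : (forall t, 0 <= t <= h -> is_derive t 1 g (dg t)) ->
    exists2 c, 0 <= c <= h & g h - g 0 = h * dg c.
  move=> gd; have gc : {within `[0, h], continuous g}.
    apply: derivable_within_continuous => t; rewrite in_itv /= => /gd gt; exact: ex_derive.
  have [|c] := @MVT_segment R g dg 0 h (ltW h0) _ gc.
    by move=> t; rewrite in_itv /= => /andP[/ltW t0 /ltW th]; apply: gd; rewrite t0.
  by rewrite in_itv /= subr0 mulrC => ch e; exists c.
have [t th|s sh e1] := mean (fun t => f (x + h *: ej + t *: ei) - f (x + t *: ei))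
    (fun t => partial i f (x + h *: ej + t *: ei) - partial i f (x + t *: ei)).
  apply: is_deriveB; apply: is_derive_line; apply: smooth_diff sf _.
    by rewrite -addrA (addrC (h *: ej)); exact: U2.
  by have := U2 t 0 th h00; rewrite scale0r addr0.
have [t th|t th e2] := mean (fun t => partial i f (x + s *: ei + t *: ej))
    (fun t => partial j (partial i f) (x + s *: ei + t *: ej)).
  apply: is_derive_line; apply: smooth_diff (smooth_partial i sf) _.
  by rewrite -addrA; exact: U2.
exists (s *: ei + t *: ej); first by rewrite (le_trans (ler_normD _ _)) // lerD ?nh.
rewrite -mulrA addrA -e2 scale0r addr0 (addrAC x (s *: ei)) -e1 scale0r !addr0.
by rewrite (addrAC x (h *: ej)); ring.
Qed.

(** Schwarz: both iterated partials are mean values of the same second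
    difference, and they are continuous. *)
Lemma partialC U (f : 'rV[R]_n -> R) x i j : open U -> U x -> smooth U f ->
  partial i (partial j f) x = partial j (partial i f) x.
Proof.
move=> oU Ux sf; apply/eqP; rewrite -subr_eq0 -normr_le0.
apply/ler_addgt0Pl => e e0; rewrite addr0.
have e2 : 0 < e / 2 by rewrite divr_gt0.
pose near2 k l z := `|partial k (partial l f) x - partial k (partial l f) z| < e / 2.
have near_partial k l : \forall z \near x, near2 k l z.
  have /differentiable_continuous c := smooth_diff (smooth_partial k (smooth_partial l sf)) Ux.
  by have /cvgrPdist_lt /(_ _ e2) := c.
have /nbhs_ballP[r /= r0 H] : nbhs x (U `&` ([set z | near2 i j z] `&` [set z | near2 j i z])).
  by apply: filterI; [exact: open_nbhs_nbhs|apply: filterI; exact: near_partial].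
pose h := r / 3.
have h0 : 0 < h by rewrite divr_gt0.
have inb v : `|v| <= h + h -> ball x r (x + v).
  by rewrite -ball_normE /= opprD addrA subrr sub0r normrN /h; lra.
have inU v : `|v| <= h + h -> U (x + v) by move=> vh; have [] := H _ (inb v vh).
have [v1 n1 e1] := second_difference_mean i j sf h0 inU.
have [v2 n2] := second_difference_mean j i sf h0 inU.
have -> : f (x + h *: delta_mx 0 j + h *: delta_mx 0 i) - f (x + h *: delta_mx 0 j)
    - f (x + h *: delta_mx 0 i) + f x = h * h * partial j (partial i f) (x + v1).
  by rewrite -e1 (addrAC x); ring.
move=> /(mulfI (lt0r_neq0 (mulr_gt0 h0 h0))) e12.
have [_ [_ +]] := H _ (inb v1 n1); have [_ [+ _]] := H _ (inb v2 n2); rewrite /= /near2.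
rewrite -e12; move: (partial i _ x) (partial j _ x) (partial j _ _) => p q m h1 h2.
have -> : p - q = (p - m) - (q - m) by ring.
by rewrite (le_trans (ler_normB _ _)) //; lra.
Qed.

Lemma partial0_cst U (f : 'rV[R]_n -> R) x v : smooth U f ->
  (forall t : R, 0 <= t <= 1 -> U (x + t *: v) /\ 'D_v f (x + t *: v) = 0) ->
  f (x + v) = f x.
Proof.
move=> sf H; have gd (t : R) : 0 <= t <= 1 -> is_derive t 1 (fun s => f (x + s *: v)) 0.
  by move=> /H[Ut <-]; apply: is_derive_line; exact: smooth_diff sf Ut.
have := is_derive0_segment gd (t := 1); rewrite ler01 lexx => /(_ isT).
by rewrite scale1r scale0r addr0.
Qed.

End Line.

(** * The ring of smooth functions on an open set *)

Section SmoothMatrix.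
Context {R : realType} {N : nat} (W : set 'rV[R]_N) (oW : open W).

Lemma smooth_prod (I : Type) (r : seq I) (f : I -> 'rV[R]_N -> R) :
  (forall i, smooth W (f i)) -> smooth W (fun x => \prod_(i <- r) f i x).
Proof.
move=> sf; elim: r => [|i r IH].
  by apply: (smooth_ext oW _ (smooth_cst (1 : R))) => x _; rewrite big_nil.
by apply: (smooth_ext oW _ (smoothM oW (sf i) IH)) => x _; rewrite big_cons.
Qed.

Lemma smooth_det m (A : 'rV[R]_N -> 'M[R]_m) :
  (forall i j, smooth W (fun z => A z i j)) -> smooth W (fun z => \det (A z)).
Proof.
move=> sA; apply: smooth_sum => // s; apply: smoothM => //; first exact: smooth_cst.
exact: smooth_prod.
Qed.

Lemma smooth_invmx m (A : 'rV[R]_N -> 'M[R]_m) i j :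
  (forall z, W z -> A z \in unitmx) ->
  (forall k l, smooth W (fun z => A z k l)) ->
  smooth W (fun z => invmx (A z) i j).
Proof.
move=> uA sA.
apply: (@smooth_ext _ _ _ _ (fun z => (\det (A z))^-1 * \adj (A z) i j)) => //.
  by move=> z Wz; rewrite /invmx uA // [RHS]mxE.
apply: smoothM => //.
  apply: smoothV => //; last exact: smooth_det.
  by move=> z /uA; rewrite unitmxE unitfE.
apply: (@smooth_ext _ _ _ _
  (fun z => (-1) ^+ (j + i) * \det (row' j (col' i (A z))))) => //.
  by move=> z _; rewrite mxE.
apply: smoothM => //; first exact: smooth_cst.
apply: smooth_det => k l; apply: (smooth_ext oW _ (sA (lift j k) (lift i l))) => z _.
by rewrite !mxE.
Qed.

End SmoothMatrix.

Section SmoothFun.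
Context {R : realType} {N : nat} (W : {W : set 'rV[R]_N | open W}).
Local Notation sW := (sval W).
Let oW : open sW := svalP W.

(** The value outside the open set is fixed, so that two functions with the same
    values on it are equal and the ring laws hold for Leibniz equality. *)
Record smf := SmoothFun {
  smf_val :> 'rV[R]_N -> R;
  smf_smooth : smooth sW smf_val;
  smf_out : forall z, ~ sW z -> smf_val z = 0 }.

Definition cutoff (f : 'rV[R]_N -> R) z := if `[< sW z >] then f z else 0.

Lemma cutoff_in f z : sW z -> cutoff f z = f z.
Proof. by rewrite /cutoff; case: asboolP. Qed.

Lemma cutoff_smooth f : smooth sW f -> smooth sW (cutoff f).
Proof. by move=> sf; apply: (smooth_ext oW _ sf) => z Wz; rewrite cutoff_in. Qed.

Lemma cutoff_out f z : ~ sW z -> cutoff f z = 0.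
Proof. by rewrite /cutoff; case: asboolP. Qed.

Definition smf_of f (sf : smooth sW f) : smf :=
  SmoothFun (cutoff_smooth sf) (@cutoff_out f).

Lemma smf_ofE f (sf : smooth sW f) z : sW z -> smf_of sf z = f z.
Proof. exact: cutoff_in. Qed.

Lemma smfP (f g : smf) : (forall z, sW z -> f z = g z) -> f = g.
Proof.
case: f g => [f sf f0] [g sg g0] /= fg.
have {}fg : f = g.
  apply/funext => z; have [/fg //|nW] := pselect (sW z).
  by rewrite f0 // g0.
rewrite -fg in sg g0 *; by congr SmoothFun; exact: Prop_irrelevance.
Qed.

Definition smf_cst (a : R) : smf := smf_of (@smooth_cst _ _ _ sW a).
Definition smf_add (f g : smf) : smf :=
  smf_of (smoothD oW (smf_smooth f) (smf_smooth g)).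
Definition smf_opp (f : smf) : smf := smf_of (smoothN oW (smf_smooth f)).
Definition smf_mul (f g : smf) : smf :=
  smf_of (smoothM oW (smf_smooth f) (smf_smooth g)).

HB.instance Definition _ := gen_eqMixin smf.
HB.instance Definition _ := gen_choiceMixin smf.

Fact smf_addA : associative smf_add.
Proof. by move=> f g h; apply: smfP => z Wz; rewrite !smf_ofE // addrA. Qed.
Fact smf_addC : commutative smf_add.
Proof. by move=> f g; apply: smfP => z Wz; rewrite !smf_ofE // addrC. Qed.
Fact smf_add0 : left_id (smf_cst 0) smf_add.
Proof. by move=> f; apply: smfP => z Wz; rewrite !smf_ofE // add0r. Qed.
Fact smf_addN : left_inverse (smf_cst 0) smf_opp smf_add.
Proof. by move=> f; apply: smfP => z Wz; rewrite !smf_ofE // addNr. Qed.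

HB.instance Definition _ := GRing.isZmodule.Build smf
  smf_addA smf_addC smf_add0 smf_addN.

Fact smf_mulA : associative smf_mul.
Proof. by move=> f g h; apply: smfP => z Wz; rewrite !smf_ofE // mulrA. Qed.
Fact smf_mulC : commutative smf_mul.
Proof. by move=> f g; apply: smfP => z Wz; rewrite !smf_ofE // mulrC. Qed.
Fact smf_mul1 : left_id (smf_cst 1) smf_mul.
Proof. by move=> f; apply: smfP => z Wz; rewrite !smf_ofE // mul1r. Qed.
Fact smf_mulDl : left_distributive smf_mul +%R.
Proof. by move=> f g h; apply: smfP => z Wz; rewrite !smf_ofE // mulrDl. Qed.

HB.instance Definition _ := GRing.Zmodule_isComPzRing.Build smf
  smf_mulA smf_mulC smf_mul1 smf_mulDl.

Lemma smfD (f g : smf) z : sW z -> (f + g) z = f z + g z.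
Proof. exact: smf_ofE. Qed.
Lemma smfM (f g : smf) z : sW z -> (f * g) z = f z * g z.
Proof. exact: smf_ofE. Qed.
Lemma smfN (f : smf) z : sW z -> (- f) z = - f z.
Proof. exact: smf_ofE. Qed.
Lemma smfB (f g : smf) z : sW z -> (f - g) z = f z - g z.
Proof. by move=> Wz; rewrite smfD // smfN. Qed.
Lemma smf0 z : sW z -> (0 : smf) z = 0.
Proof. exact: smf_ofE. Qed.
Lemma smf1 z : sW z -> (1 : smf) z = 1.
Proof. exact: smf_ofE. Qed.
Lemma smfMn (f : smf) k z : sW z -> (f *+ k) z = f z *+ k.
Proof.
move=> Wz; elim: k => [|k IH]; first by rewrite !mulr0n smf0.
by rewrite !mulrS smfD // IH.
Qed.
Definition smf_pd (i : 'I_N) (f : smf) : smf :=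
  smf_of (smooth_partial i (smf_smooth f)).

Lemma smf_pdE i f z : sW z -> smf_pd i f z = partial i f z.
Proof. exact: smf_ofE. Qed.

Let dif (f : smf) z : sW z -> differentiable f z.
Proof. exact: smooth_diff (smf_smooth f). Qed.

Fact smf_pd_additive i : zmod_morphism (smf_pd i).
Proof.
move=> f g; apply: smfP => z Wz; rewrite smfB // !smf_pdE //.
rewrite (partial_on i (g := fun z => f z + (- g) z) oW Wz); last first.
  by move=> x Wx; rewrite smfD.
rewrite partialD //; try exact: dif; congr (_ + _).
rewrite (partial_on i (g := fun z => -1 * g z) oW Wz); last first.
  by move=> x Wx; rewrite smfN // mulN1r.
rewrite partialM //; try exact: dif.
by rewrite partial_cst mulr0 addr0 mulN1r.
Qed.
HB.instance Definition _ i := GRing.isZmodMorphism.Build smf smf (smf_pd i)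
  (smf_pd_additive i).

Lemma smf_pdM i f g : smf_pd i (f * g) = smf_pd i f * g + f * smf_pd i g.
Proof.
apply: smfP => z Wz; rewrite smfD // !smfM // !smf_pdE //.
rewrite (partial_on i (g := fun z => f z * g z) oW Wz); last first.
  by move=> x Wx; rewrite smfM.
by rewrite partialM //; try exact: dif; ring.
Qed.

Lemma smf_pdC i j f : smf_pd i (smf_pd j f) = smf_pd j (smf_pd i f).
Proof.
have e k l z : sW z -> smf_pd k (smf_pd l f) z = partial k (partial l f) z.
  move=> Wz; rewrite smf_pdE //; apply: partial_on oW Wz _ => x Wx; exact: smf_pdE.
apply: smfP => z Wz; rewrite [LHS](e i j z Wz) [RHS](e j i z Wz).
by rewrite (partialC i j oW Wz (smf_smooth f)).
Qed.

Definition smf_coord (i : 'I_N) : smf := smf_of (@smooth_coord _ _ sW i).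

Lemma smf_coordE i z : sW z -> smf_coord i z = z 0 i.
Proof. exact: smf_ofE. Qed.

Lemma smf_pd_coord i j : smf_pd i (smf_coord j) = (i == j)%:R.
Proof.
apply: smfP => z Wz; rewrite smf_pdE //.
rewrite (partial_on i (g := fun z => z 0 j) oW Wz); last exact: smf_coordE.
by rewrite partial_coord; case: (i == j); rewrite ?smf1 ?smf0.
Qed.

End SmoothFun.

(* Below, these functions are used through their values on the open set only. *)
#[global] Opaque smf_pd smf_coord smf_cst smf_of smf_add smf_mul smf_opp.

(** * Sprays and curvature in a ring with commuting derivations *)

(** The smooth functions on an open set of the tangent bundle with its
    coordinate vector fields, reduced to the algebra that the curvature
    identities use; [pd] is indexed by positions, then velocities. *)
Record phase_ring (n : nat) := PhaseRing {
  pring :> comPzRingType;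
  pd : 'I_(n + n) -> {additive pring -> pring};
  pcoord : 'I_(n + n) -> pring;
  pdM : forall i f g, pd i (f * g) = pd i f * g + f * pd i g;
  pdC : forall i j f, pd i (pd j f) = pd j (pd i f);
  pd_coord : forall i j, pd i (pcoord j) = (i == j)%:R;
  mul2I : forall f g : pring, f *+ 2 = g *+ 2 -> f = g
}.
Arguments pd {n p} i.
Arguments pcoord {n p} i.

Section Finsler.
Context {n : nat} (F : phase_ring n).
Local Notation X k := (@pd _ F (lshift n k)).
Local Notation Y k := (@pd _ F (rshift n k)).
Local Notation y i := (@pcoord _ F (rshift n i)).

Lemma pd1 i : @pd _ F i 1 = 0.
Proof.
have := pdM i (1 : F) 1; rewrite !mulr1 mul1r => /eqP.
by rewrite -subr_eq subrr eq_sym => /eqP.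
Qed.

Definition along (v : 'I_n -> F) (d : 'I_n -> 'I_(n + n)) (f : F) : F :=
  \sum_k v k * pd (d k) f.

Fact along_additive v d : zmod_morphism (along v d).
Proof.
by move=> f g; rewrite /along -sumrB; apply: eq_bigr => k _; rewrite raddfB mulrBr.
Qed.
HB.instance Definition _ v d := GRing.isZmodMorphism.Build F F (along v d)
  (along_additive v d).

Lemma alongM (v : 'I_n -> F) d f g :
  along v d (f * g) = along v d f * g + f * along v d g.
Proof.
rewrite /along mulr_suml mulr_sumr -big_split; apply: eq_bigr => k _ /=.
by rewrite pdM; ring.
Qed.

Lemma pd_along (v : 'I_n -> F) d i f :
  pd i (along v d f) = \sum_k pd i (v k) * pd (d k) f + along v d (pd i f).
Proof.
rewrite /along raddf_sum -big_split; apply: eq_bigr => k _ /=.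
by rewrite pdM (pdC i (d k)).
Qed.

Definition baseD : F -> F := along (fun k => y k) (@lshift n n).
Definition euler : F -> F := along (fun k => y k) (@rshift n n).
Definition vert (G : 'I_n -> F) : F -> F := along G (@rshift n n).
Definition sprayD (G : 'I_n -> F) (f : F) : F := baseD f - vert G f *+ 2.

HB.instance Definition _ := GRing.Additive.on baseD.
HB.instance Definition _ := GRing.Additive.on euler.
HB.instance Definition _ G := GRing.Additive.on (vert G).

Lemma eulerE f : euler f = \sum_k y k * Y k f. Proof. by []. Qed.
Lemma vertE G f : vert G f = \sum_k G k * Y k f. Proof. by []. Qed.
Lemma baseDE f : baseD f = \sum_k y k * X k f. Proof. by []. Qed.
Lemma baseDM f g : baseD (f * g) = baseD f * g + f * baseD g.
Proof. exact: alongM. Qed.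
Lemma eulerM f g : euler (f * g) = euler f * g + f * euler g.
Proof. exact: alongM. Qed.
Lemma vertM G f g : vert G (f * g) = vert G f * g + f * vert G g.
Proof. exact: alongM. Qed.

Lemma pd_baseD i f : pd i (baseD f) = \sum_k pd i (y k) * X k f + baseD (pd i f).
Proof. exact: pd_along. Qed.
Lemma pd_euler i f : pd i (euler f) = \sum_k pd i (y k) * Y k f + euler (pd i f).
Proof. exact: pd_along. Qed.
Lemma pd_vert i G f : pd i (vert G f) = \sum_k pd i (G k) * Y k f + vert G (pd i f).
Proof. exact: pd_along. Qed.

#[local] Opaque baseD euler vert.

Fact sprayD_additive G : zmod_morphism (sprayD G).
Proof.
move=> f g; rewrite /sprayD [baseD (_ - _)]raddfB [vert _ (_ - _)]raddfB /=.
by ring.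
Qed.
HB.instance Definition _ G := GRing.isZmodMorphism.Build F F (sprayD G)
  (sprayD_additive G).

Lemma Xy k i : X k (y i) = 0.
Proof. by rewrite pd_coord; rewrite (_ : (_ == _) = false) ?eq_lrshift. Qed.

Lemma Yy k i : Y k (y i) = (k == i)%:R.
Proof. by rewrite pd_coord eq_rshift. Qed.

Lemma sum_delta (v : 'I_n -> F) i : \sum_k v k * (k == i)%:R = v i.
Proof.
rewrite (bigD1 i) //= eqxx mulr1 big1 ?addr0 // => k /negPf ->.
by rewrite mulr0.
Qed.

Lemma sum_deltal (v : 'I_n -> F) i : \sum_k (i == k)%:R * v k = v i.
Proof.
by rewrite -[RHS]sum_delta; apply: eq_bigr => k _; rewrite mulrC eq_sym.
Qed.

Lemma baseD_y i : baseD (y i) = 0.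
Proof. by rewrite baseDE big1 // => k _; rewrite Xy mulr0. Qed.

Lemma vert_y G i : vert G (y i) = G i.
Proof.
by rewrite vertE -[RHS]sum_delta; apply: eq_bigr => k _; rewrite Yy.
Qed.

Lemma sprayD_y G i : sprayD G (y i) = - (G i *+ 2).
Proof. by rewrite /sprayD baseD_y vert_y sub0r. Qed.

Lemma sprayDM G f g : sprayD G (f * g) = sprayD G f * g + f * sprayD G g.
Proof. by rewrite /sprayD baseDM vertM; ring. Qed.

Lemma X_baseD k f : X k (baseD f) = baseD (X k f).
Proof. by rewrite pd_baseD big1 ?add0r // => j _; rewrite Xy mul0r. Qed.

Lemma Y_baseD k f : Y k (baseD f) = X k f + baseD (Y k f).
Proof.
rewrite pd_baseD; congr (_ + _).
by rewrite -(sum_deltal (fun j => X j f) k); apply: eq_bigr => j _; rewrite Yy.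
Qed.

Lemma Y_euler k f : Y k (euler f) = Y k f + euler (Y k f).
Proof.
rewrite pd_euler; congr (_ + _).
by rewrite -(sum_deltal (fun j => Y j f) k); apply: eq_bigr => j _; rewrite Yy.
Qed.

Lemma X_euler k f : X k (euler f) = euler (X k f).
Proof. by rewrite pd_euler big1 ?add0r // => j _; rewrite Xy mul0r. Qed.

Lemma euler_baseD f : euler (baseD f) = baseD f + baseD (euler f).
Proof.
rewrite eulerE.
under eq_bigr do rewrite Y_baseD mulrDr.
rewrite big_split /=; congr (_ + _).
rewrite [in RHS]eulerE raddf_sum; apply: eq_bigr => k _ /=.
by rewrite baseDM baseD_y mul0r add0r.
Qed.

Lemma sprayD_X G k f :
  sprayD G (X k f) = X k (sprayD G f) + (\sum_j X k (G j) * Y j f) *+ 2.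
Proof.
rewrite /sprayD [X k (_ - _)]raddfB /= X_baseD [X k (_ *+ 2)]raddfMn /=.
by rewrite pd_vert; ring.
Qed.

Lemma sprayD_Y G k f :
  sprayD G (Y k f) =
    Y k (sprayD G f) - X k f + (\sum_j Y k (G j) * Y j f) *+ 2.
Proof.
rewrite /sprayD [Y k (_ - _)]raddfB /= Y_baseD [Y k (_ *+ 2)]raddfMn /=.
by rewrite pd_vert; ring.
Qed.

Lemma eq0_mul2 (f : F) : f *+ 2 = 0 -> f = 0.
Proof. by move=> e; apply: mul2I; rewrite e mul0rn. Qed.

(** The geodesic equations of the squared metric [E]. Unlike the formula for the
    spray, they do not invert the Hessian of [E], so they can be checked and
    transformed in the ring. *)
Definition euler_lagrange (G : 'I_n -> F) (E : F) :=
  forall l, sprayD G (Y l E) = X l E.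

(** The terms of the Riemann curvature that differentiate along the geodesics are
    gathered into [sprayD]. *)
Definition curv (G : 'I_n -> F) (i k : 'I_n) : F :=
  X k (G i) *+ 2 - sprayD G (Y k (G i)) - \sum_j Y j (G i) * Y k (G j).

(** The energy is a first integral of the geodesics: for [E] of degree two,
    contracting the geodesic equations with [y] leaves [sprayD G E] alone. *)
Lemma sprayD_energy G E : euler E = E *+ 2 -> euler_lagrange G E -> sprayD G E = 0.
Proof.
move=> hE EL.
have : sprayD G (euler E) = sprayD G E.
  rewrite eulerE [LHS]raddf_sum /=.
  under eq_bigr do rewrite sprayDM EL sprayD_y.
  rewrite big_split /= addrC [RHS]/sprayD baseDE; congr (_ + _).
  rewrite vertE -sumrMnl -sumrN; apply: eq_bigr => k _; ring.
rewrite hE raddfMn /= => /eqP; rewrite mulr2n -subr_eq0 addrK => /eqP //.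
Qed.

Lemma X_energy G E k : euler E = E *+ 2 -> euler_lagrange G E ->
  X k E = \sum_j Y k (G j) * Y j E.
Proof.
move=> hE EL; apply: mul2I.
have := sprayD_Y G k E; rewrite (sprayD_energy hE EL) raddf0 EL => e.
by rewrite mulr2n {1}e; ring.
Qed.

(** Constancy of the energy along horizontal directions is preserved by the
    spray, and the curvature is what this conservation law produces. *)
Lemma curv_energy G E k : euler E = E *+ 2 -> euler_lagrange G E ->
  \sum_i Y i E * curv G i k = 0.
Proof.
move=> hE EL.
have -> : \sum_i Y i E * curv G i k = (\sum_i X k (G i) * Y i E) *+ 2
    - \sum_i sprayD G (Y k (G i)) * Y i E - \sum_j Y k (G j) * X j E.
  have -> : \sum_j Y k (G j) * X j E = \sum_i Y i E * \sum_j Y j (G i) * Y k (G j).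
    under eq_bigr => j _ do rewrite (X_energy j hE EL) mulr_sumr.
    rewrite exchange_big; apply: eq_bigr => i _; rewrite mulr_sumr.
    by apply: eq_bigr => j _; ring.
  rewrite -sumrMnl -!sumrB; apply: eq_bigr => i _; rewrite /curv.
  by ring.
have := sprayD_X G k E; rewrite (sprayD_energy hE EL) raddf0 add0r => <-.
rewrite (X_energy k hE EL) raddf_sum /=.
under eq_bigr do rewrite sprayDM EL.
rewrite big_split /=; ring.
Qed.

Lemma sprayD_projective G P f :
  sprayD (fun i => G i + P * y i) f = sprayD G f - (P * euler f) *+ 2.
Proof.
rewrite /sprayD !vertE eulerE mulr_sumr -addrA -opprD -mulrnDl -big_split.
by do 3!congr (_ _); congr (_ *+ _); apply: eq_bigr => k _ /=; ring.
Qed.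

(** A direct computation; the point is the shape of the result. Whatever [P] is,
    the curvature changes by a multiple of the identity plus a matrix whose
    columns are proportional to [y]. *)
Lemma curv_projective G P i k : (forall j, euler (G j) = G j *+ 2) ->
  let G' := fun i => G i + P * y i in
  curv G' i k = curv G i k
    + (- sprayD G' P - P * P) * (k == i)%:R
    + (X k P *+ 2 - sprayD G' (Y k P) - \sum_j Y j P * Y k (G j)
       - euler P * Y k P) * y i.
Proof.
move=> hG G'.
have YG' l j : Y l (G' j) = Y l (G j) + Y l P * y j + P * (l == j)%:R.
  by rewrite /G' raddfD pdM Yy addrA.
have hN l j : euler (Y l (G j)) = Y l (G j).
  by have := Y_euler l (G j); rewrite hG raddfMn mulr2n => /addrI <-.
have eN j : \sum_l Y l (G j) * y l = G j *+ 2.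
  by rewrite -hG eulerE; apply: eq_bigr => l _; rewrite mulrC.
have XG' : X k (G' i) = X k (G i) + X k P * y i.
  by rewrite /G' raddfD pdM Xy mulr0 addr0.
have SG' : sprayD G' (Y k (G' i)) = sprayD G' (Y k (G i)) + sprayD G' (Y k P) * y i
   - Y k P * (G' i *+ 2) + sprayD G' P * (k == i)%:R + P * sprayD G' ((k == i)%:R).
  by rewrite YG' !(raddfD (sprayD G')) /= !sprayDM sprayD_y; ring.
rewrite /curv XG' SG'.
have -> : sprayD G' ((k == i)%:R) = 0.
  by case: (k == i); rewrite ?raddf0 // /sprayD baseDE vertE
   !big1 ?mul0rn ?subr0 // => j _; rewrite pd1 mulr0.
rewrite [sprayD G' (Y k (G i))]sprayD_projective hN.
have -> : \sum_j Y j (G' i) * Y k (G' j) =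
  \sum_j Y j (G i) * Y k (G j) + Y k P * (G i *+ 2) + P * Y k (G i)
  + (\sum_j Y j P * Y k (G j) + euler P * Y k P + P * Y k P) * y i
  + P * (Y k (G i) + Y k P * y i + P * (k == i)%:R).
  have -> : Y k (G i) + Y k P * y i + P * (k == i)%:R = \sum_j (i == j)%:R * Y k (G' j).
    by rewrite sum_deltal YG'.
  rewrite -eN eulerE.
  have -> : P * Y k (G i) = P * (\sum_l Y l (G i) * (k == l)%:R).
    congr (_ * _); rewrite -(sum_delta (fun l => Y l (G i)) k).
    by apply: eq_bigr => l _; rewrite (eq_sym l).
  have -> : P * Y k P = P * (\sum_l Y l P * (k == l)%:R).
    by congr (_ * _); rewrite -(sum_delta (fun l => Y l P) k); apply: eq_bigr => l _; rewrite (eq_sym l).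
  rewrite !(mulr_sumr, mulr_suml) -!big_split /= mulr_suml -!big_split /=.
  by apply: eq_bigr => j _; rewrite !YG' (eq_sym j i); ring.
by rewrite /G'; ring.
Qed.

(** Nondegeneracy of the fundamental tensor, stated for vector fields because the
    ring has no inverses. *)
Definition hessian_regular (E : F) := forall v : 'I_n -> F,
  (forall l, \sum_i v i * Y i (Y l E) = 0) -> forall i, v i = 0.

(** Both [G] and its Euler derivative solve the same nondegenerate linear system,
    up to the factor 2. *)
Lemma spray_homogeneous G E : euler E = E *+ 2 -> euler_lagrange G E ->
  hessian_regular E -> forall i, euler (G i) = G i *+ 2.
Proof.
move=> hE EL nd i; apply/eqP; rewrite -subr_eq0; apply/eqP.
apply: (nd (fun i => euler (G i) - G i *+ 2)) => l.
have h1 : euler (Y l E) = Y l E.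
  by have := Y_euler l E; rewrite hE raddfMn mulr2n => /addrI <-.
have h2 j : euler (Y j (Y l E)) = 0.
  by have := Y_euler j (Y l E); rewrite h1 -[T in T = _]addr0 => /addrI <-.
apply: eq0_mul2.
have := congr1 euler (EL l); rewrite -X_euler hE raddfMn /= -EL.
rewrite /sprayD [euler (_ - _)]raddfB /= [euler (_ *+ 2)]raddfMn /= euler_baseD h1.
have -> : euler (vert G (Y l E)) = \sum_i euler (G i) * Y i (Y l E).
  rewrite vertE raddf_sum; apply: eq_bigr => j _ /=.
  by rewrite eulerM h2 mulr0 addr0.
move=> e.
under eq_bigr do rewrite mulrBl mulrnAl.
rewrite sumrB sumrMnl -vertE.
move: e; set u := \sum_i _; set v := vert _ _; set b := baseD _ => e.
have -> : (u - v *+ 2) *+ 2 = (b - v *+ 2) *+ 2 - (b + b - u *+ 2) by ring.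
by rewrite e subrr.
Qed.

Definition closed_linear (e : F) :=
  [/\ euler e = e, forall j k, Y j (Y k e) = 0 & forall k, baseD (Y k e) = X k e].

(** The metric itself obeys the geodesic equations, because it is a first
    integral. *)
Lemma euler_lagrange_metric G f : GRing.lreg f ->
  euler f = f -> euler_lagrange G (f * f) ->
  sprayD G f = 0 /\ forall k, sprayD G (Y k f) = X k f.
Proof.
move=> f0 hf EL.
have hE : euler (f * f) = (f * f) *+ 2.
  by rewrite eulerM hf mulr2n.
have S0 : sprayD G f = 0.
  apply: f0; rewrite mulr0; apply: eq0_mul2.
  by rewrite -[RHS](sprayD_energy hE EL) sprayDM; ring.
split=> // k; apply: f0; apply: mul2I.
have := EL k; rewrite !pdM raddfD /= !sprayDM S0 mul0r mulr0 addr0 add0r => e.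
by rewrite [RHS]mulr2n [T in _ = T + _]mulrC -e; ring.
Qed.

(** A closed form adds the same total derivative to both sides of the geodesic
    equations of [f]; the multiple [P] of [y] restores the conservation of
    [f + e]. *)
Lemma euler_lagrange_add G f e P : GRing.lreg f ->
  euler f = f -> euler_lagrange G (f * f) -> closed_linear e ->
  P * (f + e) *+ 2 = sprayD G e ->
  euler_lagrange (fun i => G i + P * y i) ((f + e) * (f + e)).
Proof.
move=> f0 hf EL [he e2 ecl] hP k.
have [S0 SY] := euler_lagrange_metric f0 hf EL.
set G' := fun i => _; set f' := f + e.
have hf' : euler f' = f' by rewrite raddfD /= hf he.
have h0 : euler (Y k f') = 0.
  by have := Y_euler k f'; rewrite hf' -[T in T = _]addr0 => /addrI <-.
have S1 : sprayD G' f' = 0.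
  by rewrite sprayD_projective hf' hP raddfD /= S0 add0r subrr.
have S2 : sprayD G' (Y k f') = X k f'.
  rewrite sprayD_projective h0 mulr0 mul0rn subr0 !raddfD /= SY; congr (_ + _).
  rewrite /sprayD ecl vertE big1 ?mul0rn ?subr0 // => j _.
  by rewrite e2 mulr0.
by rewrite !pdM raddfD /= !sprayDM S1 S2; ring.
Qed.

End Finsler.

(** * Linear and quadratic forms in the velocities *)

Section Forms.
Context {n : nat} (F : phase_ring n).
Local Notation X k := (@pd _ F (lshift n k)).
Local Notation Y k := (@pd _ F (rshift n k)).
Local Notation y i := (@pcoord _ F (rshift n i)).

Definition linear_form (b : 'I_n -> F) : F := \sum_i b i * y i.
Definition quadratic_form (a : 'I_n -> 'I_n -> F) : F :=
  \sum_i \sum_j a i j * y i * y j.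

Section Linear.
Variable b : 'I_n -> F.
Hypothesis Yb : forall k i, Y k (b i) = 0.

Lemma Y_linear k : Y k (linear_form b) = b k.
Proof.
rewrite raddf_sum /= -[RHS]sum_delta; apply: eq_bigr => i _.
by rewrite pdM Yb Yy mul0r add0r eq_sym.
Qed.

Lemma X_linear k : X k (linear_form b) = linear_form (fun i => X k (b i)).
Proof. by rewrite raddf_sum; apply: eq_bigr => i _ /=; rewrite pdM Xy mulr0 addr0. Qed.

Lemma euler_linear : euler (linear_form b) = linear_form b.
Proof. by rewrite eulerE; apply: eq_bigr => i _; rewrite Y_linear mulrC. Qed.

Lemma closed_linear_form : (forall i j, X i (b j) = X j (b i)) ->
  closed_linear (linear_form b).
Proof.
move=> cb; split=> [|j k|k]; first exact: euler_linear.
  by rewrite Y_linear Yb.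
rewrite Y_linear X_linear baseDE; apply: eq_bigr => i _.
by rewrite mulrC cb.
Qed.

End Linear.

Section Quadratic.
Variable a : 'I_n -> 'I_n -> F.
Hypothesis Ya : forall k i j, Y k (a i j) = 0.
Hypothesis asym : forall i j, a i j = a j i.

Lemma quadratic_linear : quadratic_form a =
  \sum_i y i * linear_form (a i).
Proof.
apply: eq_bigr => i _; rewrite mulr_sumr; apply: eq_bigr => j _; ring.
Qed.

Lemma Y_quadratic k : Y k (quadratic_form a) = linear_form (a k) *+ 2.
Proof.
rewrite quadratic_linear raddf_sum /=.
under eq_bigr do rewrite pdM Y_linear // Yy.
rewrite big_split mulr2n /=; congr (_ + _).
  by rewrite -(sum_deltal (fun i => linear_form (a i)) k).
by apply: eq_bigr => i _; rewrite mulrC asym.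
Qed.

Lemma YY_quadratic k l : Y l (Y k (quadratic_form a)) = a k l *+ 2.
Proof. by rewrite Y_quadratic raddfMn /= Y_linear. Qed.

Lemma X_quadratic k :
  X k (quadratic_form a) = quadratic_form (fun i j => X k (a i j)).
Proof.
rewrite raddf_sum; apply: eq_bigr => i _; rewrite raddf_sum; apply: eq_bigr => j _.
by rewrite /= !pdM !Xy !mulr0 !addr0.
Qed.

Lemma euler_quadratic : euler (quadratic_form a) = quadratic_form a *+ 2.
Proof.
rewrite eulerE quadratic_linear -sumrMnl; apply: eq_bigr => i _.
by rewrite -quadratic_linear Y_quadratic mulrnAr.
Qed.

End Quadratic.

End Forms.

(** * Functions on an open part of the tangent bundle *)

(** Elements are known by their values only, and every smooth function on the open
    set is the value of one; how the ring is built does not matter below. *)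
Record phase_space (R : realType) (n : nat) (W : set 'rV[R]_(n + n)) := PhaseSpace {
  pfun :> phase_ring n;
  ev : pfun -> 'rV[R]_(n + n) -> R;
  phase_open : open W;
  evP : forall f g, (forall z, W z -> ev f z = ev g z) -> f = g;
  evD : forall f g z, W z -> ev (f + g) z = ev f z + ev g z;
  evM : forall f g z, W z -> ev (f * g) z = ev f z * ev g z;
  evN : forall f z, W z -> ev (- f) z = - ev f z;
  ev1 : forall z, W z -> ev 1 z = 1;
  ev_smooth : forall f, smooth W (ev f);
  ev_pd : forall i f z, W z -> ev (pd i f) z = partial i (ev f) z;
  ev_coord : forall i z, W z -> ev (pcoord i) z = z 0 i;
  ev_of : forall f : 'rV[R]_(n + n) -> R, smooth W f ->
    exists g, forall z, W z -> ev g z = f z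
}.

Section PhaseFunctions.
Context {R : realType} {n : nat} (W : {W : set 'rV[R]_(n + n) | open W}).

Fact smf_mul2I (f g : smf W) : f *+ 2 = g *+ 2 -> f = g.
Proof.
move=> e; apply: smfP => z Wz; apply/eqP; rewrite -(eqr_pMn2r (n := 2)) //.
by rewrite -!smfMn // e.
Qed.

Let F : phase_ring n :=
  @PhaseRing n (smf W) (fun i => smf_pd (W := W) i) (@smf_coord _ _ W)
    (@smf_pdM _ _ W) (@smf_pdC _ _ W) (@smf_pd_coord _ _ W) smf_mul2I.

Definition phase_functions : phase_space (sval W).
Proof.
refine (@PhaseSpace _ _ _ F (fun f : smf W => smf_val f) (svalP W) _ _ _ _ _ _ _ _ _).
- exact: smfP.
- exact: smfD.
- exact: smfM.
- exact: smfN.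
- exact: smf1.
- exact: smf_smooth.
- exact: smf_pdE.
- exact: smf_coordE.
- by move=> f sf; exists (smf_of sf) => z; exact: smf_ofE.
Qed.

End PhaseFunctions.

Section Represent.
Context {R : realType} {n : nat} (sW : set 'rV[R]_(n + n)) (F : phase_space sW).
Local Notation X k := (@pd _ F (lshift n k)).
Local Notation Y k := (@pd _ F (rshift n k)).
Local Notation y i := (@pcoord _ F (rshift n i)).
Let oW : open sW := phase_open F.

Lemma ev0 z : sW z -> ev (0 : F) z = 0.
Proof. by move=> Wz; rewrite -(subrr (1 : F)) evD // evN // subrr. Qed.
Lemma evB (f g : F) z : sW z -> ev (f - g) z = ev f z - ev g z.
Proof. by move=> Wz; rewrite evD // evN. Qed.
Lemma evMn (f : F) k z : sW z -> ev (f *+ k) z = ev f z *+ k.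
Proof.
move=> Wz; elim: k => [|k IH]; first by rewrite !mulr0n ev0.
by rewrite !mulrS evD // IH.
Qed.
Lemma ev_sum (I : Type) (r : seq I) (P : pred I) (f : I -> F) z :
  sW z -> ev (\sum_(i <- r | P i) f i) z = \sum_(i <- r | P i) ev (f i) z.
Proof.
move=> Wz; elim: r => [|i r IH]; first by rewrite !big_nil ev0.
by rewrite !big_cons; case: (P i); rewrite ?evD // IH.
Qed.

Lemma ev_reg (f : F) : (forall z, sW z -> ev f z != 0) -> GRing.lreg f.
Proof.
move=> f0 g h e; apply: evP => z Wz; apply: (mulfI (f0 z Wz)).
by rewrite -!evM // e.
Qed.

(** The link between functions of two arguments, as in the definitions of sprays
    and curvature, and elements of the ring. *)
Definition represents (f : 'rV[R]_n -> 'rV[R]_n -> R) (phi : F) :=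
  forall x v, sW (row_mx x v) -> f x v = ev phi (row_mx x v).

Lemma dx_partial k (f : 'rV[R]_n -> 'rV[R]_n -> R) x v :
  dx k f x v = partial (lshift n k) (fun z => f (lsubmx z) (rsubmx z)) (row_mx x v).
Proof.
rewrite /dx /partial /derive.
suff -> : (fun h : R => h^-1 *: (((fun z => f z v) \o shift x) (h *: delta_mx 0 k) - f x v))
  = (fun h => h^-1 *: (((fun z => f (lsubmx z) (rsubmx z)) \o shift (row_mx x v))
       (h *: delta_mx 0 (lshift n k)) - f (lsubmx (row_mx x v)) (rsubmx (row_mx x v)))).
  by [].
apply/funext => h /=; congr (_ *: (_ - _)); last by rewrite row_mxKl row_mxKr.
rewrite !linearD !linearZ /= row_mxKl row_mxKr; congr (f (_ *: _ + _) _).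
  by apply/rowP => i; rewrite !mxE eq_lshift.
rewrite (_ : rsubmx _ = 0) ?scaler0 ?add0r //.
by apply/rowP => i; rewrite !mxE eq_rlshift andbF.
Qed.

Lemma dy_partial k (f : 'rV[R]_n -> 'rV[R]_n -> R) x v :
  dy k f x v = partial (rshift n k) (fun z => f (lsubmx z) (rsubmx z)) (row_mx x v).
Proof.
rewrite /dy /partial /derive.
suff -> : (fun h : R => h^-1 *: ((f x \o shift v) (h *: delta_mx 0 k) - f x v))
  = (fun h => h^-1 *: (((fun z => f (lsubmx z) (rsubmx z)) \o shift (row_mx x v))
       (h *: delta_mx 0 (rshift n k)) - f (lsubmx (row_mx x v)) (rsubmx (row_mx x v)))).
  by [].
apply/funext => h /=; congr (_ *: (_ - _)); last by rewrite row_mxKl row_mxKr.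
rewrite !linearD !linearZ /= row_mxKl row_mxKr.
rewrite (_ : lsubmx _ = 0) ?scaler0 ?add0r.
  by congr (f _ (_ *: _ + _)); apply/rowP => i; rewrite !mxE eq_rshift.
by apply/rowP => i; rewrite !mxE eq_lrshift andbF.
Qed.

Lemma represents_partial i f phi x v : represents f phi -> sW (row_mx x v) ->
  partial i (fun z => f (lsubmx z) (rsubmx z)) (row_mx x v) =
  ev (pd i phi) (row_mx x v).
Proof.
move=> rf Wz; rewrite ev_pd //; apply: (partial_on _ (oW) Wz) => z Wz'.
by rewrite rf ?hsubmxK.
Qed.

Lemma represents_dx k f phi : represents f phi -> represents (dx k f) (X k phi).
Proof. by move=> rf x v Wz; rewrite dx_partial (represents_partial _ rf Wz). Qed.

Lemma represents_dy k f phi : represents f phi -> represents (dy k f) (Y k phi).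
Proof. by move=> rf x v Wz; rewrite dy_partial (represents_partial _ rf Wz). Qed.

Lemma ev_y i x v : sW (row_mx x v) -> ev (y i) (row_mx x v) = v 0 i.
Proof. by move=> Wz; rewrite ev_coord // row_mxEr. Qed.

Section Metric.
Variables (L : 'rV[R]_n -> 'rV[R]_n -> R) (lf : F).
Hypothesis rL : represents L lf.
Hypothesis nd : forall x v, sW (row_mx x v) -> fundamental_tensor L x v \in unitmx.
Let E : F := lf * lf.

Let rE : represents (sqr_fun L) E.
Proof. by move=> x v Wz; rewrite /sqr_fun rL // evM. Qed.

Lemma fundamental_tensorE x v i j : sW (row_mx x v) ->
  fundamental_tensor L x v i j = 2^-1 * ev (Y j (Y i E)) (row_mx x v).
Proof.
move=> Wz; rewrite mxE; congr (_ * _).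
exact: (represents_dy j (represents_dy i rE)).
Qed.

Let rhs l : F := baseD (Y l E) - X l E.

Let rhsE x v l : sW (row_mx x v) ->
  \sum_k dy l (dx k (sqr_fun L)) x v * v 0 k - dx l (sqr_fun L) x v
  = ev (rhs l) (row_mx x v).
Proof.
move=> Wz; rewrite evB // -(represents_dx l rE Wz); congr (_ - _).
rewrite baseDE ev_sum //; apply: eq_bigr => k _.
rewrite evM // ev_y // mulrC; congr (_ * _).
by rewrite pdC; exact: (represents_dy l (represents_dx k rE)).
Qed.

Lemma spray_unique x v (G : 'I_n -> R) : sW (row_mx x v) ->
  (forall l, 2 * \sum_k G k * ev (Y k (Y l E)) (row_mx x v)
     = ev (rhs l) (row_mx x v)) ->
  forall i, spray L i x v = G i.
Proof.
move=> Wz HG i; rewrite /spray.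
set g := fundamental_tensor L x v.
pose c := \col_k G k; pose r := \col_l (4^-1 * ev (rhs l) (row_mx x v)).
have e : g *m c = r.
  apply/colP => l; rewrite !mxE -HG mulrA (_ : 4^-1 * 2 = 2^-1 :> R); last by field.
  rewrite mulr_sumr; apply: eq_bigr => k _.
  by rewrite /g fundamental_tensorE // !mxE; ring.
have -> : G i = c i 0 by rewrite mxE.
have -> : c = invmx g *m r by rewrite -e mulKmx ?nd.
rewrite mxE mulr_sumr; apply: eq_bigr => l _.
by rewrite rhsE // [in RHS]mxE; ring.
Qed.

Lemma spray_euler_lagrange (G : 'I_n -> F) : euler_lagrange G E ->
  forall i, represents (spray L i) (G i).
Proof.
move=> EL i x v Wz.
apply: (@spray_unique x v (fun k => ev (G k) (row_mx x v))) => // l.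
rewrite /rhs -EL /sprayD opprB addrCA subrr addr0 evMn // vertE ev_sum //.
by rewrite mulr_natl; congr (_ *+ _); apply: eq_bigr => k _; rewrite evM.
Qed.

Lemma hessian_regular_tensor : hessian_regular E.
Proof.
move=> w Hw i; apply: evP => z Wz; rewrite ev0 //.
have Wz' : sW (row_mx (lsubmx z) (rsubmx z)) by rewrite hsubmxK.
set g := fundamental_tensor L (lsubmx z) (rsubmx z).
pose c := \col_k ev (w k) z.
have e : g *m c = 0.
  apply/colP => l; rewrite !mxE.
  transitivity (2^-1 * ev (\sum_i w i * Y i (Y l E)) z); last first.
    by rewrite Hw ev0 // mulr0.
  rewrite ev_sum // mulr_sumr; apply: eq_bigr => k _.
  by rewrite /g fundamental_tensorE // hsubmxK mxE evM //; ring.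
have -> : ev (w i) z = c i 0 by rewrite mxE.
by rewrite -(mulKmx (nd Wz') c) e mulmx0 mxE.
Qed.

(** The spray belongs to the ring because Cramer's rule inverts the fundamental
    tensor smoothly. *)
Lemma spray_smooth :
  exists G : 'I_n -> F, (forall i, represents (spray L i) (G i)) /\ euler_lagrange G E.
Proof.
pose ginv (i l : 'I_n) (z : 'rV[R]_(n + n)) :=
  invmx (fundamental_tensor L (lsubmx z) (rsubmx z)) i l.
have sg i l : smooth sW (ginv i l).
  apply: smooth_invmx; first exact: oW.
    by move=> z Wz; apply: nd; rewrite hsubmxK.
  move=> k l'.
  apply: (smooth_ext (oW) (f := fun z => 2^-1 * ev (Y l' (Y k E)) z)).
    by move=> z Wz; rewrite fundamental_tensorE hsubmxK.
  by apply: (smoothM oW); [exact: smooth_cst|exact: ev_smooth].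
have /choice [gi gE] (p : 'I_n * 'I_n) := ev_of F (sg p.1 p.2).
have [q qE] := ev_of F (@smooth_cst _ _ _ sW (4^-1 : R)).
pose G i : F := q * \sum_l gi (i, l) * rhs l.
have rG i : represents (spray L i) (G i).
  move=> x v Wz; rewrite /spray /G evM // qE // ev_sum //; congr (_ * _).
  apply: eq_bigr => l _; rewrite (rhsE _ Wz) (evM _ _ Wz) (gE _ _ Wz) /ginv.
  by rewrite row_mxKl row_mxKr.
exists G; split=> // l; apply: evP => z Wz.
have Wz' : sW (row_mx (lsubmx z) (rsubmx z)) by rewrite hsubmxK.
set g := fundamental_tensor L (lsubmx z) (rsubmx z).
pose r := \col_l ev (rhs l) z.
have eG i : ev (G i) z = (4^-1 *: (invmx g *m r)) i 0.
  rewrite -[z in LHS]hsubmxK -rG // /spray mxE; congr (_ * _).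
  rewrite mxE; apply: eq_bigr => k _; rewrite rhsE // hsubmxK.
  by rewrite [r _ _]mxE.
have e : g *m (invmx g *m r) = r by rewrite mulKVmx ?nd.
have el : \sum_k g l k * (invmx g *m r) k 0 = ev (rhs l) z.
  by have := congr1 (fun m : 'cV_n => m l 0) e; rewrite mxE [r _ _]mxE.
have hv : ev (vert G (Y l E)) z = 2^-1 * ev (rhs l) z.
  rewrite vertE ev_sum // -el mulr_sumr; apply: eq_bigr => k _.
  by rewrite evM // eG mxE /g fundamental_tensorE // hsubmxK; field.
rewrite /sprayD (evB (baseD (Y l E)) (vert G (Y l E) *+ 2) Wz).
rewrite (evMn (vert G (Y l E)) 2 Wz).
rewrite hv.
have -> : (2^-1 * ev (rhs l) z) *+ 2 = ev (rhs l) z.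
  by move: (ev _ _) => t; field.
by rewrite (evB (baseD (Y l E)) (X l E) Wz) opprB addrCA subrr addr0.
Qed.

Lemma represents_curvature (G : 'I_n -> F) i k :
  (forall i, represents (spray L i) (G i)) ->
  represents (riemann_curvature L i k) (curv G i k).
Proof.
move=> rG x v Wz.
have dyx j : dy k (dx j (spray L i)) x v = ev (X j (Y k (G i))) (row_mx x v).
  by rewrite pdC (represents_dy k (represents_dx j (rG i)) Wz).
have dyy j : dy k (dy j (spray L i)) x v = ev (Y j (Y k (G i))) (row_mx x v).
  by rewrite pdC (represents_dy k (represents_dy j (rG i)) Wz).
have e1 : \sum_j v 0 j * dy k (dx j (spray L i)) x v =
    ev (baseD (Y k (G i))) (row_mx x v).
  rewrite baseDE (ev_sum _ _ _ Wz); apply: eq_bigr => j _.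
  by rewrite dyx (evM _ _ Wz) (ev_y _ Wz).
have e2 : \sum_j spray L j x v * dy k (dy j (spray L i)) x v =
    ev (vert G (Y k (G i))) (row_mx x v).
  rewrite vertE (ev_sum _ _ _ Wz); apply: eq_bigr => j _.
  by rewrite dyy (evM _ _ Wz) (rG _ _ _ Wz).
have e3 : \sum_j dy j (spray L i) x v * dy k (spray L j) x v =
    ev (\sum_j Y j (G i) * Y k (G j)) (row_mx x v).
  rewrite (ev_sum _ _ _ Wz); apply: eq_bigr => j _.
  by rewrite (evM _ _ Wz) (represents_dy j (rG i) Wz) (represents_dy k (rG j) Wz).
have e4 : ev (curv G i k) (row_mx x v) = 2 * ev (X k (G i)) (row_mx x v)
   - ev (baseD (Y k (G i))) (row_mx x v) + 2 * ev (vert G (Y k (G i))) (row_mx x v)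
   - ev (\sum_j Y j (G i) * Y k (G j)) (row_mx x v).
  rewrite (evB _ _ Wz) (evB (_ *+ 2) _ Wz) (evB (baseD _) _ Wz) !(evMn _ _ Wz).
  by rewrite !mulr_natl opprB addrA (addrAC (_ *+ 2)).
rewrite e4 /riemann_curvature.
exact: (f_equal2 (fun p q => p - q) (f_equal2 (fun p q => p + 2 * q)
  (f_equal2 (fun p q => 2 * p - q) (represents_dx k (rG i) Wz) e1) e2) e3).
Qed.

End Metric.
End Represent.

(** * Kropina functions in coordinates *)

Section Bilinear.
Context {R : realType} {n : nat}.
Implicit Types (a : 'M[R]_n) (b u v w : 'rV[R]_n).

Definition pairing b u : R := \sum_i b 0 i * u 0 i.
Definition bilin a u v : R := \sum_i \sum_j a i j * u 0 i * v 0 j.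

Lemma pairing_mx b u : pairing b u = (b *m u^T) 0 0.
Proof. by rewrite mxE; apply: eq_bigr => i _; rewrite mxE. Qed.

Lemma bilin_mx a u v : bilin a u v = (u *m a *m v^T) 0 0.
Proof.
rewrite mxE /bilin exchange_big; apply: eq_bigr => j _.
rewrite !mxE mulr_suml; apply: eq_bigr => i _; rewrite (mulrC (u _ _)) //.
Qed.

Lemma pairingDr b u v : pairing b (u + v) = pairing b u + pairing b v.
Proof. by rewrite /pairing -big_split; apply: eq_bigr => i _; rewrite mxE mulrDr. Qed.
Lemma pairingZr b k u : pairing b (k *: u) = k * pairing b u.
Proof. by rewrite /pairing mulr_sumr; apply: eq_bigr => i _; rewrite mxE mulrCA. Qed.
Lemma pairingNr b u : pairing b (- u) = - pairing b u.
Proof. by rewrite -scaleN1r pairingZr mulN1r. Qed.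
Lemma pairing0r b : pairing b 0 = 0.
Proof. by rewrite -(scale0r 0) pairingZr mul0r. Qed.
Lemma pairingC b u : pairing b u = pairing u b.
Proof. by apply: eq_bigr => i _; rewrite mulrC. Qed.
Lemma pairingZl b k u : pairing (k *: b) u = k * pairing b u.
Proof. by rewrite !(pairingC _ u) pairingZr. Qed.
Lemma pairing_delta b k : pairing b (delta_mx 0 k) = b 0 k.
Proof.
rewrite /pairing (bigD1 k) //= mxE !eqxx mulr1 big1 ?addr0 // => i /negPf ik.
by rewrite mxE eqxx ik mulr0.
Qed.

Lemma pairing_gt0 b : b != 0 -> 0 < pairing b b.
Proof.
case/rV0Pn => i bi.
rewrite /pairing (bigD1 i) //= ltr_pwDl // -?expr2 ?lt0r ?sqrf_eq0 ?bi ?sqr_ge0 //.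
by apply: sumr_ge0 => j _; rewrite -expr2 sqr_ge0.
Qed.

Lemma bilinDl a u v w : bilin a (u + v) w = bilin a u w + bilin a v w.
Proof. by rewrite !bilin_mx !mulmxDl mxE. Qed.
Lemma bilinDr a u v w : bilin a w (u + v) = bilin a w u + bilin a w v.
Proof. by rewrite !bilin_mx linearD mulmxDr mxE. Qed.
Lemma bilinZl a k u w : bilin a (k *: u) w = k * bilin a u w.
Proof. by rewrite !bilin_mx -!scalemxAl mxE. Qed.
Lemma bilinZr a k u w : bilin a w (k *: u) = k * bilin a w u.
Proof. by rewrite !bilin_mx linearZ /= -!scalemxAr mxE. Qed.
Lemma bilinC a u v : (forall i j, a i j = a j i) -> bilin a u v = bilin a v u.
Proof.
move=> asym; rewrite /bilin exchange_big; apply: eq_bigr => j _.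
by apply: eq_bigr => i _; rewrite asym; ring.
Qed.
Lemma bilin_pairing a u v : bilin a u v = pairing (u *m a) v.
Proof. by rewrite bilin_mx pairing_mx. Qed.
Lemma bilin_delta a k l : bilin a (delta_mx 0 k) (delta_mx 0 l) = a k l.
Proof. by rewrite bilin_pairing pairing_delta -rowE mxE. Qed.

Lemma unitmx_inj a : (forall v, v *m a = 0 -> v = 0) -> a \in unitmx.
Proof.
move=> inj; rewrite -row_free_unit -kermx_eq0; apply/rowV0P => v /sub_kermxP.
exact: inj.
Qed.

Definition posdef a := forall v, v != 0 -> 0 < bilin a v v.

Lemma posdef_unit a : posdef a -> a \in unitmx.
Proof.
move=> pa; apply: unitmx_inj => v va; apply/eqP/negPn/negP => /pa.
by rewrite bilin_pairing va /pairing big1 ?ltxx // => i _; rewrite mxE mul0r.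
Qed.

Lemma bilin_invmx a e v : a \in unitmx -> bilin a (e *m invmx a) v = pairing e v.
Proof. by move=> ua; rewrite bilin_pairing mulmxKV. Qed.

Lemma pairing_invmx a e : pairing e (e *m invmx a) = bilin (invmx a) e e.
Proof. by rewrite pairingC bilin_pairing. Qed.

(** The squared [a]-length of [N v - e(v) s] is nonnegative, where [s] is the
    vector dual to [e] and [N] its squared length. *)
Lemma cauchy_schwarz a e v : (forall i j, a i j = a j i) -> posdef a ->
  pairing e v ^+ 2 <= bilin (invmx a) e e * bilin a v v.
Proof.
move=> asym apos; have ua := posdef_unit apos; pose s := e *m invmx a.
have [s0|s0] := eqVneq s 0.
  have -> : e = 0 by rewrite -(mulmxKV ua e) -/s s0 mul0mx.
  by rewrite pairingC pairing0r expr0n bilin_pairing pairing0r mul0r.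
have N0 := apos _ s0; rewrite bilin_invmx // pairing_invmx in N0.
set N := bilin (invmx a) e e in N0 *.
have : 0 <= bilin a (N *: v - pairing e v *: s) (N *: v - pairing e v *: s).
  have [->|/apos/ltW //] := eqVneq (N *: v - pairing e v *: s) 0.
  by rewrite bilin_pairing pairing0r.
rewrite -scaleNr bilinDl !bilinDr !bilinZl !bilinZr (bilinC v s asym).
rewrite /s !bilin_invmx // pairing_invmx -/N => h.
rewrite -subr_ge0 -(pmulr_rge0 _ N0); apply: le_trans h _.
by rewrite le_eqVlt; apply/orP; left; apply/eqP; ring.
Qed.

End Bilinear.

Section KropinaField.
Context {R : realType} {n : nat} (U : set 'rV[R]_n) (am : 'rV[R]_n -> 'M[R]_n)
  (bm em : 'rV[R]_n -> 'rV[R]_n).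
Hypothesis oU : open U.
Hypothesis sa : forall i j, smooth U (fun x => am x i j).
Hypothesis sb : forall i, smooth U (fun x => bm x 0 i).
Hypothesis se : forall i, smooth U (fun x => em x 0 i).

Definition cone : set 'rV[R]_(n + n) :=
  [set z | U (lsubmx z) /\ 0 < pairing (bm (lsubmx z)) (rsubmx z)].

Let V : set 'rV[R]_(n + n) := [set z | U (lsubmx z)].

Let oV : open V.
Proof.
apply: (@open_comp _ _ (lsubmx : 'rV[R]_(n + n) -> 'rV[R]_n)) oU => z _.
exact/differentiable_continuous/differentiable_lsubmx.
Qed.

Lemma smooth_lsubmx W : open W -> smooth W (lsubmx : 'rV[R]_(n + n) -> 'rV[R]_n).
Proof.
move=> oW; apply/smooth_mxP => // r c; rewrite ord1.
apply: (smooth_ext oW (f := fun z => z 0 (lshift n c))); last exact: smooth_coord.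
by move=> z _; rewrite mxE.
Qed.

Let smooth_base h : smooth U h -> smooth V (fun z => h (lsubmx z) : R).
Proof.
by move=> sh; apply: (smooth_comp oV oU _ _ sh) => //; exact: smooth_lsubmx.
Qed.

Lemma open_cone : open cone.
Proof.
pose phi (z : 'rV[R]_(n + n)) := pairing (bm (lsubmx z)) (rsubmx z).
have sphi : smooth V phi.
  apply: smooth_sum => // i; apply: smoothM => //; first exact: (smooth_base (sb i)).
  apply: (smooth_ext oV (f := fun z => z 0 (rshift n i))); last exact: smooth_coord.
  by move=> z _; rewrite mxE.
rewrite openE => z [Uz pz].
have cphi : {for z, continuous phi} := differentiable_continuous (smooth_diff sphi Uz).
have n1 : nbhs z V by exact: (open_nbhs_nbhs (conj oV Uz)).
have n0 : nbhs (phi z) [set r : R | 0 < r].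
  by apply: open_nbhs_nbhs; split; [exact: open_gt|].
have n2 : nbhs z (phi @^-1` [set r : R | 0 < r]) := cphi _ n0.
exact: filterI n1 n2.
Qed.

Variable F : phase_space cone.
Local Notation X k := (@pd _ F (lshift n k)).
Local Notation Y k := (@pd _ F (rshift n k)).
Local Notation y i := (@pcoord _ F (rshift n i)).

Lemma lift_base h : smooth U h -> exists g : F,
  [/\ forall z, cone z -> ev g z = h (lsubmx z), forall k, Y k g = 0 &
      forall k z, cone z -> ev (X k g) z = partial k h (lsubmx z)].
Proof.
move=> sh; have [|g gE] := @ev_of _ _ _ F (fun z => h (lsubmx z)).
  by apply: smooth_sub (smooth_base sh) => z [].
have rg : represents (fun x _ => h x) g.
  by move=> x v Wz; rewrite gE // row_mxKl.
exists g; split=> //.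
- move=> k; apply: evP => z Wz.
  have Wz' : cone (row_mx (lsubmx z) (rsubmx z)) by rewrite hsubmxK.
  have := represents_dy k rg Wz'; rewrite hsubmxK => <-.
  by rewrite ev0 // /dy partial_cst.
- move=> k z Wz.
  have Wz' : cone (row_mx (lsubmx z) (rsubmx z)) by rewrite hsubmxK.
  by have := represents_dx k rg Wz'; rewrite hsubmxK => <-.
Qed.

Definition base_lift h (sh : smooth U h) : F := sval (cid (lift_base sh)).

Lemma liftE h (sh : smooth U h) z : cone z -> ev (base_lift sh) z = h (lsubmx z).
Proof. by have [+ _ _] := svalP (cid (lift_base sh)); apply. Qed.
Lemma Y_lift h (sh : smooth U h) k : Y k (base_lift sh) = 0.
Proof. by have [_ + _] := svalP (cid (lift_base sh)); apply. Qed.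
Lemma X_lift h (sh : smooth U h) k z : cone z ->
  ev (X k (base_lift sh)) z = partial k h (lsubmx z).
Proof. by have [_ _] := svalP (cid (lift_base sh)); apply. Qed.

Definition a_ i j := base_lift (sa i j).
Definition b_ i := base_lift (sb i).
Definition e_ i := base_lift (se i).
Definition fA : F := quadratic_form a_.
Definition fB : F := linear_form b_.
Definition fE : F := linear_form e_.

Lemma ev_linear c z : cone z -> ev (linear_form c : F) z =
  pairing (\row_i ev (c i) z) (rsubmx z).
Proof.
move=> Wz; rewrite ev_sum //; apply: eq_bigr => i _.
by rewrite evM // ev_coord // !mxE.
Qed.

Lemma ev_quadratic c z : cone z -> ev (quadratic_form c : F) z =
  bilin (\matrix_(i, j) ev (c i j) z) (rsubmx z) (rsubmx z).
Proof.
move=> Wz; rewrite ev_sum //; apply: eq_bigr => i _.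
rewrite ev_sum //; apply: eq_bigr => j _.
by rewrite !evM // !ev_coord // !mxE.
Qed.

Lemma ev_fA z : cone z -> ev fA z = bilin (am (lsubmx z)) (rsubmx z) (rsubmx z).
Proof.
move=> Wz; rewrite ev_quadratic //; congr (bilin _ _ _).
by apply/matrixP => i j; rewrite mxE liftE.
Qed.

Lemma ev_fB z : cone z -> ev fB z = pairing (bm (lsubmx z)) (rsubmx z).
Proof.
move=> Wz; rewrite ev_linear //; congr (pairing _ _).
by apply/rowP => i; rewrite mxE liftE.
Qed.

Lemma ev_fE z : cone z -> ev fE z = pairing (em (lsubmx z)) (rsubmx z).
Proof.
move=> Wz; rewrite ev_linear //; congr (pairing _ _).
by apply/rowP => i; rewrite mxE liftE.
Qed.

Lemma Y_a k i j : Y k (a_ i j) = 0. Proof. exact: Y_lift. Qed.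
Lemma Y_b k i : Y k (b_ i) = 0. Proof. exact: Y_lift. Qed.
Lemma Y_e k i : Y k (e_ i) = 0. Proof. exact: Y_lift. Qed.

Lemma fB_gt0 z : cone z -> 0 < ev fB z.
Proof. by move=> Wz; rewrite ev_fB //; case: Wz. Qed.

Lemma fB_reg : GRing.lreg fB.
Proof. by apply: ev_reg => z /fB_gt0 /lt0r_neq0. Qed.

Hypothesis asym : forall x, U x -> forall i j, am x i j = am x j i.
Hypothesis apos : forall x, U x -> posdef (am x).

Lemma a_sym i j : a_ i j = a_ j i.
Proof. by apply: evP => z Wz; rewrite !liftE // asym //; case: Wz. Qed.

(** The ring has no division, so the quotient of [fA] by [fB] is introduced by the
    equation that it solves. *)
Lemma kropina_exists : exists f0 : F, fB * f0 = fA.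
Proof.
have [|g gE] := @ev_of _ _ _ F (fun z => (ev fB z)^-1).
  apply: smoothV; [exact: open_cone| |exact: ev_smooth].
  by move=> z /fB_gt0 /lt0r_neq0.
exists (g * fA); apply: evP => z Wz; rewrite !evM // gE // mulrA mulfV ?mul1r //.
exact/lt0r_neq0/fB_gt0.
Qed.

Definition fK : F := sval (cid kropina_exists).
Definition fL : F := fK + fE.

Lemma fBK : fB * fK = fA.
Proof. exact: svalP (cid kropina_exists). Qed.

Lemma ev_fK z : cone z -> ev fK z = ev fA z / ev fB z.
Proof.
by move=> Wz; rewrite -fBK evM // mulrC mulKf //; exact/lt0r_neq0/fB_gt0.
Qed.

Lemma cone_neq0 z : cone z -> rsubmx z != 0.
Proof. by case=> _ pz; apply: contraTneq pz => ->; rewrite pairing0r ltxx. Qed.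

Lemma fA_gt0 z : cone z -> 0 < ev fA z.
Proof.
by move=> Wz; rewrite ev_fA //; apply: apos; [case: Wz|exact: cone_neq0].
Qed.

Lemma fK_gt0 z : cone z -> 0 < ev fK z.
Proof. by move=> Wz; rewrite ev_fK // divr_gt0 ?fA_gt0 ?fB_gt0. Qed.

Lemma euler_fK : euler fK = fK.
Proof.
apply: fB_reg.
have := eulerM fB fK; rewrite fBK euler_quadratic; [|exact: Y_a|exact: a_sym].
by rewrite euler_linear ?fBK; [rewrite mulr2n => /addrI|exact: Y_b].
Qed.

Lemma euler_fL : euler fL = fL.
Proof. by rewrite raddfD /= euler_fK euler_linear //; exact: Y_e. Qed.

Variable L : 'rV[R]_n -> 'rV[R]_n -> R.
Hypothesis rL : represents L fL.

(** Along a null vector [w] of the tensor, [fL] is constant to second order.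
    Differentiating [fB * fK = fA] twice in the direction [w] then shows that
    [B(v) w - B(w) v] has [am]-length zero; so [w] is a multiple of [v], and [fL]
    is not constant along [v]. *)
Lemma kropina_regular x v : cone (row_mx x v) -> L x v != 0 ->
  fundamental_tensor L x v \in unitmx.
Proof.
move=> Wz; rewrite (rL Wz) => L0; apply: unitmx_inj => w wg.
set z := row_mx x v in Wz L0 *.
have zv : rsubmx z = v by rewrite row_mxKr.
have Ux : U x by case: Wz; rewrite row_mxKl.
pose c i := base_lift (@smooth_cst _ _ _ U (w 0 i)).
have evD' g : ev (vert c g) z = \sum_i w 0 i * ev (Y i g) z.
  by rewrite vertE ev_sum //; apply: eq_bigr => i _; rewrite evM // liftE.
have YD j g : Y j (vert c g) = vert c (Y j g).
  by rewrite pd_vert big1 ?add0r // => k _; rewrite Y_lift mul0r.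
have DD_linear b : (forall k i, Y k (b i) = 0) -> vert c (vert c (linear_form b)) = 0.
  move=> Yb; rewrite {1}vertE big1 // => i _.
  by rewrite YD Y_linear // vertE big1 ?mulr0 // => k _; rewrite Yb mulr0.
have DM g h : vert c (g * h) = vert c g * h + g * vert c h by exact: vertM.
pose E := fL * fL.
have YDE j : ev (Y j (vert c E)) z = 0.
  have := congr1 (fun m : 'rV_n => m 0 j) wg; rewrite YD evD' !mxE => e.
  transitivity (2 * \sum_i w 0 i * fundamental_tensor L x v i j); last by rewrite e mulr0.
  rewrite mulr_sumr; apply: eq_bigr => i _.
  by rewrite (fundamental_tensorE rL) // -/z -/E pdC; field.
have euler_DE : euler (vert c E) = vert c E.
  have := congr1 (vert c) (eulerE E); rewrite {1}/E eulerM euler_fL -/E -mulr2n raddfMn.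
  rewrite [in RHS]raddf_sum mulr2n /= => e; apply: (addrI (vert c E)); rewrite e.
  rewrite {1}vertE eulerE -big_split; apply: eq_bigr => k _ /=.
  by rewrite vertM vert_y YD.
have DL : ev (vert c fL) z = 0.
  have : ev (vert c E) z = 0.
    rewrite -euler_DE eulerE ev_sum // big1 // => k _.
    by rewrite evM // YDE mulr0.
  rewrite /E DM evD // !evM // mulrC -mulr2n => /eqP.
  by rewrite mulrn_eq0 mulf_eq0 (negPf L0) => /eqP.
have DDL : ev (vert c (vert c fL)) z = 0.
  have : ev (vert c (vert c E)) z = 0 by rewrite evD' big1 // => k _; rewrite YDE mulr0.
  have -> : vert c (vert c E) = (vert c (vert c fL) * fL + vert c fL * vert c fL) *+ 2.
    by rewrite /E DM [vert c (_ + _)]raddfD /= !DM; ring.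
  rewrite evMn // evD // !evM // DL mulr0 addr0 => /eqP.
  by rewrite mulrn_eq0 mulf_eq0 (negPf L0) orbF => /eqP.
have DDK : ev (vert c (vert c fK)) z = 0.
  rewrite -DDL /fL [vert c (_ + _)]raddfD [vert c (_ + _)]raddfD /= evD //.
  rewrite DD_linear ?ev0 ?addr0 //.
  exact: Y_e.
pose B := ev fB z; pose f0 := ev fK z; pose bw := pairing (bm x) w; pose f0w := ev (vert c fK) z.
have B0 : 0 < B by exact: fB_gt0.
have DB : ev (vert c fB) z = bw.
  rewrite evD'; apply: eq_bigr => i _.
  by rewrite Y_linear ?liftE // ?row_mxKl 1?mulrC //; exact: Y_b.
have k2 : bw * f0w = bilin (am x) w w.
  have : ev (vert c (vert c (fB * fK))) z = 2 * bilin (am x) w w.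
    rewrite fBK evD' mulr_sumr; apply: eq_bigr => i _; rewrite YD evD' !mulr_sumr.
    apply: eq_bigr => j _; rewrite YY_quadratic; [|exact: Y_a|exact: a_sym].
    by rewrite evMn // liftE // row_mxKl; ring.
  have -> : vert c (vert c (fB * fK)) = vert c (vert c fB) * fK
      + (vert c fB * vert c fK) *+ 2 + fB * vert c (vert c fK).
    by rewrite DM [vert c (_ + _)]raddfD /= !DM; ring.
  rewrite DD_linear; last exact: Y_b.
  rewrite mul0r add0r evD // evMn // !evM // DDK DB mulr0 addr0 => e.
  have n2 : 2 != 0 :> R by rewrite pnatr_eq0.
  by apply: (mulfI n2); rewrite -e mulr_natl.
have k3 : bw * f0 + B * f0w = 2 * bilin (am x) w v.
  have := congr1 (fun g => ev (vert c g) z) fBK; rewrite DM evD // !evM // DB -/f0 -/B -/f0w => ->.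
  rewrite evD' mulr_sumr; apply: eq_bigr => i _.
  rewrite Y_quadratic; [|exact: Y_a|exact: a_sym].
  rewrite evMn // ev_linear // zv mulrnAr mulr_natl; congr (_ *+ 2).
  by rewrite mulr_sumr; apply: eq_bigr => j _; rewrite mxE liftE // row_mxKl; ring.
have kA : B * f0 = bilin (am x) v v.
  by rewrite -evM // fBK ev_fA // zv row_mxKl.
pose u := B *: w - bw *: v.
have u0 : u = 0.
  apply/eqP/negPn/negP => /(apos Ux).
  rewrite /u -scaleNr !bilinDl !bilinDr !bilinZl !bilinZr -k2 -kA.
  rewrite (bilinC v w (asym Ux)).
  have -> : bilin (am x) w v = (bw * f0 + B * f0w) / 2 by rewrite k3; field.
  by rewrite (_ : _ + _ = 0) ?ltxx //; field.
have wE i : B * w 0 i = bw * v 0 i.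
  by have := congr1 (fun m : 'rV_n => m 0 i) u0; rewrite !mxE => /subr0_eq.
have bw0 : bw = 0.
  have : bw * ev fL z = 0.
    transitivity (B * ev (vert c fL) z); last by rewrite DL mulr0.
    rewrite -[in LHS]euler_fL eulerE ev_sum // evD' !mulr_sumr; apply: eq_bigr => i _.
    by rewrite evM // ev_y // !mulrA wE.
  by move=> /eqP; rewrite mulf_eq0 (negPf L0) orbF => /eqP.
apply/rowP => i; apply: (mulfI (lt0r_neq0 B0)).
by rewrite wE bw0 mxE mul0r mulr0.
Qed.

End KropinaField.

(** * Adding a closed form; projectively flat functions *)

Section RandersChange.
Context {R : realType} {n : nat} (W : set 'rV[R]_(n + n)) (F : phase_space W).
Local Notation X k := (@pd _ F (lshift n k)).
Local Notation Y k := (@pd _ F (rshift n k)).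
Local Notation y i := (@pcoord _ F (rshift n i)).

Lemma ev_half (f g : F) : (forall z, W z -> ev f z != 0) ->
  exists P : F, P * f *+ 2 = g.
Proof.
move=> f0.
have [|h hE] := @ev_of _ _ _ F (fun z => (2 * ev f z)^-1).
  apply: smoothV; first exact: phase_open F.
    by move=> z Wz; rewrite mulf_neq0 ?f0 // pnatr_eq0.
  by apply: smoothM (phase_open F) _ (ev_smooth f); exact: smooth_cst.
exists (g * h); apply: evP => z Wz; rewrite (evMn _ _ Wz) !(evM _ _ Wz) (hE _ Wz).
by have := f0 z Wz => e; field.
Qed.

Lemma lower_yE (L : 'rV[R]_n -> 'rV[R]_n -> R) (f : F) k x v :
  represents L f -> euler f = f -> W (row_mx x v) ->
  lower_y L k x v = 2^-1 * ev (Y k (f * f)) (row_mx x v).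
Proof.
move=> rL hf Wz.
have h : euler (Y k (f * f)) = Y k (f * f).
  have := Y_euler k (f * f); rewrite eulerM hf raddfD /= => e.
  by apply: (addrI (Y k (f * f))); rewrite -e.
rewrite -[in RHS]h eulerE (ev_sum _ _ _ Wz) mulr_sumr; apply: eq_bigr => i _.
rewrite (fundamental_tensorE rL _ _ Wz) (evM _ _ Wz) (ev_y _ _ Wz) pdC.
by rewrite -mulrA (mulrC (v 0 i)).
Qed.

Variables (f e : F) (L0 L : 'rV[R]_n -> 'rV[R]_n -> R).
Hypothesis f0 : forall z, W z -> ev f z != 0.
Hypothesis hf : euler f = f.
Hypothesis cle : closed_linear e.
Hypothesis fe0 : forall z, W z -> ev (f + e) z != 0.
Hypothesis rL0 : represents L0 f.
Hypothesis rL : represents L (f + e).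
Hypothesis nd0 : forall x v, W (row_mx x v) -> fundamental_tensor L0 x v \in unitmx.
Hypothesis nd : forall x v, W (row_mx x v) -> fundamental_tensor L x v \in unitmx.

Let f_reg : GRing.lreg f. Proof. exact: ev_reg. Qed.

Let hE : euler (f * f) = f * f *+ 2.
Proof. by rewrite eulerM hf mulr2n. Qed.

(** Adding a closed form changes the spray by a multiple of [y], so that it does
    not change the geodesics as curves. *)
Lemma spray_add G : euler_lagrange G (f * f) ->
  exists P : F, P * (f + e) *+ 2 = sprayD G e /\
    forall i, represents (spray L i) (G i + P * y i).
Proof.
move=> EL; have [P hP] := ev_half (sprayD G e) fe0.
exists P; split=> // i.
by apply: (spray_euler_lagrange rL nd (G := fun i => G i + P * y i));
  exact: euler_lagrange_add.
Qed.

(** The curvature of the sum has the form [A * delta + tau_k * y^i] by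
    [curv_projective], and [curv_energy] for the sum expresses [tau] by [A]; the
    result is the formula of scalar flag curvature with [A] in place of
    [K * L ^ 2]. *)
Theorem scalar_curvature_add K x v : W (row_mx x v) ->
  flag_curvature_at L0 K x v -> exists K', flag_curvature_at L K' x v.
Proof.
move=> Wz flag.
have [G [rG EL]] := spray_smooth rL0 nd0.
have hG := spray_homogeneous hE EL (hessian_regular_tensor rL0 nd0).
have [P [hP rG']] := spray_add EL.
pose G' i := G i + P * y i.
have EL' : euler_lagrange G' ((f + e) * (f + e)) by exact: euler_lagrange_add.
have hfe : euler (f + e) = f + e by rewrite raddfD /= hf; case: cle => ->.
have hE' : euler ((f + e) * (f + e)) = (f + e) * (f + e) *+ 2.
  by rewrite eulerM hfe mulr2n.
set z := row_mx x v in Wz.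
pose A := K * L0 x v ^+ 2 + ev (- sprayD G' P - P * P) z.
pose tau k := - (K * lower_y L0 k x v) +
  ev (X k P *+ 2 - sprayD G' (Y k P) - \sum_j Y j P * Y k (G j) - euler P * Y k P) z.
have L00 : L0 x v != 0 by rewrite rL0 // f0.
have Rm i k : ev (curv G' i k) z = A * (k == i)%:R + tau k * v 0 i.
  rewrite curv_projective // -/G' (evD _ _ Wz) (evD (curv _ _ _) _ Wz) !(evM _ _ Wz).
  rewrite (ev_y _ _ Wz) -(represents_curvature i k rG Wz) flag.
  have -> : ev ((k == i)%:R : F) z = (k == i)%:R.
    by case: (k == i); [exact: ev1|exact: ev0].
  rewrite /A /tau (eq_sym i); move: (ev _ _) (ev _ _) (lower_y _ _ _ _) => p q l.
  by field.
pose E' := ev ((f + e) * (f + e)) z.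
have EE : E' = L x v ^+ 2 by rewrite rL // expr2 -(evM _ _ Wz).
have L0' : L x v != 0 by rewrite rL // fe0.
have key k : A * ev (Y k ((f + e) * (f + e))) z + tau k * (2 * E') = 0.
  have := congr1 (fun g => ev g z) (curv_energy k hE' EL').
  rewrite ev0 // (ev_sum _ _ _ Wz) => <-.
  have -> : 2 * E' = \sum_i v 0 i * ev (Y i ((f + e) * (f + e))) z.
    rewrite mulr_natl -(evMn _ _ Wz) -hE' eulerE (ev_sum _ _ _ Wz).
    by apply: eq_bigr => i _; rewrite (evM _ _ Wz) (ev_y _ _ Wz).
  have -> : A * ev (Y k ((f + e) * (f + e))) z
     = \sum_i (A * (k == i)%:R) * ev (Y i ((f + e) * (f + e))) z.
    rewrite (bigD1 k) //= eqxx mulr1 big1 ?addr0 // => i /negPf ik.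
    by rewrite eq_sym ik mulr0 mul0r.
  rewrite mulr_sumr -big_split; apply: eq_bigr => i _ /=.
  by rewrite (evM _ _ Wz) Rm; move: (ev (Y i _) z) => u; ring.
exists (A / L x v ^+ 2) => i k.
rewrite (represents_curvature i k rG' Wz) Rm (lower_yE k rL hfe Wz) -/z.
have := key k; rewrite EE (eq_sym i); move: (ev _ z) (tau k) => u t e1.
have -> : t = - (A * u) / (2 * L x v ^+ 2).
  have e2 : t * (2 * L x v ^+ 2) = - (A * u) by apply/eqP; rewrite -addr_eq0 addrC e1.
  by rewrite -e2; field.
by field.
Qed.

End RandersChange.

Lemma exists_neq n (hn : (2 <= n)%N) (i : 'I_n) : exists k, k != i.
Proof.
apply/existsP; apply: contraLR hn; rewrite negb_exists => /forallP H.
rewrite -ltnNge ltnS -(card_ord n) -(card1 i) subset_leq_card //.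
by apply/fintype.subsetP => k _; rewrite inE -[_ == _]negbK H.
Qed.

Section ProjectivelyFlat.
Context {R : realType} {n : nat} (W : set 'rV[R]_(n + n)) (F : phase_space W).
Local Notation X k := (@pd _ F (lshift n k)).
Local Notation Y k := (@pd _ F (rshift n k)).
Local Notation y i := (@pcoord _ F (rshift n i)).
Variables (f p : F) (L0 : 'rV[R]_n -> 'rV[R]_n -> R).
Hypothesis f0 : forall z, W z -> ev f z != 0.
Hypothesis hf : euler f = f.
Hypothesis hp : p * f *+ 2 = baseD f.
Hypothesis EL : euler_lagrange (fun i => p * y i) (f * f).

Let f_reg : GRing.lreg f. Proof. exact: ev_reg. Qed.

Let sprayDE g : sprayD (fun i => p * y i) g = baseD g - (p * euler g) *+ 2.
Proof.
rewrite /sprayD vertE eulerE mulr_sumr; congr (_ - _ *+ _).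
by apply: eq_bigr => i _; rewrite mulrA.
Qed.

(** Hamel's criterion for straight geodesics, from which [p] is eliminated. *)
Lemma hamel k : baseD (Y k f) = X k f.
Proof.
have [_ SY] := euler_lagrange_metric f_reg hf EL.
have h0 : euler (Y k f) = 0.
  have := Y_euler k f; rewrite hf -[T in T = _]addr0.
  by move=> /addrI <-.
by rewrite -SY sprayDE h0 mulr0 mul0rn subr0.
Qed.

Lemma X_projective k : X k f = Y k (p * f).
Proof.
apply: mul2I; rewrite -[RHS]raddfMn /= hp Y_baseD hamel mulr2n //.
Qed.

Lemma euler_projective : euler p = p.
Proof.
apply: f_reg; apply: (addrI (p * f)); apply: mul2I.
have := congr1 (@euler _ F) hp; rewrite raddfMn /= eulerM hf euler_baseD hf -hp => e.
transitivity ((euler p * f + p * f) *+ 2); first by ring.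
by rewrite e; ring.
Qed.

Lemma curv_projectively_flat i k : curv (fun i => p * y i) i k =
  (p * p - baseD p) * (k == i)%:R
  + (X k p *+ 2 - baseD (Y k p) - p * Y k p) * y i.
Proof.
have z0 : forall j : 'I_n, euler (0 : F) = 0 *+ 2 by move=> j; rewrite raddf0 mul0rn.
have h0 : euler (Y k p) = 0.
  have := Y_euler k p; rewrite euler_projective -[T in T = _]addr0.
  by move=> /addrI <-.
have := @curv_projective _ F (fun=> 0) p i k z0.
have -> : (fun i => (0 : F) + p * y i) = (fun i => p * y i).
  by apply/funext => j; rewrite add0r.
move=> /= ->.
have -> : curv (fun=> 0 : F) i k = 0.
  rewrite /curv /sprayD vertE !raddf0 !mul0rn !big1 ?subr0 ?mul0rn ?subr0 //.
    by move=> j _; rewrite raddf0 mul0r.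
  by move=> j _; rewrite mul0r.
rewrite add0r !sprayDE h0 euler_projective mulr0 mul0rn subr0 big1 ?subr0.
  by ring.
by move=> j _; rewrite raddf0 mulr0.
Qed.

Hypothesis rL0 : represents L0 f.
Hypothesis nd0 : forall x v, W (row_mx x v) -> fundamental_tensor L0 x v \in unitmx.
Hypothesis hn : (2 <= n)%N.

(** For [n >= 2] the identity and the matrices with columns proportional to [v]
    are independent, so the two parts of the curvature are determined
    separately. *)
Lemma projectively_flat_curvature K x v : W (row_mx x v) -> v != 0 ->
  flag_curvature_at L0 K x v ->
  ev (p * p - baseD p) (row_mx x v) = K * ev f (row_mx x v) ^+ 2 /\
  forall k, ev (X k p *+ 2 - baseD (Y k p) - p * Y k p) (row_mx x v)
     = - K * lower_y L0 k x v.
Proof.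
move=> Wz v0 flag; set z := row_mx x v.
have rG := spray_euler_lagrange rL0 nd0 EL.
pose A := ev (p * p - baseD p) z - K * ev f z ^+ 2.
pose t k := ev (X k p *+ 2 - baseD (Y k p) - p * Y k p) z + K * lower_y L0 k x v.
have eq0 i k : A * (k == i)%:R + t k * v 0 i = 0.
  have := flag i k.
  rewrite (represents_curvature i k rG Wz) curv_projectively_flat.
  rewrite (evD _ _ Wz) !(evM _ _ Wz) (ev_y _ _ Wz) -/z.
  have -> : ev ((k == i)%:R : F) z = (k == i)%:R.
    by case: (k == i); [exact: ev1|exact: ev0].
  rewrite rL0 // -/z /A /t (eq_sym i) => e.
  have f0z := f0 Wz; rewrite -/z in f0z.
  rewrite mulrBl mulrDl addrAC addrA e.
  by move: (lower_y _ _ _ _) => l; field.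
have /rV0Pn[i0 vi0] := v0; have [k0 k0i] := exists_neq hn i0.
have tk0 : t k0 = 0.
  have := eq0 i0 k0; rewrite (negPf k0i) mulr0 add0r => /eqP.
  by rewrite mulf_eq0 (negPf vi0) orbF => /eqP.
have A0 : A = 0.
  by have := eq0 k0 k0; rewrite eqxx mulr1 tk0 mul0r addr0.
split=> [|k]; first exact/subr0_eq.
have := eq0 i0 k; rewrite A0 mul0r add0r => /eqP; rewrite mulf_eq0 (negPf vi0) orbF => /eqP.
by rewrite /t => /eqP; rewrite addr_eq0 mulNr => /eqP.
Qed.

End ProjectivelyFlat.

(** * Functions that are polynomial along lines *)

Section PolynomialAlongLines.
Context {R : realType}.

Lemma poly_ray_eq0 (p : {poly R}) (s0 : R) :
  (forall s, s0 < s -> p.[s] = 0) -> p = 0.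
Proof.
move=> H; pose rs := [seq s0 + i.+1%:R | i <- iota 0 (size p)].
apply: (@roots_geq_poly_eq0 _ p rs); last by rewrite size_map size_iota.
  apply/allP => _ /mapP[i _ ->]; apply/rootP/H; by rewrite ltrDl ltr0n.
rewrite map_inj_uniq ?iota_uniq // => i j /addrI /eqP.
by rewrite eqr_nat eqSS => /eqP.
Qed.

(** A positive quadratic polynomial is irreducible, hence divides a cubic whose
    multiple by a linear polynomial has a square divisible by it. *)
Lemma quadratic_dvd_cubic (c0 c1 c2 a0 a1 a2 a3 b0 b1 : R) (m : {poly R}) :
  (forall s, 0 < c0 + c1 * s + c2 * s ^+ 2) -> c2 != 0 -> b0 != 0 ->
  (forall s, 3 * ((a0 + a1 * s + a2 * s ^+ 2 + a3 * s ^+ 3) * (b0 + b1 * s)) ^+ 2 =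
             (c0 + c1 * s + c2 * s ^+ 2) * m.[s]) ->
  exists l0 l1, [/\ forall s, a0 + a1 * s + a2 * s ^+ 2 + a3 * s ^+ 3 =
      (c0 + c1 * s + c2 * s ^+ 2) * (l0 + l1 * s), a0 = c0 * l0 & a3 = c2 * l1].
Proof.
move=> qpos c20 b00 eqm.
pose q := Poly [:: c0; c1; c2]; pose p := Poly [:: a0; a1; a2; a3].
pose b := Poly [:: b0; b1].
have qE s : q.[s] = c0 + c1 * s + c2 * s ^+ 2 by rewrite horner_Poly /=; ring.
have pE s : p.[s] = a0 + a1 * s + a2 * s ^+ 2 + a3 * s ^+ 3.
  by rewrite horner_Poly /=; ring.
have bE s : b.[s] = b0 + b1 * s by rewrite horner_Poly /=; ring.
have sq : (2 < size q)%N.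
  rewrite ltnNge; apply: contraNN c20 => s2.
  by have := nth_default 0 s2; rewrite coef_Poly /= => ->.
have irr : irreducible_poly q.
  apply: cubic_irreducible; first by rewrite (ltnW sq) (leq_trans (size_Poly _)).
  by move=> s; rewrite /root qE; exact/lt0r_neq0.
have dvd2 : q %| (p * b) ^+ 2.
  have -> : (p * b) ^+ 2 = (3%:R^-1 *: m) * q.
    apply/eqP; rewrite -subr_eq0; apply/eqP; apply: (@poly_ray_eq0 _ 0) => s _.
    rewrite hornerD hornerN horner_exp !hornerM hornerZ qE pE bE.
    have -> : 3%:R^-1 * m.[s] * (c0 + c1 * s + c2 * s ^+ 2) =
       3%:R^-1 * ((c0 + c1 * s + c2 * s ^+ 2) * m.[s]) by ring.
    by rewrite -eqm; field.
  exact: dvdp_mull.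
have b_ndvd : ~~ (q %| b).
  apply: contraNN b00 => /dvdp_leq H.
  have [b_0|/H] := eqVneq b 0; first by rewrite -[b0](coef_Poly [:: b0; b1] 0) -/b b_0 coef0.
  by move=> /leq_trans /(_ (size_Poly [:: b0; b1])); rewrite leqNgt sq.
have dvd1 : q %| p.
  apply: contraTT dvd2 => p_ndvd.
  have cp : coprimep q (p * b).
    by rewrite coprimepMr !irreducible_poly_coprime // p_ndvd b_ndvd.
  by rewrite -irreducible_poly_coprime // expr2 coprimepMr cp.
have [l pl] := dvdpP _ _ dvd1.
have sl : (size l <= 2)%N.
  have [->|l0] := eqVneq l 0; first by rewrite size_poly0.
  have q0 : q != 0 by rewrite -size_poly_gt0 (leq_trans _ sq).
  have := size_Poly [:: a0; a1; a2; a3]; rewrite -/p pl size_mul //=.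
  by move: sq; case: (size q) => [|[|[|k]]] //= _; rewrite !addnS /= !ltnS; case: (size l) => [|[|[|j]]].
have lE s : l.[s] = l`_0 + l`_1 * s.
  rewrite (horner_coef_wide _ sl) big_ord_recl big_ord1 /= expr0 mulr1 expr1 //.
have H s : a0 + a1 * s + a2 * s ^+ 2 + a3 * s ^+ 3 =
      (c0 + c1 * s + c2 * s ^+ 2) * (l`_0 + l`_1 * s).
  by rewrite -pE pl hornerM lE qE mulrC.
exists l`_0, l`_1; split=> //; first by have := H 0; rewrite !expr0n /= !mulr0 !addr0.
have := coef_Poly [:: a0; a1; a2; a3] 3; rewrite -/p pl coefM !big_ord_recr big_ord0 /=.
rewrite !coef_Poly /= (nth_default 0 sl) (nth_default 0 (leqW sl)) mulr0 !mul0r !addr0 add0r.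
by rewrite mulrC => <-.
Qed.

Variable n : nat.
Implicit Types (f g : 'rV[R]_n -> R) (u v w : 'rV[R]_n).

(** The only use of polynomials is to extend identities from a half space to the
    whole space, and to divide on planes; both need restrictions to lines only. *)
Definition polyl f := forall u w, exists q : {poly R}, forall s, f (u + s *: w) = q.[s].

Lemma polyl_cst (a : R) : polyl (fun=> a).
Proof. by move=> u w; exists a%:P => s; rewrite hornerC. Qed.

Lemma polyl_coord i : polyl (fun v => v 0 i).
Proof.
move=> u w; exists ((u 0 i)%:P + (w 0 i)%:P * 'X) => s.
by rewrite hornerD hornerM !hornerC hornerX !mxE mulrC.
Qed.

Lemma polylD f g : polyl f -> polyl g -> polyl (fun v => f v + g v).
Proof.
move=> pf pg u w; have [p pE] := pf u w; have [q qE] := pg u w.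
by exists (p + q) => s; rewrite hornerD pE qE.
Qed.

Lemma polylM f g : polyl f -> polyl g -> polyl (fun v => f v * g v).
Proof.
move=> pf pg u w; have [p pE] := pf u w; have [q qE] := pg u w.
by exists (p * q) => s; rewrite hornerM pE qE.
Qed.

Lemma polylN f : polyl f -> polyl (fun v => - f v).
Proof.
move=> pf u w; have [p pE] := pf u w.
by exists (- p) => s; rewrite hornerN pE.
Qed.

Lemma polyl_sum (I : Type) (r : seq I) (h : I -> 'rV[R]_n -> R) :
  (forall i, polyl (h i)) -> polyl (fun v => \sum_(i <- r) h i v).
Proof.
move=> ph; elim: r => [|i r IH].
  rewrite (_ : (fun v => _) = fun=> 0); first exact: polyl_cst.
  by apply/funext => v; rewrite big_nil.
rewrite (_ : (fun v => _) = fun v => h i v + \sum_(j <- r) h j v); first exact: polylD.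
by apply/funext => v; rewrite big_cons.
Qed.

Lemma polyl_pairing b : polyl (pairing b).
Proof.
by apply: polyl_sum => i; apply: polylM; [exact: polyl_cst|exact: polyl_coord].
Qed.

Lemma polyl_bilin a : polyl (fun v => bilin a v v).
Proof.
apply: polyl_sum => i; apply: polyl_sum => j.
by do 2!(apply: polylM; last exact: polyl_coord); exact: polyl_cst.
Qed.

(** Moving in a direction with positive pairing leads into the half-space. *)
Lemma polyl_eq0 b f : polyl f -> b != 0 ->
  (forall v, 0 < pairing b v -> f v = 0) -> forall v, f v = 0.
Proof.
move=> pf b0 H v; have [q qE] := pf v b.
have bb := pairing_gt0 b0.
have q0 : q = 0.
  apply: (@poly_ray_eq0 _ (- pairing b v / pairing b b)) => s hs.
  by rewrite -qE; apply: H; rewrite pairingDr pairingZr -ltrBlDl sub0r -ltr_pdivrMr.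
by have := qE 0; rewrite scale0r addr0 q0 horner0.
Qed.

Definition trilin (t : 'I_n -> 'M[R]_n) u v w := \sum_k u 0 k * bilin (t k) v w.

Lemma trilin_line t u w : exists a1 a2, forall s,
  trilin t (u + s *: w) (u + s *: w) (u + s *: w) =
  trilin t u u u + a1 * s + a2 * s ^+ 2 + trilin t w w w * s ^+ 3.
Proof.
exists (trilin t w u u + trilin t u w u + trilin t u u w),
  (trilin t w w u + trilin t u w w + trilin t w u w) => s.
rewrite /trilin -!big_split !mulr_suml -!big_split; apply: eq_bigr => k _ /=.
by rewrite !bilinDl !bilinDr !bilinZl !bilinZr !mxE; ring.
Qed.

Lemma polyl_trilin t : polyl (fun v => trilin t v v v).
Proof.
apply: polyl_sum => k; apply: polylM; [exact: polyl_coord|exact: polyl_bilin].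
Qed.

Lemma trilinZ t c u : trilin t (c *: u) (c *: u) (c *: u) = c ^+ 3 * trilin t u u u.
Proof.
rewrite /trilin mulr_sumr; apply: eq_bigr => k _.
by rewrite bilinZl bilinZr mxE; ring.
Qed.

(** On each plane the cubic is the quadric times a linear form, so that their
    quotient is additive. *)
Lemma cubic_quotient_additive (a : 'M[R]_n) t b m u w :
  (forall i j, a i j = a j i) -> posdef a -> polyl m ->
  (forall v, 3 * (trilin t v v v * pairing b v) ^+ 2 = bilin a v v * m v) ->
  0 < pairing b u -> 0 < pairing b w ->
  trilin t (u + w) (u + w) (u + w) / bilin a (u + w) (u + w) =
  trilin t u u u / bilin a u u + trilin t w w w / bilin a w w.
Proof.
move=> asym apos pm Hm bu bw.
have nz v : 0 < pairing b v -> v != 0.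
  by apply: contraTneq => ->; rewrite pairing0r ltxx.
have Au : 0 < bilin a u u by apply/apos/nz.
have Aw : 0 < bilin a w w by apply/apos/nz.
have Auw : 0 < bilin a (u + w) (u + w).
  by apply/apos/nz; rewrite pairingDr addr_gt0.
have [[s us]|nuw] := pselect (exists s : R, u + s *: w = 0).
  have uE : u = (- s) *: w by apply/eqP; rewrite scaleNr -addr_eq0 us.
  move: (- s) uE => c uE.
  move: Au Auw; rewrite uE -[X in c *: w + X]scale1r -scalerDl !trilinZ.
  rewrite !bilinZl !bilinZr => Au Auw.
  have c1 : c + 1 != 0 by apply: contraTneq Auw => ->; rewrite !mul0r ltxx.
  have c0 : c != 0 by apply: contraTneq Au => ->; rewrite !mul0r ltxx.
  by have A0 := lt0r_neq0 Aw; field; rewrite A0 c0 c1.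
have qE s : bilin a (u + s *: w) (u + s *: w) =
    bilin a u u + (2 * bilin a u w) * s + bilin a w w * s ^+ 2.
  by rewrite !bilinDl !bilinDr !bilinZl !bilinZr (bilinC w u asym); ring.
have [a1 [a2 pE]] := trilin_line t u w.
have [q mE] := pm u w.
have [||||l0 [l1 [H H0 H3]]] := @quadratic_dvd_cubic (bilin a u u) (2 * bilin a u w)
  (bilin a w w) (trilin t u u u) a1 a2 (trilin t w w w) (pairing b u) (pairing b w) q.
- move=> s; rewrite -qE; apply: apos.
  by apply/eqP => us; apply: nuw; exists s.
- exact: lt0r_neq0.
- exact: lt0r_neq0.
- by move=> s; rewrite -pE -qE -mE -Hm pairingDr pairingZr (mulrC s).
have := H 1; rewrite -pE -qE !scale1r mulr1 => ->.
rewrite H0 H3; have Au0 := lt0r_neq0 Au; have Aw0 := lt0r_neq0 Aw.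
by have Auw0 := lt0r_neq0 Auw; field; rewrite Au0 Aw0 Auw0.
Qed.

End PolynomialAlongLines.

Ltac polyl_closed := do !(apply: polylD || apply: polylM || apply: polylN ||
  exact: polyl_cst || exact: polyl_pairing || exact: polyl_bilin ||
  exact: polyl_trilin || assumption).

(** * Projectively flat Kropina functions of constant curvature *)

Section PartialRules.
Context {R : realType} {n : nat}.
Implicit Types (g : 'rV[R]_n -> R) (v w : 'rV[R]_n).

Lemma partial_shift k g v w : partial k (fun t => g (t + w)) v = partial k g (v + w).
Proof.
rewrite /partial /derive.
suff -> : (fun h : R => h^-1 *: (((fun t => g (t + w)) \o shift v) (h *: delta_mx 0 k)
     - g (v + w)))
  = (fun h => h^-1 *: ((g \o shift (v + w)) (h *: delta_mx 0 k) - g (v + w))).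
  by [].
by apply/funext => h /=; rewrite addrA.
Qed.

Lemma partial_addc k g v (c : R) : partial k (fun t => g t + c) v = partial k g v.
Proof.
rewrite /partial /derive.
suff -> : (fun h : R => h^-1 *: (((fun t => g t + c) \o shift v) (h *: delta_mx 0 k)
     - (g v + c)))
  = (fun h => h^-1 *: ((g \o shift v) (h *: delta_mx 0 k) - g v)).
  by [].
by apply/funext => h /=; congr (_ *: _); ring.
Qed.

Lemma partial_sum (I : Type) (r : seq I) (h : I -> 'rV[R]_n -> R) k v :
  (forall i, differentiable (h i) v) ->
  partial k (fun x => \sum_(i <- r) h i x) v = \sum_(i <- r) partial k (h i) v.
Proof.
move=> dh.
have H : differentiable (fun x => \sum_(i <- r) h i x) v /\
  partial k (fun x => \sum_(i <- r) h i x) v = \sum_(i <- r) partial k (h i) v.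
  elim: r => [|i r [IHd IH]].
    have -> : (fun x => \sum_(i <- [::]) h i x) = fun=> 0.
      by apply/funext => x; rewrite big_nil.
    by rewrite big_nil partial_cst; split=> //; exact: differentiable_cst.
  have -> : (fun x => \sum_(j <- i :: r) h j x) = fun x => h i x + \sum_(j <- r) h j x.
    by apply/funext => x; rewrite big_cons.
  rewrite big_cons partialD // IH; split=> //.
  exact: differentiableD.
exact: H.2.
Qed.

Lemma partialMc k g v (c : R) : differentiable g v ->
  partial k (fun x => g x * c) v = partial k g v * c.
Proof.
move=> dg; rewrite partialM //.
by rewrite partial_cst mulr0 add0r mulrC.
Qed.

Lemma smooth_pairing (b : 'rV[R]_n) (U : set 'rV[R]_n) : open U -> smooth U (pairing b).
Proof.
by move=> oU; apply: smooth_sum => // i; apply: smoothM => //; [exact: smooth_cst|exact: smooth_coord].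
Qed.

Lemma partial_pairing_coord k (b v : 'rV[R]_n) : partial k (pairing b) v = b 0 k.
Proof.
have dc i : differentiable (fun z : 'rV[R]_n => z 0 i) v by exact: differentiable_coord.
rewrite partial_sum => [|i]; last by apply: differentiableM => //; exact: differentiable_cst.
under eq_bigr do rewrite partialM ?partial_cst ?mulr0 ?addr0 ?partial_coord //; last 1 first.
rewrite (bigD1 k) //= eqxx mulr1 big1 ?addr0 // => i /negPf ik.
by rewrite eq_sym ik mulr0.
Qed.

Lemma open_positive g : smooth setT g -> open [set v | 0 < g v].
Proof.
move=> sg; rewrite (_ : [set v | 0 < g v] = g @^-1` [set r : R | 0 < r]) //.
apply: open_comp; last exact: open_gt.
move=> v _; exact: differentiable_continuous (smooth_diff sg I).
Qed.

Lemma bilin_eq0 (s : 'M[R]_n) : (forall i j, s i j = s j i) ->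
  (forall v, bilin s v v = 0) -> s = 0.
Proof.
move=> ssym H; apply/matrixP => i j; rewrite mxE.
have := H (delta_mx 0 i + delta_mx 0 j).
rewrite bilinDl !bilinDr !H addr0 add0r !bilin_delta (ssym j) => /eqP.
by rewrite -mulr2n mulrn_eq0 /= => /eqP.
Qed.

End PartialRules.

Section LocalMinimum.
Context {R : realType} {n : nat}.

Lemma partial_at_min (U : set 'rV[R]_n) (h : 'rV[R]_n -> R) x l :
  open U -> U x -> smooth U h -> (forall z, U z -> h x <= h z) -> partial l h x = 0.
Proof.
move=> oU Ux sh hmin.
have /nbhs_ballP[r /= r0 Ur] := open_nbhs_nbhs (conj oU Ux).
pose g (t : R) := h (x + t *: delta_mx 0 l).
have inU (t : R) : `|t| < r -> U (x + t *: delta_mx 0 l).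
  move=> tr; apply: Ur; rewrite -ball_normE /= opprD addrA subrr sub0r normrN.
  exact: le_lt_trans (norm_delta_le l t) tr.
have gd (t : R) : `|t| < r -> is_derive t 1 g (partial l h (x + t *: delta_mx 0 l)).
  move=> tr; apply: is_derive_line; apply: smooth_diff sh _; exact: inU.
have : is_derive (0 : R) 1 g 0.
  apply: (@derive1_at_min _ g (- r) r); first by rewrite ge0_cp ?ltW.
  - by move=> t; rewrite in_itv /= -ltr_norml => /gd[].
  - by rewrite in_itv /= oppr_lt0 r0.
  - move=> t; rewrite in_itv /= -ltr_norml => tr.
    by rewrite /g scale0r addr0; apply: hmin; exact: inU.
have [_] := gd 0 (eq_ind_r (fun z => z < r) r0 (normr0 R)).
by rewrite scale0r addr0 => <- [].
Qed.

End LocalMinimum.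

Section ConstantCurvature.
Context {R : realType} {n : nat} (U : set 'rV[R]_n) (am : 'rV[R]_n -> 'M[R]_n)
  (bm : 'rV[R]_n -> 'rV[R]_n).
Hypothesis oU : open U.
Hypothesis sa : forall i j, smooth U (fun x => am x i j).
Hypothesis sb : forall i, smooth U (fun x => bm x 0 i).
Hypothesis asym : forall x, U x -> forall i j, am x i j = am x j i.
Hypothesis apos : forall x, U x -> posdef (am x).
Variable F : phase_space (cone U bm).
Local Notation X k := (@pd _ F (lshift n k)).
Local Notation Y k := (@pd _ F (rshift n k)).
Local Notation y i := (@pcoord _ F (rshift n i)).
Local Notation cone := (cone U bm).
Local Notation fA := (fA oU sa F).
Local Notation fB := (fB oU sb F).
Local Notation f := (fK oU sa sb F).
Local Notation base_lift := (base_lift oU F).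

Lemma cone_row x v : U x -> 0 < pairing (bm x) v -> cone (row_mx x v).
Proof. by move=> Ux bv; split; rewrite row_mxKl ?row_mxKr. Qed.

(** The functions that are polynomial in the velocity at every point; they are
    closed under all the derivations, so that [polyl_eq0] applies to every identity
    cleared of denominators. *)
Inductive fiber_polynomial : F -> Prop :=
| fp_base h (sh : smooth U h) : fiber_polynomial (base_lift sh)
| fp_coord i : fiber_polynomial (y i)
| fp_add g h : fiber_polynomial g -> fiber_polynomial h -> fiber_polynomial (g + h)
| fp_mul g h : fiber_polynomial g -> fiber_polynomial h -> fiber_polynomial (g * h).

Lemma fp_cst (a : R) (g : F) : (forall z, cone z -> ev g z = a) -> fiber_polynomial g.
Proof.
move=> gE; rewrite (_ : g = base_lift (@smooth_cst _ _ _ U a)); first exact: fp_base.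
by apply: evP => z Wz; rewrite gE // liftE.
Qed.

Lemma fp0 : fiber_polynomial 0.
Proof. by apply: (@fp_cst 0) => z; exact: ev0. Qed.

Lemma fp_sum (I : Type) (r : seq I) (g : I -> F) :
  (forall i, fiber_polynomial (g i)) -> fiber_polynomial (\sum_(i <- r) g i).
Proof.
move=> pg; elim: r => [|i r IH]; first by rewrite big_nil; exact: fp0.
by rewrite big_cons; exact: fp_add.
Qed.

Lemma fp_pd i g : fiber_polynomial g -> fiber_polynomial (pd i g).
Proof.
elim=> [h sh|j|g1 h1 _ IHg _ IHh|g1 h1 pg IHg ph IHh].
- case: (split_ordP i) => k ->.
    rewrite (_ : X k _ = base_lift (smooth_partial k sh)); first exact: fp_base.
    by apply: evP => z Wz; rewrite X_lift // liftE.
  by rewrite Y_lift; exact: fp0.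
- rewrite pd_coord; case: (i == _); last exact: fp0.
  by apply: (@fp_cst 1) => z; exact: ev1.
- by rewrite raddfD; exact: fp_add.
- by rewrite pdM; apply: fp_add; exact: fp_mul.
Qed.

Lemma fp_baseD g : fiber_polynomial g -> fiber_polynomial (baseD g).
Proof.
move=> pg; rewrite baseDE; apply: fp_sum => k.
by apply: fp_mul; [exact: fp_coord|exact: fp_pd].
Qed.

Lemma fp_fA : fiber_polynomial fA.
Proof.
apply: fp_sum => i; apply: fp_sum => j.
by do 2!(apply: fp_mul; last exact: fp_coord); exact: fp_base.
Qed.

Lemma fp_fB : fiber_polynomial fB.
Proof. by apply: fp_sum => i; apply: fp_mul; [exact: fp_base|exact: fp_coord]. Qed.

Lemma fp_eval g x : U x -> fiber_polynomial g ->
  exists h, polyl h /\ forall v, 0 < pairing (bm x) v -> ev g (row_mx x v) = h v.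
Proof.
move=> Ux; elim=> [h sh|j|g1 h1 _ [p [pp pE]] _ [q [pq qE]]|
                   g1 h1 _ [p [pp pE]] _ [q [pq qE]]].
- exists (fun=> h x); split=> [|v bv]; first exact: polyl_cst.
  by rewrite liftE ?row_mxKl //; exact: cone_row.
- exists (fun v => v 0 j); split=> [|v bv]; first exact: polyl_coord.
  by rewrite ev_y //; exact: cone_row.
- exists (fun v => p v + q v); split=> [|v bv]; first exact: polylD.
  by rewrite evD ?pE ?qE //; exact: cone_row.
- exists (fun v => p v * q v); split=> [|v bv]; first exact: polylM.
  by rewrite evM ?pE ?qE //; exact: cone_row.
Qed.

Definition dBm x : 'M[R]_n := \matrix_(k, i) partial k (fun x => bm x 0 i) x.
Definition dAm x k : 'M[R]_n := \matrix_(i, j) partial k (fun x => am x i j) x.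

Lemma ev_X_fB x v k : cone (row_mx x v) ->
  ev (X k fB) (row_mx x v) = pairing (row k (dBm x)) v.
Proof.
move=> Wz; rewrite X_linear.
rewrite ev_linear // row_mxKr; congr (pairing _ _).
by apply/rowP => i; rewrite !mxE X_lift // row_mxKl.
Qed.

Lemma ev_X_fA x v k : cone (row_mx x v) ->
  ev (X k fA) (row_mx x v) = bilin (dAm x k) v v.
Proof.
move=> Wz; rewrite X_quadratic ev_quadratic // row_mxKr; congr (bilin _ _ _).
by apply/matrixP => i j; rewrite !mxE X_lift // row_mxKl.
Qed.

Lemma ev_baseD_fB x v : cone (row_mx x v) ->
  ev (baseD fB) (row_mx x v) = bilin (dBm x) v v.
Proof.
move=> Wz; rewrite baseDE ev_sum //; apply: eq_bigr => k _.
rewrite evM // ev_y // ev_X_fB // /pairing mulr_sumr; apply: eq_bigr => i _.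
by rewrite [row _ _ _ _]mxE; ring.
Qed.

Lemma ev_baseD_fA x v : cone (row_mx x v) ->
  ev (baseD fA) (row_mx x v) = trilin (dAm x) v v v.
Proof.
move=> Wz; rewrite baseDE ev_sum //; apply: eq_bigr => k _.
by rewrite evM // ev_y // ev_X_fA.
Qed.

Variable p : F.
Hypothesis hp : p * f *+ 2 = baseD f.
Hypothesis EL : euler_lagrange (fun i => p * y i) (f * f).

Let f0 z : cone z -> ev f z != 0.
Proof. by move=> Wz; exact/lt0r_neq0/fK_gt0. Qed.

Let hf : euler f = f. Proof. exact: euler_fK. Qed.

(** This and the next four identities come from differentiating
    [fB * fK = fA], using [hp] and [hamel]; they contain no division. *)
Lemma baseD_quotient : baseD fA = baseD fB * f + (p * fA) *+ 2.
Proof. by rewrite -(fBK oU sa sb F) baseDM -hp; ring. Qed.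

Lemma baseD2_quotient : baseD (baseD fA) = baseD (baseD fB) * f +
  baseD fB * (p * f *+ 2) + (baseD p * fA + p * baseD fA) *+ 2.
Proof.
by rewrite {1}baseD_quotient raddfD /= raddfMn /= !baseDM -hp.
Qed.

Lemma Y_quotient l : b_ oU sb F l * f + fB * Y l f = Y l fA.
Proof. by rewrite -(fBK oU sa sb F) pdM (Y_linear (Y_b oU sb F)). Qed.

Lemma X_quotient l : X l fB * f + fB * X l f = X l fA.
Proof. by rewrite -(fBK oU sa sb F) pdM. Qed.

Lemma hamel_quotient l : baseD (b_ oU sb F l) * f + b_ oU sb F l * (p * f *+ 2)
  + baseD fB * Y l f + fB * X l f = baseD (Y l fA).
Proof. by rewrite -Y_quotient raddfD /= !baseDM -hp (hamel f0 hf EL); ring. Qed.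

Section Point.
Variable x : 'rV[R]_n.
Hypothesis Ux : U x.
Hypothesis b0 : bm x != 0.

Let Bf v := pairing (bm x) v.
Let Af v := bilin (am x) v v.
Let B0f v := bilin (dBm x) v v.
Let A0f v := trilin (dAm x) v v v.

Let ev_A v : 0 < Bf v -> ev fA (row_mx x v) = Af v.
Proof. by move=> bv; rewrite ev_fA ?row_mxKl ?row_mxKr //; exact: cone_row. Qed.
Let ev_B v : 0 < Bf v -> ev fB (row_mx x v) = Bf v.
Proof. by move=> bv; rewrite ev_fB ?row_mxKl ?row_mxKr //; exact: cone_row. Qed.
Let evf v : 0 < Bf v -> ev f (row_mx x v) = Af v / Bf v.
Proof. by move=> bv; rewrite ev_fK ?ev_A ?ev_B //; exact: cone_row. Qed.

Let A_gt0 v : v != 0 -> 0 < Af v. Proof. exact: apos. Qed.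
Let Bnz v : 0 < Bf v -> v != 0.
Proof. by apply: contraTneq => ->; rewrite /Bf pairing0r ltxx. Qed.

Let pE v : 0 < Bf v ->
  ev p (row_mx x v) = (A0f v * Bf v - B0f v * Af v) / (2 * Af v * Bf v).
Proof.
move=> bv; have Wz := cone_row Ux bv.
have := congr1 (fun g => ev g (row_mx x v)) baseD_quotient => /=.
rewrite ev_baseD_fA // evD // evM // evMn // evM // ev_baseD_fB // evf // ev_A //.
rewrite -/(A0f v) -/(B0f v) => ->.
have A1 := lt0r_neq0 (A_gt0 (Bnz bv)); have B1 := lt0r_neq0 bv.
by field; rewrite A1 B1.
Qed.

(** Hamel's equation multiplied by the cube of [fB] and read on the hyperplane
    where [fB] vanishes. *)
Lemma dB_on_kernel v : Bf v = 0 -> B0f v = 0.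
Proof.
move=> Bv0; have [->|v0] := eqVneq v 0.
  by rewrite /B0f bilin_pairing pairing0r.
have /rV0Pn[l bl] := b0.
have [da [pda daE]] := fp_eval Ux (fp_baseD (fp_pd (rshift n l) fp_fA)).
have [dbl [pdbl dblE]] := fp_eval Ux (fp_baseD (fp_base (sb l))).
have [al [pal alE]] := fp_eval Ux (fp_pd (rshift n l) fp_fA).
have [xa [pxa xaE]] := fp_eval Ux (fp_pd (lshift n l) fp_fA).
have [xb [pxb xbE]] := fp_eval Ux (fp_pd (lshift n l) fp_fB).
pose b_l := bm x 0 l.
pose I v := dbl v * Af v * Bf v + b_l * (A0f v * Bf v + - (B0f v * Af v))
  + B0f v * (al v * Bf v + - (b_l * Af v)) + xa v * Bf v * Bf v
  + - (xb v * Af v * Bf v) + - (da v * Bf v * Bf v).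
have pI : polyl I.
  by rewrite /I; polyl_closed.
have I0 : forall v, I v = 0.
  apply: (polyl_eq0 pI b0) => w bw; have Wz := cone_row Ux bw.
  have A1 := lt0r_neq0 (A_gt0 (Bnz bw)); have B1 := lt0r_neq0 bw.
  have h1 := congr1 (fun g => ev g (row_mx x w)) (hamel_quotient l).
  have h2 := congr1 (fun g => ev g (row_mx x w)) (Y_quotient l).
  have h3 := congr1 (fun g => ev g (row_mx x w)) (X_quotient l).
  move: h1 h2 h3; rewrite !evD // !evM // evMn // evM //.
  rewrite ev_B // evf // ev_baseD_fB // -/(B0f w) daE // alE // xaE // xbE //.
  rewrite (dblE w bw) liftE // row_mxKl -/b_l pE //.
  set fl := ev (Y l f) _; set xf := ev (X l f) _ => h1 h2 h3.
  have flE : fl = (al w - b_l * (Af w / Bf w)) / Bf w by rewrite -h2; field.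
  have xfE : xf = (xa w - xb w * (Af w / Bf w)) / Bf w by rewrite -h3; field.
  by rewrite /I -h1 flE xfE; field; rewrite A1 B1.
have := I0 v; rewrite /I Bv0 !mulr0 !add0r oppr0 !addr0 => e.
have : b_l * (B0f v * Af v) * 2 = 0 by rewrite -[RHS]oppr0 -e; ring.
move=> /eqP; rewrite !mulf_eq0 pnatr_eq0 orbF (negPf bl) /=.
by rewrite (negPf (lt0r_neq0 (A_gt0 v0))) orbF => /eqP.
Qed.

Variables (K : R).
Hypothesis hn : (2 <= n)%N.
Hypothesis hK : forall v, 0 < Bf v ->
  ev (p * p - baseD p) (row_mx x v) = K * ev f (row_mx x v) ^+ 2.

(** The curvature equation [p ^ 2 - baseD p = K * f ^ 2] cleared of denominators.
    Being polynomial in the velocity, it holds for all [v], in particular where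
    [Bf v = 0] and the metric itself is not defined. *)
Let cleared_curvature : exists m1 m2, [/\ polyl m1, polyl m2 & forall v,
  (A0f v * Bf v - Af v * B0f v) * (3 * A0f v * Bf v + Af v * B0f v)
   - 2 * Af v * Bf v * (m1 v * Bf v - m2 v * Af v) = 4 * K * Af v ^+ 4].
Proof.
have [m1 [pm1 m1E]] := fp_eval Ux (fp_baseD (fp_baseD fp_fA)).
have [m2 [pm2 m2E]] := fp_eval Ux (fp_baseD (fp_baseD fp_fB)).
exists m1, m2; split=> //.
pose I v := (A0f v * Bf v + - (Af v * B0f v)) * (3 * A0f v * Bf v + Af v * B0f v)
   + - (2 * Af v * Bf v * (m1 v * Bf v + - (m2 v * Af v)))
   + - (4 * K * (Af v * Af v * (Af v * Af v))).
have pI : polyl I.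
  by rewrite /I; polyl_closed.
have I0 : forall v, I v = 0.
  apply: (polyl_eq0 pI b0) => w bw; have Wz := cone_row Ux bw.
  have A1 := lt0r_neq0 (A_gt0 (Bnz bw)); have B1 := lt0r_neq0 bw.
  have h1 := congr1 (fun g => ev g (row_mx x w)) baseD2_quotient.
  move: h1 (hK bw) => /=; rewrite evB // !(evD, evM, evMn) //.
  rewrite evf // ev_baseD_fB // ev_baseD_fA // ev_A // m1E // m2E // pE //.
  rewrite -/(A0f w) -/(B0f w); set dp := ev (baseD p) _ => h1 h2.
  set P := (A0f w * Bf w - B0f w * Af w) / (2 * Af w * Bf w) in h1 h2.
  have dpE : dp = P * P - K * (Af w / Bf w) ^+ 2 by rewrite -h2; ring.
  by rewrite /I h1 dpE /P; field; rewrite A1 B1.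
by move=> v; apply/subr0_eq; rewrite -[RHS](I0 v) /I; ring.
Qed.

(** On the hyperplane [Bf v = 0] every term but the multiple of [K] vanishes, by
    [dB_on_kernel]. *)
Lemma curvature_eq0 : K = 0.
Proof.
have [m1 [m2 [_ _ H]]] := cleared_curvature.
have [v v0 Bv] : exists2 v, v != 0 & Bf v = 0.
  have /rV0Pn[l bl] := b0.
  have [k kl] := exists_neq hn l.
  exists (bm x 0 l *: delta_mx 0 k - bm x 0 k *: delta_mx 0 l).
    apply/rV0Pn; exists k; rewrite !mxE !eqxx (negPf kl) mulr1 mulr0 subr0 //.
  by rewrite /Bf pairingDr pairingNr !pairingZr !pairing_delta mulrC subrr.
have := H v; rewrite (dB_on_kernel Bv) Bv !mulr0 !mul0r !subr0 mul0r.
have A4 : Af v ^+ 4 != 0 by rewrite expf_neq0 // (lt0r_neq0 (A_gt0 v0)).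
move=> /esym e; apply: (mulIf A4); rewrite mul0r.
by apply: (@mulfI _ 4); rewrite ?pnatr_eq0 // mulr0 mulrA.
Qed.

(** With [K = 0] the curvature equation says that the quadric [Af] divides
    [3 (A0f Bf) ^ 2], so [A0f / Af] is additive; [B0f / Bf] is additive because
    [B0f] vanishes where [Bf] does. *)
Lemma projective_factor_additive u w : 0 < Bf u -> 0 < Bf w ->
  ev p (row_mx x (u + w)) = ev p (row_mx x u) + ev p (row_mx x w).
Proof.
move=> bu bw; have bs : 0 < Bf (u + w) by rewrite /Bf pairingDr addr_gt0.
have [m1 [m2 [pm1 pm2 H]]] := cleared_curvature; rewrite curvature_eq0 in H.
pose m v := 2 * Bf v * (m1 v * Bf v + - (m2 v * Af v)) + 2 * A0f v * B0f v * Bf v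
   + Af v * (B0f v * B0f v).
have pm : polyl m.
  by rewrite /m; polyl_closed.
have Hm v : 3 * (A0f v * Bf v) ^+ 2 = Af v * m v.
  apply/subr0_eq; transitivity (4 * 0 * Af v ^+ 4); last by rewrite mulr0 mul0r.
  by rewrite -H /m; ring.
have fadd := cubic_quotient_additive (asym Ux) (apos Ux) pm Hm bu bw.
have k0 : Bf (Bf w *: u - Bf u *: w) = 0.
  by rewrite /Bf pairingDr pairingNr !pairingZr mulrC subrr.
have := dB_on_kernel k0; rewrite /B0f -scaleNr !bilinDl !bilinDr !bilinZl !bilinZr => e.
have pE' v : 0 < Bf v ->
    ev p (row_mx x v) = 2^-1 * (A0f v / Af v) - 2^-1 * (B0f v / Bf v).
  move=> bv; rewrite pE //.
  have A1 := lt0r_neq0 (A_gt0 (Bnz bv)); have B1 := lt0r_neq0 bv.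
  by field; rewrite A1 B1.
rewrite !pE' // /A0f /Af fadd.
have u1 := lt0r_neq0 bu; have w1 := lt0r_neq0 bw; have s1 := lt0r_neq0 bs.
suff -> : B0f (u + w) / Bf (u + w) = B0f u / Bf u + B0f w / Bf w by ring.
rewrite /B0f !bilinDl !bilinDr; move: s1; rewrite /Bf pairingDr -/(Bf u) -/(Bf w) => s1.
have e' : bilin (dBm x) u w + bilin (dBm x) w u =
  (Bf w ^+ 2 * bilin (dBm x) u u + Bf u ^+ 2 * bilin (dBm x) w w) / (Bf u * Bf w).
  apply: (mulIf (mulf_neq0 u1 w1)); rewrite divfK ?mulf_neq0 //.
  by apply/subr0_eq; rewrite -[RHS]oppr0 -e; ring.
set b1 := bilin _ u u; set b2 := bilin _ w w.
transitivity ((b1 + (bilin (dBm x) u w + bilin (dBm x) w u) + b2) / (Bf u + Bf w)).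
  by congr (_ / _); ring.
by rewrite e' -/b1 -/b2; field; rewrite u1 w1 s1.
Qed.

End Point.

Variables (L0 : 'rV[R]_n -> 'rV[R]_n -> R) (K : R).
Hypothesis rL0 : represents L0 f.
Hypothesis hn : (2 <= n)%N.
Hypothesis flag : forall x v, cone (row_mx x v) -> flag_curvature_at L0 K x v.
Hypothesis nd0 : forall x v, cone (row_mx x v) -> fundamental_tensor L0 x v \in unitmx.
Hypothesis unit : forall x, U x -> bilin (invmx (am x)) (bm x) (bm x) = 1.

Lemma unit_neq0 x : U x -> bm x != 0.
Proof.
move=> Ux; apply/eqP => b0; have := unit Ux; rewrite b0 bilin_pairing pairing0r => /esym/eqP.
by rewrite oner_eq0.
Qed.

Let bb_gt0 x : U x -> 0 < pairing (bm x) (bm x).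
Proof. by move=> Ux; exact/pairing_gt0/unit_neq0. Qed.

Let curvature x v : cone (row_mx x v) ->
  ev (p * p - baseD p) (row_mx x v) = K * ev f (row_mx x v) ^+ 2 /\
  forall k, ev (X k p *+ 2 - baseD (Y k p) - p * Y k p) (row_mx x v)
     = - K * lower_y L0 k x v.
Proof.
move=> Wz; have v0 : v != 0 by have := cone_neq0 Wz; rewrite row_mxKr.
exact: (projectively_flat_curvature f0 hf hp EL rL0 nd0 hn Wz v0 (flag Wz)).
Qed.

Let K0 x : U x -> K = 0.
Proof.
move=> Ux; apply: (curvature_eq0 Ux (unit_neq0 Ux) hn) => v bv.
exact: (curvature (cone_row Ux bv)).1.
Qed.

Let pD x u w : U x -> 0 < pairing (bm x) u -> 0 < pairing (bm x) w ->
  ev p (row_mx x (u + w)) = ev p (row_mx x u) + ev p (row_mx x w).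
Proof.
move=> Ux bu bw.
apply: (projective_factor_additive Ux (unit_neq0 Ux) hn _ bu bw) => v bv.
exact: (curvature (cone_row Ux bv)).1.
Qed.

(** As [p] is additive in the velocity, it is linear, and its coefficients can be
    read at any velocity of the half space, here at the components of the form
    themselves. *)
Definition projective_covector x : 'rV[R]_n := \row_k ev (Y k p) (row_mx x (bm x)).

Let repp : represents (fun x v => ev p (row_mx x v)) p. Proof. by []. Qed.

Let Yp_shift x k u w : U x -> 0 < pairing (bm x) u -> 0 < pairing (bm x) w ->
  ev (Y k p) (row_mx x (u + w)) = ev (Y k p) (row_mx x u).
Proof.
move=> Ux bu bw.
have bs : 0 < pairing (bm x) (u + w) by rewrite pairingDr addr_gt0.
rewrite -(represents_dy k repp (cone_row Ux bs)) -(represents_dy k repp (cone_row Ux bu)).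
pose g t := ev p (row_mx x t).
transitivity (partial k (fun t => g (t + w)) u); first exact/esym/partial_shift.
transitivity (partial k (fun t => g t + g w) u); last exact: partial_addc.
by apply: (partial_on k (open_positive (smooth_pairing (bm x) openT)) bu) => t bt; exact: pD.
Qed.

Lemma projective_covectorE x v k : U x -> 0 < pairing (bm x) v ->
  ev (Y k p) (row_mx x v) = projective_covector x 0 k.
Proof.
move=> Ux bv; rewrite mxE -(Yp_shift k Ux bv (bb_gt0 Ux)) addrC.
exact: Yp_shift (bb_gt0 Ux) bv.
Qed.

Lemma projective_factorE x v : U x -> 0 < pairing (bm x) v ->
  ev p (row_mx x v) = pairing (projective_covector x) v.
Proof.
move=> Ux bv; have Wz := cone_row Ux bv.
rewrite -{1}(euler_projective f0 hf hp) eulerE ev_sum //; apply: eq_bigr => k _.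
by rewrite evM // ev_y // projective_covectorE // mulrC.
Qed.

Lemma smooth_projective_covector k : smooth U (fun x => projective_covector x 0 k).
Proof.
apply: (smooth_ext oU (f := fun x => ev (Y k p) (row_mx x (bm x)))).
  by move=> x _; rewrite mxE.
apply: (smooth_comp oU (phase_open F) _ _ (ev_smooth (Y k p))).
  by move=> x Ux; apply: cone_row => //; exact: bb_gt0.
apply/smooth_mxP => // r c; rewrite ord1; case: (split_ordP c) => i ->.
  apply: (smooth_ext oU (f := fun x => x 0 i)); last exact: smooth_coord.
  by move=> x _; rewrite row_mxEl.
by apply: (smooth_ext oU _ (sb i)) => x _; rewrite row_mxEr.
Qed.

Let repf k : represents (fun x _ => projective_covector x 0 k) (Y k p).
Proof.
move=> x v Wz; have := Wz; case; rewrite row_mxKl row_mxKr => Ux bv.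
by rewrite projective_covectorE.
Qed.

(** The second half of the curvature equations with [K = 0], solved for the
    partial derivatives of the covector. *)
Lemma projective_covector_ode x j k : U x ->
  partial j (fun z => projective_covector z 0 k) x =
    projective_covector x 0 k * projective_covector x 0 j.
Proof.
move=> Ux; pose dP j k := partial j (fun z => projective_covector z 0 k) x.
have XY i l v : 0 < pairing (bm x) v -> ev (X i (Y l p)) (row_mx x v) = dP i l.
  by move=> bv; rewrite -(represents_dx i (repf l) (cone_row Ux bv)).
have H l : forall v, pairing (\row_i (2 * dP l i - dP i l
    - projective_covector x 0 i * projective_covector x 0 l)) v = 0.
  apply: (polyl_eq0 (polyl_pairing _) (unit_neq0 Ux)) => v bv.
  have Wz := cone_row Ux bv.
  have := (curvature Wz).2 l; rewrite (K0 Ux) oppr0 mul0r => <-.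
  rewrite !evB // evMn // evM // projective_factorE // projective_covectorE //.
  have -> : X l p = \sum_i y i * X l (Y i p).
    rewrite -{1}(euler_projective f0 hf hp) X_euler eulerE.
    by apply: eq_bigr => i _; rewrite pdC.
  rewrite baseDE !ev_sum // -sumrMnl /pairing mulr_suml -!sumrB.
  apply: eq_bigr => i _; rewrite !evM // !ev_y // !XY // mxE -mulr_natl; ring.
have {}H i l : 2 * dP l i - dP i l = projective_covector x 0 i * projective_covector x 0 l.
  by have := H l (delta_mx 0 i); rewrite pairing_delta mxE => /subr0_eq.
have e1 := H k j; have e2 := H j k; rewrite mulrC in e2.
by rewrite -/(dP j k); lra.
Qed.

Let dsa x i j : U x -> differentiable (fun x => am x i j) x.
Proof. exact: smooth_diff. Qed.
Let dsb x i : U x -> differentiable (fun x => bm x 0 i) x.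
Proof. exact: smooth_diff. Qed.

Lemma partial_pairing x v l : U x ->
  partial l (fun z => pairing (bm z) v) x = pairing (row l (dBm x)) v.
Proof.
move=> Ux; rewrite partial_sum.
  by apply: eq_bigr => i _; rewrite partialMc ?mxE ?mxE //; exact: dsb.
by move=> i; apply: differentiableM; [exact: dsb|exact: differentiable_cst].
Qed.

Lemma partial_bilin x v l : U x ->
  partial l (fun z => bilin (am z) v v) x = bilin (dAm x l) v v.
Proof.
move=> Ux.
have d1 i j : differentiable (fun z => am z i j * v 0 i * v 0 j) x.
  by do 2!(apply: differentiableM; last exact: differentiable_cst); exact: dsa.
rewrite partial_sum.
  apply: eq_bigr => i _; rewrite partial_sum //; apply: eq_bigr => j _.
  rewrite partialMc; first by rewrite partialMc ?mxE //; exact: dsa.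
  by apply: differentiableM; [exact: dsa|exact: differentiable_cst].
move=> i; rewrite (_ : (fun _ => _) = \sum_j (fun z => am z i j * v 0 i * v 0 j)).
  exact: differentiable_sum.
by apply/funext => z; rewrite fct_sumE.
Qed.

Section Unit.
Variable x : 'rV[R]_n.
Hypothesis Ux : U x.

Let sharp : 'rV[R]_n := bm x *m invmx (am x).

Let ua : am x \in unitmx. Proof. exact/posdef_unit/apos. Qed.

Let bilin_sharp w : bilin (am x) sharp w = pairing (bm x) w.
Proof. exact: bilin_invmx. Qed.

Let pairing_sharp : pairing (bm x) sharp = 1.
Proof. by rewrite pairing_invmx unit. Qed.

(** The unit length makes [am v v - (bm v) ^ 2] nonnegative with value zero at the
    dual vector, so that its derivatives in the position vanish there. *)
Let unit_derivative l :
  bilin (dAm x l) sharp sharp = 2 * pairing (row l (dBm x)) sharp.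
Proof.
pose h z := bilin (am z) sharp sharp - pairing (bm z) sharp * pairing (bm z) sharp.
have sA : smooth U (fun z => bilin (am z) sharp sharp).
  apply: smooth_sum => // i; apply: smooth_sum => // j.
  by do 2!(apply: smoothM => //; last exact: smooth_cst).
have sB : smooth U (fun z => pairing (bm z) sharp).
  by apply: smooth_sum => // i; apply: smoothM => //; exact: smooth_cst.
have sBB := smoothM oU sB sB.
have sh : smooth U h by apply: smoothD => //; exact: smoothN.
have h0 z : U z -> h x <= h z.
  move=> Uz; have := cauchy_schwarz (bm z) sharp (asym Uz) (apos Uz).
  rewrite (unit Uz) mul1r /h bilin_sharp pairing_sharp mulr1 subrr.
  by rewrite subr_ge0 expr2.
have := partial_at_min l oU Ux sh h0.
have -> : partial l h x = partial l (fun z => bilin (am z) sharp sharp) x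
   + -1 * partial l (fun z => pairing (bm z) sharp * pairing (bm z) sharp) x.
  rewrite /h partialD; [|exact: smooth_diff sA Ux|exact: smooth_diff (smoothN oU sBB) Ux].
  congr (_ + _); rewrite (partial_on l
    (g := fun z => pairing (bm z) sharp * pairing (bm z) sharp * -1) oU Ux).
    by rewrite partialMc ?mulN1r ?mulrN1 //; exact: smooth_diff sBB Ux.
  by move=> z _; rewrite mulrN1.
rewrite partial_bilin // partialM; [|exact: smooth_diff sB Ux|exact: smooth_diff sB Ux].
rewrite partial_pairing // pairing_sharp => e; lra.
Qed.

Let dAm_sym l i j : dAm x l i j = dAm x l j i.
Proof.
by rewrite !mxE; apply: (partial_on l oU Ux) => z Uz; exact: asym.
Qed.

(** The equation [X_l f = Y_l (p f)] with linear [p] splits, by divisibility of the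
    polynomials [fA] and [fB], into equations for both tensors up to a common
    covector [mu]; the unit length of the form identifies [mu] with the covector
    of [p]. *)
Theorem metric_form_ode l :
  (forall i j, partial l (fun z => am z i j) x = projective_covector x 0 i * am x l j
     + projective_covector x 0 j * am x l i + 2 * projective_covector x 0 l * am x i j) /\
  (forall i, partial l (fun z => bm z 0 i) x =
     projective_covector x 0 i * bm x 0 l + projective_covector x 0 l * bm x 0 i).
Proof.
pose P := projective_covector x.
pose D v := pairing (row l (dBm x)) v - pairing P v * bm x 0 l.
pose al v := pairing (row l (am x)) v.
pose T v := bilin (dAm x l) v v - P 0 l * bilin (am x) v v - pairing P v * (2 * al v).
have I2 : forall v, T v * pairing (bm x) v + - (bilin (am x) v v * D v) = 0.
  apply: (polyl_eq0 _ (unit_neq0 Ux)) => [|v bv].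
    by rewrite /T /D /al; polyl_closed.
  have Wz := cone_row Ux bv.
  have := congr1 (fun g => ev g (row_mx x v)) (X_projective f0 hf hp EL l).
  have := congr1 (fun g => ev g (row_mx x v)) (Y_quotient l).
  have := congr1 (fun g => ev g (row_mx x v)) (X_quotient l) => /=.
  rewrite pdM !evD // !evM // projective_covectorE // projective_factorE //.
  rewrite ev_X_fA // ev_X_fB // liftE // row_mxKl -/P.
  have -> : ev (Y l fA) (row_mx x v) = 2 * al v.
    rewrite Y_quadratic; [|exact: Y_a|exact: a_sym].
    rewrite evMn // ev_linear // row_mxKr mulr_natl; congr (pairing _ _ *+ 2).
    by apply/rowP => j; rewrite !mxE liftE // row_mxKl.
  have BF : ev fB (row_mx x v) * ev f (row_mx x v) = bilin (am x) v v.
    by rewrite -evM // fBK ev_fA // row_mxKl row_mxKr.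
  have BE : ev fB (row_mx x v) = pairing (bm x) v.
    by rewrite ev_fB // row_mxKl row_mxKr.
  rewrite BE in BF *.
  rewrite /T /D -BF; move: (ev f _) (ev (X l f) _) (ev (Y l f) _) => F0 xf yf e1 e2 e3.
  by rewrite -e1 e3 -e2; ring.
pose mu := D sharp.
have DD u w : D (u + w) = D u + D w by rewrite /D !pairingDr; ring.
have DZ c u : D (c *: u) = c * D u by rewrite /D !pairingZr; ring.
have Dmu v : D v = pairing (bm x) v * mu.
  pose w := v - pairing (bm x) v *: sharp.
  have bw : pairing (bm x) w = 0.
    by rewrite /w -scaleNr pairingDr pairingZr pairing_sharp mulr1 subrr.
  suff : D w = 0.
    by rewrite /w -scaleNr DD DZ mulNr -/mu => /subr0_eq.
  have [->|w0] := eqVneq w 0.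
    by rewrite /D !pairing0r mul0r subrr.
  have := I2 w; rewrite bw mulr0 add0r => /eqP; rewrite oppr_eq0 mulf_eq0.
  by rewrite (negPf (lt0r_neq0 (apos Ux w0))) => /eqP.
have Tmu : forall v, T v + - (mu * bilin (am x) v v) = 0.
  apply: (polyl_eq0 _ (unit_neq0 Ux)) => [|v bv].
    by rewrite /T /D /al; polyl_closed.
  apply: (mulIf (lt0r_neq0 bv)); rewrite mul0r -[RHS](I2 v) Dmu; ring.
have al_sharp : al sharp = bm x 0 l.
  rewrite -(pairing_delta (bm x) l) -bilin_sharp (bilinC _ _ (asym Ux)).
  by rewrite bilin_pairing -rowE.
have muP : mu = P 0 l.
  have gen (q m pl ps bl : R) :
    2 * q - pl * 1 - ps * (2 * bl) + - (m * 1) = 0 -> m = q - ps * bl -> m = pl.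
    by move=> ? ?; lra.
  apply: (gen (pairing (row l (dBm x)) sharp) _ _ (pairing P sharp) (bm x 0 l)) => //.
  have := Tmu sharp; rewrite /T unit_derivative.
  by rewrite (_ : bilin (am x) sharp sharp = 1) ?al_sharp // bilin_sharp.
split=> [i j|i]; last first.
  have := Dmu (delta_mx 0 i); rewrite /D !pairing_delta [row _ _ _ _]mxE muP mxE => e.
  by rewrite -/P; lra.
pose s := \matrix_(i, j) (dAm x l i j - P 0 l * am x i j
   - (P 0 i * am x l j + P 0 j * am x l i) - mu * am x i j).
have s0 : s = 0.
  apply: bilin_eq0 => [i' j'|v].
    by rewrite [LHS]mxE [RHS]mxE dAm_sym (asym Ux i' j'); ring.
  rewrite -[RHS](Tmu v) /T /al.
  have e1 : \sum_i \sum_j P 0 i * am x l j * v 0 i * v 0 j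
     = pairing P v * pairing (row l (am x)) v.
    rewrite /pairing mulr_suml; apply: eq_bigr => i' _; rewrite mulr_sumr.
    by apply: eq_bigr => j' _; rewrite [row _ _ _ _]mxE; ring.
  have e2 : \sum_i \sum_j P 0 j * am x l i * v 0 i * v 0 j
     = pairing P v * pairing (row l (am x)) v.
    rewrite -e1 exchange_big; apply: eq_bigr => i' _; apply: eq_bigr => j' _.
    by ring.
  transitivity (bilin (dAm x l) v v - P 0 l * bilin (am x) v v
    - (pairing P v * pairing (row l (am x)) v + pairing P v * pairing (row l (am x)) v)
    - mu * bilin (am x) v v); last by ring.
  rewrite -{1}e1 -e2 /bilin !mulr_sumr -!big_split -!sumrB /=.
  apply: eq_bigr => i' _; rewrite !mulr_sumr -!big_split -!sumrB /=.
  by apply: eq_bigr => j' _; rewrite mxE; ring.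
have := congr1 (fun m : 'M[R]_n => m i j) s0; rewrite !mxE muP -/P => e.
move: e; set t := (partial l _ x).
by move=> e; apply/subr0_eq; rewrite -[RHS]e /P [projective_covector x 0 l]mxE; ring.
Qed.

End Unit.
End ConstantCurvature.

(** * Orthonormal frames and changes of charts *)

Section Frames.
Context {R : realType} {n : nat}.
Implicit Types (a : 'M[R]_n.+1) (u v w : 'rV[R]_n.+1).

(** A vector orthogonal to the rows of [V] exists by counting ranks. *)
Lemma extend_orthonormal a k (V : 'M[R]_(k, n.+1)) :
  (forall i j, a i j = a j i) -> posdef a -> (k < n.+1)%N ->
  V *m a *m V^T = 1%:M ->
  exists w : 'rV[R]_n.+1, (col_mx V w) *m a *m (col_mx V w)^T = 1%:M.
Proof.
move=> asym apos kn VV.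
have : kermx (a *m V^T) != 0.
  by rewrite kermx_eq0 /row_free neq_ltn (leq_ltn_trans (rank_leq_col _) kn).
case/rowV0Pn => u /sub_kermxP uV u0.
have au := apos u u0.
pose w := (Num.sqrt (bilin a u u))^-1 *: u.
have aT : a^T = a by apply/matrixP => i j; rewrite mxE asym.
have wV : w *m a *m V^T = 0 by rewrite -mulmxA -scalemxAl uV scaler0.
have Vw : V *m a *m w^T = 0.
  by have := congr1 trmx wV; rewrite !trmx_mul trmxK aT trmx0 mulmxA.
have ww : w *m a *m w^T = 1%:M.
  apply/matrixP => i j; rewrite !ord1 -bilin_mx /w bilinZl bilinZr mxE eqxx.
  have s0 : Num.sqrt (bilin a u u) != 0 by rewrite sqrtr_eq0 -ltNge.
  have := sqr_sqrtr (ltW au); move: (Num.sqrt _) s0 => s s0 <-.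
  by rewrite mulr1n; field.
exists w; rewrite tr_col_mx mul_col_mx mul_col_row VV wV Vw ww.
by rewrite -scalar_mx_block.
Qed.

(** Gram-Schmidt orthonormalisation starting from a given unit vector. *)
Lemma orthonormal_frame a u : (forall i j, a i j = a j i) -> posdef a ->
  bilin a u u = 1 ->
  exists V : 'M[R]_n.+1, V *m a *m V^T = 1%:M /\ row ord0 V = u.
Proof.
move=> asym apos uu.
have H k : (k <= n)%N -> exists V : 'M[R]_(k.+1, n.+1),
    V *m a *m V^T = 1%:M /\ row ord0 V = u.
  elim: k => [_|k IH kn].
    exists u; split; last by apply/rowP => i; rewrite mxE.
    by apply/matrixP => i j; rewrite !ord1 -bilin_mx uu mxE eqxx.
  have [V [VV Vu]] := IH (ltnW kn).
  have [w ww] := @extend_orthonormal a k.+1 V asym apos kn VV.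
  exists (castmx (addn1 k.+1, erefl) (col_mx V w)); split.
    case: _ / (addn1 k.+1) ; exact: ww.
  rewrite -[RHS]Vu; apply/rowP => j; rewrite !mxE castmxE /=.
  rewrite (_ : cast_ord _ _ = lshift 1 ord0) ?col_mxEu; last exact: val_inj.
  by rewrite cast_ord_id.
exact: H.
Qed.

End Frames.

Section Jacobian.
Context {R : realType} {n m : nat}.

Lemma jacobian_entry (f : 'rV[R]_n -> 'rV[R]_m) x i j : differentiable f x ->
  'J f x i j = partial i (fun z => f z 0 j) x.
Proof.
by move=> df; rewrite mxE -deriveE // partial_entry.
Qed.

End Jacobian.

Lemma open_within_preimage (S T : topologicalType) (A : set S) (B : set T) (f : S -> T) :
  open A -> {within A, continuous f} -> open B -> open (A `&` f @^-1` B).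
Proof.
move=> oA; rewrite continuous_open_subspace // => cf oB.
rewrite openE => s [As Bs]; apply: filterI; first exact: open_nbhs_nbhs.
have nB : nbhs (f s) B by exact: open_nbhs_nbhs.
by apply: (cf s) nB; rewrite inE.
Qed.

Section Charts.
Context {R : realType} {n : nat} (T : topologicalType).
Implicit Types c : chart R n T.

Lemma pointK c x : chart_range c x -> coord c (point c x) = x.
Proof. by case=> p dp <-; rewrite coordK. Qed.

Lemma point_dom c x : chart_range c x -> dom c (point c x).
Proof. by case=> p dp <-; rewrite coordK. Qed.

Lemma overlapE c c' : overlap c c' = chart_range c `&` (point c) @^-1` (dom c').
Proof.
apply/seteqP; split=> [x [p [dp dp'] <-]|x [rx dx]].
  by split; [exists p|rewrite /= coordK].
by exists (point c x); [split=> //; exact: point_dom|exact: pointK].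
Qed.

Lemma open_overlap c c' : open (overlap c c').
Proof.
rewrite overlapE; apply: open_within_preimage; last exact: dom_open.
  exact: range_open.
exact: point_continuous.
Qed.

Lemma overlap_range c c' x : overlap c c' x -> chart_range c x.
Proof. by rewrite overlapE => -[]. Qed.

Lemma transition_overlap c c' x : overlap c c' x -> overlap c' c (transition c c' x).
Proof.
by rewrite overlapE => -[rx dx]; exists (point c x) => //; split=> //; exact: point_dom.
Qed.

End Charts.

Lemma smooth_mx_comp (R : realType) (n m k l : nat) U W (f : 'rV[R]_n -> 'rV[R]_m)
    (g : 'rV[R]_m -> 'M[R]_(k, l)) : open U -> open W -> (forall x, U x -> W (f x)) ->
  smooth U f -> smooth W g -> smooth U (g \o f).
Proof.
move=> oU oW UW sf /(smooth_mxP _ oW) sg; apply/smooth_mxP => // r c.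
exact: (smooth_comp oU oW UW sf (sg r c)).
Qed.

Section NewChart.
Context {R : realType} {n : nat} (M : manifold R n).
Variables (c : chart R n (carrier M)) (V W : set 'rV[R]_n) (psi chi : 'rV[R]_n -> 'rV[R]_n).
Hypothesis ac : atlas c.
Hypothesis (oV : open V) (oW : open W) (Vc : V `<=` chart_range c).
Hypothesis (psiW : forall x, V x -> W (psi x)) (chiV : forall w, W w -> V (chi w)).
Hypothesis (psiK : forall x, V x -> chi (psi x) = x) (chiK : forall w, W w -> psi (chi w) = w).
Hypothesis (spsi : smooth V psi) (schi : smooth W chi).

Let dom1 := dom c `&` coord c @^-1` V.
Let coord1 := psi \o coord c.
Let point1 := point c \o chi.

Let oV1 : open dom1.
Proof.
by apply: open_within_preimage => //; [exact: dom_open|exact: coord_continuous].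
Qed.

Let range1 : coord1 @` dom1 = W.
Proof.
apply/seteqP; split=> [_ [p [dp Vp] <-]|w Ww]; first exact: psiW.
have rw := Vc (chiV Ww).
exists (point c (chi w)); last by rewrite /coord1 /= pointK // chiK.
by split; [exact: point_dom|rewrite /= pointK //; exact: chiV].
Qed.

Fact new_range_open : open (coord1 @` dom1). Proof. by rewrite range1. Qed.

Fact new_coordK p : dom1 p -> point1 (coord1 p) = p.
Proof. by case=> dp Vp; rewrite /point1 /coord1 /= psiK // coordK. Qed.

Fact new_coord_continuous : {within dom1, continuous coord1}.
Proof.
rewrite continuous_open_subspace // => p; rewrite inE => -[dp Vp].
apply: continuous_comp.
  have := @coord_continuous _ _ _ c; rewrite continuous_open_subspace; last exact: dom_open.
  by apply; rewrite inE.
exact: differentiable_continuous (smooth_diff spsi Vp).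
Qed.

Fact new_point_continuous : {within coord1 @` dom1, continuous point1}.
Proof.
rewrite range1 continuous_open_subspace // => w; rewrite inE => Ww.
apply: continuous_comp; first exact: differentiable_continuous (smooth_diff schi Ww).
have := @point_continuous _ _ _ c; rewrite continuous_open_subspace; last exact: range_open.
by apply; rewrite inE; exact/Vc/chiV.
Qed.

Definition new_chart : chart R n (carrier M) :=
  Chart oV1 new_range_open new_coordK new_coord_continuous new_point_continuous.

Lemma new_chart_range : chart_range new_chart = W. Proof. exact: range1. Qed.

Lemma new_overlap x : V x -> overlap c new_chart x.
Proof.
move=> Vx; rewrite overlapE; split; first exact: Vc.
by split; [exact/point_dom/Vc|rewrite /= pointK //; exact: Vc].
Qed.

Lemma new_transition x : V x -> transition c new_chart x = psi x.
Proof. by move=> Vx; rewrite /transition /= /coord1 /= pointK //; exact: Vc. Qed.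

(** The atlas is maximal, so a diffeomorphism of open sets of coordinates produces
    another chart of it. *)
Lemma new_chart_atlas : atlas new_chart.
Proof.
apply: atlas_maximal => c' ac'; have [s1 s2] := atlas_compatible ac ac'.
split.
- apply: (@smooth_mx_comp _ _ _ _ _ _ (overlap c c') chi (transition c c')).
  + exact: open_overlap.
  + exact: open_overlap.
  + move=> _ [p [[dp Vp] dp'] <-]; rewrite /= psiK //; by exists p.
  + by apply: smooth_sub schi => w /overlap_range; rewrite new_chart_range.
  + exact: s1.
- apply: (@smooth_mx_comp _ _ _ _ _ _ V (transition c' c) psi) => //.
  + exact: open_overlap.
  + move=> _ [p [dp' [dp Vp]] <-]; by rewrite /transition /= coordK.
  + apply: smooth_sub s2 => _ [p [dp' [dp Vp]] <-]; by exists p.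
Qed.

Let D x : 'M[R]_n := \matrix_(i, j) partial i (fun z => psi z 0 j) x.

Lemma new_jacobian x : V x -> 'J (transition c new_chart) x = D x.
Proof.
move=> Vx; apply/matrixP => i j; rewrite [RHS]mxE; have e : \near x, psi x = transition c new_chart x.
  apply: filterS (open_nbhs_nbhs (conj oV Vx)) => z Vz.
  by rewrite new_transition.
rewrite jacobian_entry; last by apply: differentiable_near e _; exact: smooth_diff spsi Vx.
apply: (partial_on i oV Vx) => z Vz; by rewrite new_transition.
Qed.

Lemma chart_change (a : riemannian_metric M) (b : one_form M) : exists c1,
  [/\ atlas c1, forall p, dom c p -> V (coord c p) -> dom c1 p, chart_range c1 = W &
   forall x, V x ->
     metric_comp a c x = D x *m metric_comp a c1 (psi x) *m (D x)^T /\
     form_comp b c x = form_comp b c1 (psi x) *m (D x)^T].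
Proof.
exists new_chart; split=> [|p dp Vp||x Vx]; [exact: new_chart_atlas|by split|exact: range1|].
have Ox := new_overlap Vx; have ac1 := new_chart_atlas.
rewrite (metric_change a ac ac1 Ox) (form_change b ac ac1 Ox).
by rewrite new_transition // new_jacobian.
Qed.

End NewChart.

(** * Charts in which the metric and the form are constant *)

Section ChartData.
Context {R : realType} {n : nat} (M : manifold R n) (a : riemannian_metric M)
  (b : one_form M) (c : chart R n (carrier M)).
Hypothesis ac : atlas c.
Local Notation U := (chart_range c).

Lemma metric_entry_smooth i j : smooth U (fun x => metric_comp a c x i j).
Proof. by have /(smooth_mxP _ (@range_open _ _ _ c)) := metric_smooth a ac; apply. Qed.

Lemma form_entry_smooth i : smooth U (fun x => form_comp b c x 0 i).
Proof. by have /(smooth_mxP _ (@range_open _ _ _ c)) := form_smooth b ac; apply. Qed.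

Lemma metric_entry_sym x : U x -> forall i j, metric_comp a c x i j = metric_comp a c x j i.
Proof. by move=> Ux i j; rewrite -{1}(metric_sym a ac Ux) mxE. Qed.

Lemma metric_posdef x : U x -> posdef (metric_comp a c x).
Proof. by move=> Ux v v0; exact: metric_pos. Qed.

Lemma form_norm_bilin x : form_norm a b c x =
  Num.sqrt (bilin (invmx (metric_comp a c x)) (form_comp b c x) (form_comp b c x)).
Proof. by []. Qed.

Lemma unit_form x : form_norm a b c x = 1 ->
  bilin (invmx (metric_comp a c x)) (form_comp b c x) (form_comp b c x) = 1.
Proof.
rewrite form_norm_bilin; set q := bilin _ _ _ => e.
have q0 : 0 <= q.
  rewrite leNgt; apply/negP => /ltW; rewrite -sqrtr_eq0 e oner_eq0 //.
by rewrite -(sqr_sqrtr q0) e expr1n.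
Qed.

End ChartData.

Section LinearMaps.
Context {R : realType} {n : nat}.

Lemma mulmx_pairing (L : 'M[R]_n) j (x : 'rV[R]_n) : (x *m L) 0 j = pairing (row j L^T) x.
Proof. by rewrite mxE; apply: eq_bigr => k _; rewrite !mxE mulrC. Qed.

Lemma smooth_mulmx (L : 'M[R]_n) U : open U -> smooth U (fun x : 'rV[R]_n => x *m L).
Proof.
move=> oU; apply/smooth_mxP => // r j; rewrite ord1.
apply: (smooth_ext oU _ (smooth_pairing (row j L^T) oU)) => x _.
by rewrite mulmx_pairing.
Qed.

Lemma partial_mulmx (L : 'M[R]_n) i j x :
  partial i (fun z : 'rV[R]_n => (z *m L) 0 j) x = L i j.
Proof.
rewrite (partial_on i openT I (fun z _ => mulmx_pairing L j z)).
by rewrite partial_pairing_coord !mxE.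
Qed.

End LinearMaps.

Section StandardCharts.
Context {R : realType} {n : nat} (M : manifold R n) (a : riemannian_metric M)
  (b : one_form M).

Definition constant_chart p := exists c, [/\ atlas c, dom c p & exists a0 b0,
  forall x, chart_range c x -> metric_comp a c x = a0 /\ form_comp b c x = b0].

Definition standard_chart i1 p := exists c, [/\ atlas c, dom c p &
  forall x, chart_range c x -> metric_comp a c x = 1%:M /\ form_comp b c x = delta_mx 0 i1].

(** In a chart with identity metric the Christoffel symbols vanish, so a parallel
    form has constant components on a ball. *)
Lemma flat_parallel_constant p : flat_parallel a b -> constant_chart p.
Proof.
case=> fl par; have [c [ac dp a1]] := fl p.
have oU := @range_open _ _ _ c; pose x0 := coord c p.
have Ux0 : chart_range c x0 by exists p.
have /nbhs_ballP[r /= r0 rU] := open_nbhs_nbhs (conj oU Ux0).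
have db x i j : chart_range c x -> partial j (fun z => form_comp b c z 0 i) x = 0.
  move=> Ux; have := par c x i j ac Ux; rewrite big1 ?subr0 // => k _.
  have da l u v : partial l (fun z => metric_comp a c z u v) x = 0.
    rewrite (partial_on l (g := fun=> (1%:M : 'M[R]_n) u v) oU Ux) ?partial_cst //.
    by move=> z Uz; rewrite a1.
  rewrite /christoffel big1 ?mulr0 ?mul0r // => l _.
  by rewrite !da addr0 subrr mulr0.
pose V : set 'rV[R]_n := ball x0 r.
have oV : open V by exact: ball_open.
have bE x : V x -> form_comp b c x = form_comp b c x0.
  rewrite /V -ball_normE /= => Vx; apply/rowP => i.
  have -> : x = x0 + (x - x0) by rewrite addrC subrK.
  apply: (partial0_cst (form_entry_smooth b ac i)) => t /andP[t0 t1].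
  have Ut : chart_range c (x0 + t *: (x - x0)).
    apply: rU; rewrite -ball_normE /= opprD addrA subrr sub0r normrN normrZ.
    rewrite ger0_norm // distrC (le_lt_trans _ Vx) // ler_piMl //.
  split=> //; rewrite derive_sum_partial; last exact: smooth_diff (form_entry_smooth b ac i) Ut.
  by rewrite big1 // => k _; rewrite db // mulr0.
have sid : smooth V (id : 'rV[R]_n -> 'rV[R]_n).
  apply: (smooth_ext oV _ (smooth_mulmx 1%:M oV)) => x _; by rewrite mulmx1.
have J1 x : (\matrix_(i, j) partial i (fun z : 'rV[R]_n => id z 0 j) x) = 1%:M :> 'M[R]_n.
  by apply/matrixP => i j; rewrite !mxE partial_coord.
have [c1 [ac1 d1 r1 H1]] := chart_change ac oV oV rU (fun x h => h) (fun x h => h)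
  (fun x _ => erefl) (fun x _ => erefl) sid sid a b.
exists c1; split=> //; first by apply: d1 => //; exact: ballxx.
exists 1%:M, (form_comp b c x0) => x; rewrite r1 => Vx.
have [] := H1 x Vx; rewrite J1 trmx1 mul1mx !mulmx1 bE // a1 //; exact: rU.
Qed.

(** Being parallel is not given in a single chart but in all of them, so the
    Christoffel symbols are computed from the transition map [phi] to the
    standard chart: the metric is [J J^T], the form is a column of [J], and
    second derivatives of [phi] commute. *)
Lemma parallel_standard c c' i1 x : atlas c -> atlas c' ->
  (forall x, chart_range c' x -> metric_comp a c' x = 1%:M /\ form_comp b c' x = delta_mx 0 i1) ->
  overlap c c' x -> forall i j,
  partial j (fun z => form_comp b c z 0 i) x
    - \sum_k christoffel a c k i j x * form_comp b c x 0 k = 0.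
Proof.
move=> ac ac' std Ox i j; have oO := @open_overlap _ _ _ c c'.
pose phi := transition c c'.
have sphi : smooth (overlap c c') phi := (atlas_compatible ac ac').1.
have sm m : smooth (overlap c c') (fun z => phi z 0 m).
  by have /(smooth_mxP _ oO) := sphi; apply.
pose d k m z := partial k (fun z => phi z 0 m) z.
have JE z : overlap c c' z -> 'J phi z = \matrix_(k, m) d k m z.
  by move=> Oz; apply/matrixP => k m; rewrite jacobian_entry ?mxE //; exact: smooth_diff sphi Oz.
have stdz z : overlap c c' z -> metric_comp a c' (phi z) = 1%:M /\
    form_comp b c' (phi z) = delta_mx 0 i1.
  by move=> /transition_overlap /overlap_range; exact: std.
have aE z : overlap c c' z -> metric_comp a c z = 'J phi z *m ('J phi z)^T.
  by move=> Oz; rewrite (metric_change a ac ac' Oz) (stdz z Oz).1 mulmx1.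
have bE z : overlap c c' z -> form_comp b c z = delta_mx 0 i1 *m ('J phi z)^T.
  by move=> Oz; rewrite (form_change b ac ac' Oz) (stdz z Oz).2.
have aij u v z : overlap c c' z -> metric_comp a c z u v = \sum_m d u m z * d v m z.
  move=> Oz; rewrite aE // mxE; apply: eq_bigr => m _.
  by rewrite [(_^T) _ _]mxE JE // !mxE.
have bi u z : overlap c c' z -> form_comp b c z 0 u = d u i1 z.
  by move=> Oz; rewrite bE // -rowE JE // !mxE.
have sd u m : smooth (overlap c c') (d u m) by exact: smooth_partial.
have dd u m : differentiable (d u m) x by exact: smooth_diff (sd u m) Ox.
have [h hE] : exists h : 'I_n -> 'I_n -> 'I_n -> R,
    forall u v m, partial u (d v m) x = h u v m by exists (fun u v m => partial u (d v m) x).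
have hC u v m : h u v m = h v u m by rewrite -!hE; exact: partialC oO Ox (sm m).
have da l u v : partial l (fun z => metric_comp a c z u v) x =
    \sum_m (d u m x * h l v m + d v m x * h l u m).
  rewrite (partial_on l (g := fun z => \sum_m d u m z * d v m z) oO Ox); last exact: aij.
  rewrite partial_sum; last by move=> m; apply: differentiableM.
  by apply: eq_bigr => m _; rewrite partialM // !hE.
have db : partial j (fun z => form_comp b c z 0 i) x = h j i i1.
  by rewrite -hE; exact: partial_on oO Ox (bi i).
pose J := 'J phi x; pose A := metric_comp a c x.
have JlE l m : J l m = d l m x by rewrite /J JE // mxE.
have uA : A \in unitmx by exact/posdef_unit/metric_posdef/(overlap_range Ox).
have JJ : J^T *m invmx A *m J = 1%:M.
  by apply: mulmx1C; rewrite mulmxA -aE // mulmxV.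
have row1 : form_comp b c x *m invmx A *m J = delta_mx 0 i1.
  by rewrite bE // -!mulmxA (mulmxA _ (invmx A)) JJ mulmx1.
rewrite db; apply/eqP; rewrite subr_eq0; apply/eqP.
transitivity (\sum_m h i j m * (form_comp b c x *m invmx A *m J) 0 m).
  have e m : (form_comp b c x *m invmx A *m J) 0 m = (m == i1)%:R by rewrite row1 mxE.
  rewrite (eq_bigr _ (fun m _ => congr1 (GRing.mul (h i j m)) (e m))).
  rewrite (bigD1 i1) // eqxx mulr1 big1 => [|m /negPf ->]; last by rewrite mulr0.
  exact: etrans (hC j i i1) (esym (addr0 _)).
have brack l : partial i (fun z => metric_comp a c z j l) x
     + partial j (fun z => metric_comp a c z i l) x
     - partial l (fun z => metric_comp a c z i j) x = 2 * \sum_m h i j m * d l m x.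
  rewrite !da -big_split -sumrB mulr_sumr; apply: eq_bigr => m _ /=.
  by rewrite (hC l i) (hC l j) (hC j i); ring.
transitivity (\sum_m \sum_l \sum_k
    h i j m * (form_comp b c x 0 k * invmx A k l * d l m x)).
  apply: eq_bigr => m _; rewrite [(_ *m J) 0 m]mxE mulr_sumr; apply: eq_bigr => l _.
  by rewrite JlE [(_ *m invmx A) 0 l]mxE mulr_suml mulr_sumr.
rewrite exchange_big /=.
under eq_bigr do rewrite exchange_big /=.
rewrite exchange_big /=; apply: eq_bigr => k _.
rewrite /christoffel mulr_sumr mulr_suml; apply: eq_bigr => l _.
by rewrite brack !mulr_sumr mulr_suml; apply: eq_bigr => m _; rewrite -/A; field.
Qed.

Lemma standard_flat_parallel i1 : (forall p, standard_chart i1 p) -> flat_parallel a b.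
Proof.
move=> std; split=> [p|c x i j ac Ux].
  by have [c [ac dp H]] := std p; exists c; split=> // x /H[].
have [c' [ac' dp' H]] := std (point c x).
apply: (parallel_standard ac ac' H) => //.
by rewrite overlapE.
Qed.

End StandardCharts.

Section StandardFrame.
Context {R : realType} {n : nat} (M : manifold R n.+1) (a : riemannian_metric M)
  (b : one_form M).
Hypothesis hb : forall c x, atlas c -> chart_range c x -> form_norm a b c x = 1.

(** A linear change of coordinates by an orthonormal frame whose first vector is
    dual to the form. *)
Lemma constant_standard p : constant_chart a b p -> standard_chart a b ord0 p.
Proof.
case=> c [ac dp [a0 [b0 H]]]; pose x0 := coord c p.
have Ux0 : chart_range c x0 by exists p.
have [a0E b0E] := H x0 Ux0.
have asym : forall i j, a0 i j = a0 j i by rewrite -a0E; exact: metric_entry_sym.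
have apos : posdef a0 by rewrite -a0E; exact: metric_posdef.
have ua := posdef_unit apos.
pose beta := b0 *m invmx a0.
have bb : bilin a0 beta beta = 1.
  rewrite bilin_pairing mulmxKV // pairingC -bilin_pairing.
  by have := unit_form (hb ac Ux0); rewrite a0E b0E.
have [V [VV Vb]] := orthonormal_frame asym apos bb.
have uV : V \in unitmx by have := mulmx1_unit (etrans (mulmxA _ _ _) VV) => -[].
pose L := invmx V; pose psi (x : 'rV[R]_n.+1) := x *m L; pose chi (w : 'rV[R]_n.+1) := w *m V.
have oU := @range_open _ _ _ c.
pose W := chi @^-1` (chart_range c).
have schiT : smooth setT chi by apply: smooth_mulmx; exact: openT.
have oW : open W.
  by apply: open_comp oU => w _; exact: differentiable_continuous (smooth_diff schiT I).
have psiK x : chi (psi x) = x by rewrite /chi /psi mulmxKV.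
have chiK w : psi (chi w) = w by rewrite /chi /psi mulmxK.
have spsi : smooth (chart_range c) psi by exact: smooth_mulmx.
have schi : smooth W chi by exact: smooth_mulmx.
have psiW x : chart_range c x -> W (psi x) by rewrite /W /= psiK.
have JE x : (\matrix_(i, j) partial i (fun z => psi z 0 j) x) = L.
  by apply/matrixP => i j; rewrite mxE partial_mulmx.
have [c1 [ac1 d1 r1 H1]] := chart_change ac oU oW (fun x h => h) psiW (fun x h => h)
  (fun x _ => psiK x) (fun x _ => chiK x) spsi schi a b.
exists c1; split=> [//||w]; first exact: d1.
rewrite r1 => Ww; have [] := H1 _ Ww; rewrite JE chiK (H _ Ww).1 (H _ Ww).2 => e1 e2.
have VL : V *m L = 1%:M by rewrite mulmxV.
have LV : L^T *m V^T = 1%:M by rewrite -trmx_mul VL trmx1.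
split.
  by rewrite -VV e1 !mulmxA VL mul1mx -mulmxA LV mulmx1.
have -> : form_comp b c1 w = b0 *m V^T by rewrite e2 -mulmxA LV mulmx1.
have -> : b0 = delta_mx 0 ord0 *m V *m a0.
  by rewrite -rowE Vb /beta mulmxKV.
by rewrite -mulmxA -mulmxA (mulmxA V) VV mulmx1.
Qed.

End StandardFrame.

(** * The transport equations along a ray *)

(** [A], [B] and [P] stand for the components of the metric, of the form and of the
    covector of the projective factor along the ray [x0 + t v], and the
    hypotheses on derivatives for the system that they satisfy there. The
    constant [c] is minus the initial covector, and [lam] is the denominator of
    the central projection. *)
Section Rays.
Context {R : realType}.

Lemma is_derive_lincomb n (v : 'rV[R]_n) (f df : 'I_n -> R -> R) (t : R) :
  (forall l, is_derive t 1 (f l) (df l t)) ->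
  is_derive t 1 (fun s => \sum_l v 0 l * f l s) (\sum_l v 0 l * df l t).
Proof.
move=> d; have -> : (fun s => \sum_l v 0 l * f l s) = \sum_l (v 0 l *: f l).
  by apply/funext => s; rewrite fct_sumE.
by apply: is_derive_sum => l; exact: is_deriveZ.
Qed.

Lemma is_derive_inv (g : R -> R) (dg t : R) : g t != 0 -> is_derive t 1 g dg ->
  is_derive t 1 (fun s => (g s)^-1) (- dg / g t ^+ 2).
Proof.
move=> g0 [d1 d2]; split; first exact: derivableV.
by rewrite deriveV // d2 /GRing.scale /=; field.
Qed.

Variables (n : nat) (v : 'rV[R]_n) (A : 'I_n -> 'I_n -> R -> R) (B P : 'I_n -> R -> R).
Let AV j t := \sum_l v 0 l * A l j t.
Let AVV t := \sum_j v 0 j * AV j t.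
Let BV t := \sum_l v 0 l * B l t.
Let PV t := \sum_l v 0 l * P l t.
Hypothesis dA : forall i j (t : R), 0 <= t <= 1 ->
  is_derive t 1 (A i j) (P i t * AV j t + P j t * AV i t + 2 * PV t * A i j t).
Hypothesis dB : forall i (t : R), 0 <= t <= 1 ->
  is_derive t 1 (B i) (P i t * BV t + PV t * B i t).
Hypothesis dP : forall i (t : R), 0 <= t <= 1 -> is_derive t 1 (P i) (P i t * PV t).
Hypothesis AVV_gt0 : forall t : R, 0 <= t <= 1 -> 0 < AVV t.
Let c i := - P i 0.
Let cv := \sum_l v 0 l * c l.
Let lam (t : R) := 1 + t * cv.
Hypothesis lam_gt0 : forall t : R, 0 <= t <= 1 -> 0 < lam t.

Let lam0 : lam 0 = 1. Proof. by rewrite /lam mul0r addr0. Qed.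

Let dt (k s : R) : is_derive s 1 (fun r : R => r * k) k.
Proof.
have -> : (fun r : R => r * k) = (k *: id) by apply/funext => r; rewrite mulrC.
by have := is_deriveZ k (is_derive_id s (1 : R)); rewrite [k *: 1]mulr1.
Qed.

Let dlam (t : R) : is_derive t 1 lam cv.
Proof.
have := is_deriveD (is_derive_cst (1 : R) t 1) (dt cv t); rewrite add0r; exact.
Qed.

Let dPV (t : R) : 0 <= t <= 1 -> is_derive t 1 PV (PV t * PV t).
Proof.
move=> t01; apply: is_derive_eq
  (@is_derive_lincomb n v P (fun l s => P l s * PV s) t (fun l => dP l t01)) _.
by rewrite [RHS]mulr_suml; apply: eq_bigr => l _ /=; ring.
Qed.

Let dBV (t : R) : 0 <= t <= 1 -> is_derive t 1 BV (2 * PV t * BV t).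
Proof.
move=> t01; apply: is_derive_eq (@is_derive_lincomb n v B
  (fun l s => P l s * BV s + PV s * B l s) t (fun l => dB l t01)) _.
transitivity ((\sum_l v 0 l * P l t) * BV t + PV t * (\sum_l v 0 l * B l t)).
  move=> /=; move: (PV t) (BV t) => q r.
  by rewrite mulr_suml mulr_sumr -big_split; apply: eq_bigr => l _ /=; ring.
by rewrite -/(PV t) -/(BV t); ring.
Qed.

Let dAV j (t : R) : 0 <= t <= 1 -> is_derive t 1 (AV j) (3 * PV t * AV j t + P j t * AVV t).
Proof.
move=> t01; apply: is_derive_eq (@is_derive_lincomb n v (fun l => A l j)
  (fun l s => P l s * AV j s + P j s * AV l s + 2 * PV s * A l j s) t (fun l => dA l j t01)) _.
transitivity ((\sum_l v 0 l * P l t) * AV j t + P j t * (\sum_l v 0 l * AV l t)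
  + 2 * PV t * (\sum_l v 0 l * A l j t)).
  move=> /=; move: (PV t) (AV j t) => q r.
  by rewrite mulr_suml !mulr_sumr -!big_split; apply: eq_bigr => l _ /=; ring.
by rewrite -/(PV t) -/(AVV t) -/(AV j t); ring.
Qed.

Let dAVV (t : R) : 0 <= t <= 1 -> is_derive t 1 AVV (4 * PV t * AVV t).
Proof.
move=> t01; apply: is_derive_eq (@is_derive_lincomb n v AV
  (fun l s => 3 * PV s * AV l s + P l s * AVV s) t (fun l => dAV l t01)) _.
transitivity (3 * PV t * (\sum_l v 0 l * AV l t) + (\sum_l v 0 l * P l t) * AVV t).
  move=> /=; move: (PV t) (AVV t) => q r.
  by rewrite mulr_suml !mulr_sumr -!big_split; apply: eq_bigr => l _ /=; ring.
by rewrite -/(PV t) -/(AVV t); ring.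
Qed.

(** The factor [lam] is the integrating factor of the Riccati equation of [PV].
    Uniqueness comes from the quotient of [(lam * PV + cv) ^ 4] by [AVV], which is
    conserved and vanishes at the start. *)
Lemma ray_riccati (t : R) : 0 <= t <= 1 -> lam t * PV t = - cv.
Proof.
pose g s := lam s * PV s + cv.
have dg (s : R) : 0 <= s <= 1 -> is_derive s 1 g (PV s * g s).
  move=> s01; apply: (is_derive_eq (f := g))
    (is_deriveD (is_deriveM (dlam s) (dPV s01)) (is_derive_cst cv s 1)) _.
  by rewrite /GRing.scale /= /g; ring.
pose h s := g s ^+ 4 * (AVV s)^-1.
have dh (s : R) : 0 <= s <= 1 -> is_derive s 1 h 0.
  move=> s01; have A0 := lt0r_neq0 (AVV_gt0 s01).
  apply: (is_derive_eq (f := h)) (is_deriveM (is_deriveX 4 (dg s s01)) (is_derive_inv A0 (dAVV s01))) _.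
  by rewrite /GRing.scale /= exprfctE; field.
move=> t01; have A0 := lt0r_neq0 (AVV_gt0 t01).
have := is_derive0_segment dh t01.
have -> : h 0 = 0.
  rewrite /h /g lam0 mul1r.
  have -> : PV 0 + cv = 0.
    by rewrite /PV /cv -big_split big1 // => l _ /=; rewrite /c mulrN subrr.
  by rewrite expr0n mul0r.
move=> /eqP; rewrite mulf_eq0 invr_eq0 (negPf A0) orbF expf_eq0 /=.
by rewrite addr_eq0 => /eqP.
Qed.

Lemma ray_factor k (t : R) : 0 <= t <= 1 -> lam t * P k t = - c k.
Proof.
pose g s := lam s * P k s + c k.
have dg (s : R) : 0 <= s <= 1 -> is_derive s 1 g 0.
  move=> s01; apply: (is_derive_eq (f := g))
    (is_deriveD (is_deriveM (dlam s) (dP k s01)) (is_derive_cst (c k) s 1)) _.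
  have e := ray_riccati s01.
  rewrite /GRing.scale /= addr0; transitivity (P k s * (lam s * PV s + cv)); first by ring.
  by rewrite e addNr mulr0.
move=> t01; have := is_derive0_segment dg t01.
rewrite /g lam0 mul1r {2}/c subrr => /eqP; rewrite addr_eq0 => /eqP //.
Qed.

Let P_quotient k (t : R) : 0 <= t <= 1 -> P k t = - c k / lam t.
Proof. by move=> t01; rewrite -(ray_factor k t01) mulrC mulKf // lt0r_neq0 ?lam_gt0. Qed.

Let PV_quotient (t : R) : 0 <= t <= 1 -> PV t = - cv / lam t.
Proof. by move=> t01; rewrite -(ray_riccati t01) mulrC mulKf // lt0r_neq0 ?lam_gt0. Qed.

(** The left-hand side is constant along the ray, and [lam 0 = 1]. *)
Lemma ray_metric i j :
  lam 1 ^+ 2 * (A i j 1 + c i * AV j 1 + c j * AV i 1 + c i * c j * AVV 1) = A i j 0.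
Proof.
pose D s := lam s ^+ 2 * (A i j s + (s * c i) * AV j s + (s * c j) * AV i s
   + (s * c i) * (s * c j) * AVV s).
have dD (s : R) : 0 <= s <= 1 -> is_derive s 1 D 0.
  move=> s01.
  apply: (is_derive_eq (f := D)) (is_deriveM (is_deriveX 2 (dlam s))
    (is_deriveD (is_deriveD (is_deriveD (dA i j s01) (is_deriveM (dt (c i) s) (dAV j s01)))
       (is_deriveM (dt (c j) s) (dAV i s01)))
       (is_deriveM (is_deriveM (dt (c i) s) (dt (c j) s)) (dAVV s01)))) _.
  have l0 := lt0r_neq0 (lam_gt0 s01); have PVE := PV_quotient s01.
  have PE k := P_quotient k s01.
  rewrite /GRing.scale /= PVE !PE.
  have lE : lam s = 1 + s * cv by [].
  rewrite exprfctE !addrfctE !mulrfctE /=.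
  rewrite lE in l0 *; move: (AV i s) (AV j s) (AVV s) (A i j s) => p q r u.
  by field.
have := is_derive0_segment dD (t := 1); rewrite ler01 lexx => /(_ isT).
rewrite {2}/D lam0 !mul0r !addr0 expr1n mul1r => <-.
by rewrite /D !mul1r.
Qed.

Lemma ray_form i : lam 1 * (B i 1 + c i * BV 1) = B i 0.
Proof.
pose D s := lam s * (B i s + (s * c i) * BV s).
have dD (s : R) : 0 <= s <= 1 -> is_derive s 1 D 0.
  move=> s01.
  apply: (is_derive_eq (f := D)) (is_deriveM (dlam s)
    (is_deriveD (dB i s01) (is_deriveM (dt (c i) s) (dBV s01)))) _.
  have l0 := lt0r_neq0 (lam_gt0 s01); have PVE := PV_quotient s01.
  have PE k := P_quotient k s01.
  rewrite /GRing.scale /= PVE !PE addrfctE !mulrfctE /=.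
  have lE : lam s = 1 + s * cv by [].
  rewrite lE in l0 *; move: (BV s) (B i s) => p q.
  by field.
have := is_derive0_segment dD (t := 1); rewrite ler01 lexx => /(_ isT).
rewrite {2}/D lam0 !mul0r !addr0 mul1r => <-.
by rewrite /D !mul1r.
Qed.

End Rays.

(** * Central projection *)

(** In the coordinates [(x - x0) / (1 + k0 (x - x0))] straight lines stay straight;
    with [k0] adapted to a metric this is the change from the projective model of
    a flat metric to its Cartesian coordinates. *)
Section CentralProjection.
Context {R : realType} {n : nat}.
Variables (x0 k0 : 'rV[R]_n) (V : set 'rV[R]_n).

Definition central_factor x : R := 1 + pairing k0 (x - x0).
Definition central_map x : 'rV[R]_n := (central_factor x)^-1 *: (x - x0).
Definition central_inverse w : 'rV[R]_n := x0 + (1 - pairing k0 w)^-1 *: w.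
Definition central_domain : set 'rV[R]_n := V `&` [set x | 0 < central_factor x].
Definition central_range : set 'rV[R]_n :=
  [set w | 0 < 1 - pairing k0 w] `&` central_inverse @^-1` V.
(** The inverse of the Jacobian matrix of the projection. *)
Definition central_frame x : 'M[R]_n :=
  central_factor x *: (1%:M + k0^T *m (x - x0)).

Local Notation lam := central_factor.
Local Notation psi := central_map.
Local Notation chi := central_inverse.
Hypothesis oV : open V.

Lemma central_mapK x : 0 < lam x -> chi (psi x) = x.
Proof.
move=> l0; have ln := lt0r_neq0 l0; rewrite /chi /psi pairingZr.
have -> : 1 - (lam x)^-1 * pairing k0 (x - x0) = (lam x)^-1.
  have -> : pairing k0 (x - x0) = lam x - 1 by rewrite /lam addrAC subrr add0r.
  by field.
by rewrite invrK scalerA mulfV // scale1r addrC subrK.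
Qed.

Lemma central_factor_inverse w : 0 < 1 - pairing k0 w -> lam (chi w) = (1 - pairing k0 w)^-1.
Proof.
move=> /lt0r_neq0 m0; rewrite /lam /chi addrAC subrr add0r pairingZr.
by move: (pairing _ _) m0 => q m0; field.
Qed.

Lemma central_inverseK w : 0 < 1 - pairing k0 w -> psi (chi w) = w.
Proof.
move=> m0; rewrite /psi central_factor_inverse // invrK /chi addrAC subrr add0r scalerA.
by rewrite mulfV ?scale1r // lt0r_neq0.
Qed.

Lemma central_map_range x : central_domain x -> central_range (psi x).
Proof.
case=> Vx l0; split; last by rewrite /= central_mapK.
have ln := lt0r_neq0 l0; rewrite /= /psi pairingZr.
suff -> : 1 - (lam x)^-1 * pairing k0 (x - x0) = (lam x)^-1 by rewrite invr_gt0.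
have -> : pairing k0 (x - x0) = lam x - 1 by rewrite /lam addrAC subrr add0r.
by field.
Qed.

Lemma central_inverse_domain w : central_range w -> central_domain (chi w).
Proof. by case=> m0 Vw; split=> //; rewrite /= central_factor_inverse // invr_gt0. Qed.

Let factorE : lam = fun x => pairing k0 x + (1 - pairing k0 x0).
Proof. by apply/funext => x; rewrite /lam pairingDr pairingNr; ring. Qed.

Let smooth_factor1 : smooth setT lam.
Proof.
have oT := @openT 'rV[R]_n; rewrite factorE.
by apply: smoothD => //; [exact: smooth_pairing|exact: smooth_cst].
Qed.

Let smooth_height : smooth setT (fun w => 1 - pairing k0 w).
Proof.
have oT := @openT 'rV[R]_n; apply: smoothD => //; first exact: smooth_cst.
by apply: smoothN => //; exact: smooth_pairing.
Qed.

Lemma central_domain_open : open central_domain.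
Proof. by apply: openI => //; exact: open_positive. Qed.

Let smooth_inverse1 : smooth [set w | 0 < 1 - pairing k0 w] chi.
Proof.
have oH := open_positive smooth_height; apply/smooth_mxP => // r j; rewrite ord1.
apply: (smooth_ext oH (f := fun w => x0 0 j + (1 - pairing k0 w)^-1 * w 0 j)).
  by move=> w _; rewrite !mxE.
apply: smoothD => //; first exact: smooth_cst.
apply: smoothM => //; last exact: smooth_coord.
by apply: smoothV => // [w /lt0r_neq0 //|]; apply: smooth_sub smooth_height.
Qed.

Lemma central_range_open : open central_range.
Proof.
apply: open_within_preimage => //; first exact: open_positive smooth_height.
rewrite continuous_open_subspace; last exact: open_positive smooth_height.
move=> w; rewrite inE => Hw; exact: differentiable_continuous (smooth_diff smooth_inverse1 Hw).
Qed.

Lemma smooth_central_inverse : smooth central_range chi.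
Proof. by apply: smooth_sub smooth_inverse1 => w []. Qed.

Lemma smooth_central_map : smooth central_domain psi.
Proof.
have oD := central_domain_open; apply/smooth_mxP => // r j; rewrite ord1.
apply: (smooth_ext oD (f := fun x => (lam x)^-1 * (x 0 j + (- x0 0 j)))).
  by move=> w _; rewrite !mxE.
apply: smoothM => //; last by apply: smoothD => //; [exact: smooth_coord|exact: smooth_cst].
apply: smoothV => // [x [_ /lt0r_neq0 //]|]; exact: smooth_sub smooth_factor1.
Qed.

Let partial_lam i x : partial i lam x = k0 0 i.
Proof. by rewrite factorE partial_addc partial_pairing_coord. Qed.

Lemma central_frame_jacobian x : central_domain x ->
  central_frame x *m (\matrix_(i, j) partial i (fun z => psi z 0 j) x) = 1%:M.
Proof.
move=> [Vx l0]; have ln := lt0r_neq0 l0.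
have dl : differentiable lam x := smooth_diff smooth_factor1 I.
have -> : \matrix_(i, j) partial i (fun z => psi z 0 j) x =
    (lam x)^-1 *: 1%:M - ((lam x)^-1 * (lam x)^-1) *: (k0^T *m (x - x0)).
  apply/matrixP => i j; rewrite [LHS]mxE.
  have dj : differentiable (fun z : 'rV[R]_n => z 0 j + - x0 0 j) x.
    by apply: differentiableD; [exact: differentiable_coord|exact: differentiable_cst].
  rewrite (partial_on i (g := fun z : 'rV[R]_n => (lam z)^-1 * (z 0 j + - x0 0 j)) openT I);
    last by move=> z _; rewrite !mxE.
  rewrite partialM //; last exact: differentiableV.
  rewrite partialV // partial_lam partial_addc partial_coord !mxE big_ord1 !mxE.
  by rewrite mulrDr !mulrN; ring.
rewrite /central_frame -scalemxAl mulmxBr -!scalemxAr mulmx1 mulmxDl mul1mx.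
have -> : k0^T *m (x - x0) *m (k0^T *m (x - x0)) = pairing k0 (x - x0) *: (k0^T *m (x - x0)).
  rewrite mulmxA -(mulmxA k0^T) [(x - x0) *m k0^T]mx11_scalar -pairing_mx pairingC.
  by rewrite mul_mx_scalar scalemxAl.
have -> : pairing k0 (x - x0) = lam x - 1 by rewrite /lam addrAC subrr add0r.
apply/matrixP => i j; rewrite !mxE; move: (\sum_(_ < _) _) (_%:R) => q r.
by field.
Qed.

End CentralProjection.

Section ProjectiveChart.
Context {R : realType} {n : nat} (M : manifold R n) (a : riemannian_metric M)
  (b : one_form M) (c : chart R n (carrier M)).
Hypothesis ac : atlas c.
Local Notation U := (chart_range c).
Local Notation am := (metric_comp a c).
Local Notation bm := (form_comp b c).
Variable P : 'rV[R]_n -> 'rV[R]_n.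
Hypothesis sP : forall k, smooth U (fun x => P x 0 k).
Hypothesis dP : forall x j k, U x -> partial j (fun z => P z 0 k) x = P x 0 k * P x 0 j.
Hypothesis dA : forall x l i j, U x -> partial l (fun z => am z i j) x =
  P x 0 i * am x l j + P x 0 j * am x l i + 2 * P x 0 l * am x i j.
Hypothesis dB : forall x l i, U x -> partial l (fun z => bm z 0 i) x =
  P x 0 i * bm x 0 l + P x 0 l * bm x 0 i.

Let oU : open U := @range_open _ _ _ c.

Let along_segment (f : 'rV[R]_n -> R) x v (t : R) : smooth U f -> U (x + t *: v) ->
  is_derive t 1 (fun s => f (x + s *: v)) (\sum_k v 0 k * partial k f (x + t *: v)).
Proof.
move=> sf Ut; have df := smooth_diff sf Ut.
by rewrite -derive_sum_partial //; exact: is_derive_line.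
Qed.

(** Pulling back by the inverse Jacobian matrix produces the expressions that
    [ray_metric] and [ray_form] prove constant along rays from [x0]. *)
Lemma central_frame_constant x0 x :
  (forall t : R, 0 <= t <= 1 -> U (x0 + t *: (x - x0))) ->
  (forall t : R, 0 <= t <= 1 -> 0 < 1 + t * pairing (- P x0) (x - x0)) ->
  central_frame x0 (- P x0) x *m am x *m (central_frame x0 (- P x0) x)^T = am x0 /\
  bm x *m (central_frame x0 (- P x0) x)^T = bm x0.
Proof.
set v := x - x0; set k0 := - P x0 => Ut lt0.
have xE : x0 + 1 *: v = x by rewrite scale1r /v addrC subrK.
have x0E : x0 + 0 *: v = x0 by rewrite scale0r addr0.
have [v0|v0] := eqVneq v 0.
  have xx : x = x0 by rewrite -xE v0 scaler0 addr0.
  by rewrite /central_frame /central_factor -/v v0 pairing0r addr0 scale1r mulmx0 addr0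
    trmx1 mul1mx !mulmx1 xx.
pose A i j (t : R) := am (x0 + t *: v) i j.
pose B i (t : R) := bm (x0 + t *: v) 0 i.
pose Q i (t : R) := P (x0 + t *: v) 0 i.
have Asym i j (t : R) : 0 <= t <= 1 -> A i j t = A j i t.
  by move=> /Ut Uz; exact: metric_entry_sym.
have dA1 i j (t : R) : 0 <= t <= 1 -> is_derive t 1 (A i j)
    (Q i t * (\sum_l v 0 l * A l j t) + Q j t * (\sum_l v 0 l * A l i t)
      + 2 * (\sum_l v 0 l * Q l t) * A i j t).
  move=> /Ut Uz.
  apply: is_derive_eq (along_segment (metric_entry_smooth a ac i j) Uz) _.
  rewrite !mulr_sumr mulr_suml -!big_split; apply: eq_bigr => l _ /=.
  by rewrite dA // /A /Q; ring.
have dB1 i (t : R) : 0 <= t <= 1 -> is_derive t 1 (B i)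
    (Q i t * (\sum_l v 0 l * B l t) + (\sum_l v 0 l * Q l t) * B i t).
  move=> /Ut Uz; apply: is_derive_eq (along_segment (form_entry_smooth b ac i) Uz) _.
  rewrite mulr_sumr mulr_suml -!big_split; apply: eq_bigr => l _ /=.
  by rewrite dB // /B /Q; ring.
have dQ1 i (t : R) : 0 <= t <= 1 -> is_derive t 1 (Q i) (Q i t * (\sum_l v 0 l * Q l t)).
  move=> /Ut Uz; apply: is_derive_eq (along_segment (sP i) Uz) _.
  rewrite mulr_sumr; apply: eq_bigr => l _ /=.
  by rewrite dP // /Q; ring.
have AVV (t : R) : 0 <= t <= 1 -> 0 < \sum_j v 0 j * (\sum_l v 0 l * A l j t).
  move=> t01; have Uz := Ut t t01; have := metric_posdef a ac Uz v0.
  suff -> : bilin (am (x0 + t *: v)) v v = \sum_j v 0 j * (\sum_l v 0 l * A l j t) by [].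
  apply: eq_bigr => j _; rewrite mulr_sumr; apply: eq_bigr => l _.
  by rewrite (Asym l j t t01) /A; ring.
have cE : \sum_l v 0 l * - Q l 0 = pairing k0 v.
  by apply: eq_bigr => l _; rewrite /Q x0E [k0 0 l]mxE mulrC.
have lamE (t : R) : 0 <= t <= 1 -> 0 < 1 + t * \sum_l v 0 l * - Q l 0.
  by rewrite cE; exact: lt0.
have k0E i : - Q i 0 = k0 0 i by rewrite /Q x0E mxE.
have lam1 : 1 + 1 * pairing k0 v = central_factor x0 k0 x by rewrite mul1r.
set lam := central_factor x0 k0 x in lam1 *.
have FE i j : central_frame x0 k0 x i j = lam * ((i == j)%:R + k0 0 i * v 0 j).
  by rewrite !mxE big_ord1 !mxE.
have row_sum i (g : 'I_n -> R) : \sum_k central_frame x0 k0 x i k * g k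
    = lam * (g i + k0 0 i * \sum_k v 0 k * g k).
  transitivity (\sum_k (lam * ((i == k)%:R * g k) + lam * (k0 0 i * (v 0 k * g k)))).
    by apply: eq_bigr => k _; rewrite FE; ring.
  rewrite big_split /= -!mulr_sumr mulrDr; congr (_ * _ + _).
  rewrite (bigD1 i) //= eqxx mul1r big1 ?addr0 // => k /negPf ki.
  by rewrite eq_sym ki mul0r.
split.
  apply/matrixP => i j.
  have := ray_metric dA1 dQ1 AVV lamE i j.
  rewrite cE lam1 !k0E /A x0E xE => <-.
  rewrite mxE; under eq_bigr => k _ do rewrite [(_ *m am x) i k]mxE [_^T k j]mxE mulrC.
  rewrite row_sum row_sum.
  have -> : \sum_k v 0 k * (\sum_l central_frame x0 k0 x i l * am x l k) =
     lam * ((\sum_k v 0 k * am x k i) + k0 0 i * \sum_k v 0 k * (\sum_l v 0 l * am x l k)).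
    rewrite mulrDr !mulr_sumr -big_split; apply: eq_bigr => k _ /=; rewrite row_sum.
    have Ux : U x by rewrite -xE; apply: Ut; rewrite ler01 lexx.
    by rewrite (metric_entry_sym a ac Ux k i); ring.
  by ring.
apply/rowP => i; have := ray_form dA1 dB1 dQ1 AVV lamE i.
rewrite cE lam1 !k0E /B x0E xE => <-.
rewrite mxE; under eq_bigr => k _ do rewrite [_^T k i]mxE mulrC.
exact: row_sum.
Qed.

(** The central projection along the initial value of [- P] makes both tensors
    constant on the part of a ball where its denominator is positive; that part
    is star-shaped about the centre, so rays reach all of it. *)
Lemma ode_constant_chart p : dom c p -> constant_chart a b p.
Proof.
move=> dp; pose x0 := coord c p; pose k0 := - P x0.
have Ux0 : U x0 by exists p.
have /nbhs_ballP[r /= r0 rU] := open_nbhs_nbhs (conj oU Ux0).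
have oV : open (ball x0 r) by exact: ball_open.
pose D := central_domain x0 k0 (ball x0 r).
pose W := central_range x0 k0 (ball x0 r).
have oD : open D := central_domain_open oV.
have oW : open W := central_range_open oV.
have DU : D `<=` U by move=> x [/rU].
have psiW := @central_map_range _ _ x0 k0 (ball x0 r).
have chiD := @central_inverse_domain _ _ x0 k0 (ball x0 r).
have psiK x : D x -> central_inverse x0 k0 (central_map x0 k0 x) = x.
  by case=> _; exact: central_mapK.
have chiK w : W w -> central_map x0 k0 (central_inverse x0 k0 w) = w.
  by case=> w0 _; exact: central_inverseK.
have spsi : smooth D (central_map x0 k0) := smooth_central_map oV.
have schi : smooth W (central_inverse x0 k0) := @smooth_central_inverse _ _ x0 k0 (ball x0 r).
have [c1 [ac1 d1 r1 H1]] := chart_change ac oD oW DU psiW chiD psiK chiK spsi schi a b.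
exists c1; split=> //.
  apply: d1 => //; split; first exact: ballxx.
  by rewrite /= /central_factor -/x0 subrr pairing0r addr0.
exists (am x0), (bm x0) => w; rewrite r1 => Ww.
have Dw := chiD _ Ww; set x := central_inverse x0 k0 w in Dw.
have xw : central_map x0 k0 x = w := chiK _ Ww.
have seg (t : R) : 0 <= t <= 1 -> U (x0 + t *: (x - x0)).
  move=> /andP[t0 t1]; case: Dw => [+ _]; rewrite -ball_normE /= => xr.
  apply: rU; rewrite -ball_normE /= opprD addrA subrr sub0r normrN normrZ.
  by rewrite ger0_norm // distrC (le_lt_trans _ xr) // ler_piMl.
have lam (t : R) : 0 <= t <= 1 -> 0 < 1 + t * pairing k0 (x - x0).
  move=> /andP[t0 t1]; case: Dw => _ /=; rewrite /central_factor.
  move: (pairing _ _) => q q1; have [q0|/ltW q0] := lerP 0 q.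
    by rewrite ltr_pwDl // mulr_ge0.
  by apply: lt_le_trans q1 _; rewrite lerD2l ler_niMl.
have [eA eB] := central_frame_constant seg lam.
have FJ := central_frame_jacobian Dw.
have [] := H1 x Dw; rewrite xw; set J := \matrix_(i, j) _ in FJ * => e1 e2.
have JF : J^T *m (central_frame x0 k0 x)^T = 1%:M by rewrite -trmx_mul FJ trmx1.
rewrite -eA -eB -/k0 e1 e2 !mulmxA FJ mul1mx -!mulmxA JF !mulmx1 //.
Qed.

End ProjectiveChart.

(** * Kropina metrics and their changes in a chart *)

Section RandersData.
Context {R : realType} {n : nat} (M : manifold R n) (a : riemannian_metric M)
  (b eta : one_form M).
Hypothesis hb : forall c x, atlas c -> chart_range c x -> form_norm a b c x = 1.
Hypothesis he : forall c x, atlas c -> chart_range c x -> form_norm a eta c x < 2^-1.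

Lemma form_evalE (e : one_form M) c x y : form_eval e c x y = pairing (form_comp e c x) y.
Proof. by []. Qed.

Lemma alpha_sqr c x y : atlas c -> chart_range c x ->
  alpha a c x y ^+ 2 = bilin (metric_comp a c x) y y.
Proof.
move=> ac Ux; rewrite sqr_sqrtr //; have [->|y0] := eqVneq y 0.
  by rewrite -/(bilin _ _ _) bilin_pairing pairing0r.
exact: ltW (metric_posdef a ac Ux y0).
Qed.

(** Cauchy-Schwarz for both forms, with dual norms 1 and at most 1/2. *)
Lemma form_product_bound c x y : atlas c -> chart_range c x ->
  `|form_eval b c x y * form_eval eta c x y| <= 2^-1 * bilin (metric_comp a c x) y y.
Proof.
move=> ac Ux; have asym := metric_entry_sym a ac Ux; have apos := metric_posdef a ac Ux.
have A0 : 0 <= bilin (metric_comp a c x) y y by rewrite -alpha_sqr // sqr_ge0.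
rewrite !form_evalE.
have h1 := cauchy_schwarz (form_comp b c x) y asym apos.
rewrite (unit_form (hb ac Ux)) mul1r in h1.
have h2 := cauchy_schwarz (form_comp eta c x) y asym apos.
set q := bilin (invmx _) _ _ in h2.
have q4 : q <= 4^-1.
  have [q0|q0] := lerP q 0; first by rewrite (le_trans q0) // invr_ge0.
  have := he ac Ux; rewrite form_norm_bilin -/q => s2.
  have s0 : 0 <= Num.sqrt q := sqrtr_ge0 q.
  rewrite -(sqr_sqrtr (ltW q0)); move: (Num.sqrt q) s0 s2 => s s0 s2; nra.
move: (pairing (form_comp b c x) y) (pairing (form_comp eta c x) y)
  (bilin (metric_comp a c x) y y) A0 h1 h2 => B E A A0 h1 h2.
rewrite -ler_sqr ?nnegrE ?mulr_ge0 ?normr_ge0 ?invr_ge0 //.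
rewrite real_normK ?num_real // !exprMn.
have h3 : E ^+ 2 <= 4^-1 * A by rewrite (le_trans h2) // ler_wpM2r.
have h4 := ler_pM (sqr_ge0 B) (sqr_ge0 E) h1 h3.
apply: (le_trans h4).
by rewrite le_eqVlt; apply/orP; left; apply/eqP; field.
Qed.

Lemma randers_metric_gt0 c x y : atlas c -> chart_range c x -> y != 0 ->
  0 < bilin (metric_comp a c x) y y + form_eval b c x y * form_eval eta c x y.
Proof.
move=> ac Ux y0; have := form_product_bound y ac Ux.
have A0 := metric_posdef a ac Ux y0; rewrite ler_norml => /andP[h _].
move: (bilin _ _ _) (form_eval b c x y * _) A0 h => A B A0 h; lra.
Qed.

Section Chart.
Variable c : chart R n (carrier M).
Hypothesis ac : atlas c.
Local Notation U := (chart_range c).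
Local Notation am := (metric_comp a c).
Local Notation bm := (form_comp b c).
Local Notation em := (form_comp eta c).

Let oU : open U := @range_open _ _ _ c.
Let sa i j := metric_entry_smooth a ac i j.
Let sb i := form_entry_smooth b ac i.
Let se i := form_entry_smooth eta ac i.
Let s0 i : smooth U (fun x => (fun=> 0 : 'rV[R]_n) x 0 i) := @smooth_cst _ _ _ U _.
Let asym x (Ux : U x) := metric_entry_sym a ac Ux.
Let apos x (Ux : U x) := metric_posdef a ac Ux.
Let F : phase_space (cone U bm) :=
  phase_functions (exist (fun W => open W) (cone U bm) (open_cone oU sb)).
Local Notation X k := (@pd _ F (lshift n k)).
Local Notation Y k := (@pd _ F (rshift n k)).
Local Notation y i := (@pcoord _ F (rshift n i)).
Local Notation f := (fK oU sa sb F).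
Local Notation fe := (fE oU se F).
Local Notation L0 := (value (kropina a b) c).
Local Notation L := (value (add_form (kropina a b) eta) c).

Lemma coneP x v : cone U bm (row_mx x v) <-> U x /\ region (kropina a b) c x v.
Proof. by rewrite /cone /= row_mxKl row_mxKr. Qed.

Let rL0 : represents L0 f.
Proof.
move=> x v Wz; have [Ux bv] := (coneP x v).1 Wz.
by rewrite ev_fK // ev_fA // ev_fB // row_mxKl row_mxKr -alpha_sqr.
Qed.

(* [kropina_regular] speaks of a sum with a form; here the form is zero. *)
Let rL00 : represents L0 (fL oU sa sb s0 F).
Proof.
move=> x v Wz; rewrite rL0 // /fL evD // ev_fE //.
by rewrite pairingC pairing0r addr0.
Qed.

Let rL : represents L (f + fe).
Proof.
by move=> x v Wz; rewrite evD // ev_fE // row_mxKl row_mxKr -rL0.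
Qed.

Let f0 z : cone U bm z -> ev f z != 0.
Proof. by move=> Wz; exact/lt0r_neq0/fK_gt0. Qed.

Let L_gt0 x v : cone U bm (row_mx x v) -> 0 < L x v.
Proof.
move=> Wz; have [Ux bv] := (coneP x v).1 Wz.
have v0 := cone_neq0 Wz; rewrite row_mxKr in v0.
have h := randers_metric_gt0 ac Ux v0.
rewrite /= alpha_sqr // -(pmulr_lgt0 _ bv) mulrDl divfK ?lt0r_neq0 //.
by rewrite mulrC [form_eval eta _ _ _ * _]mulrC in h *.
Qed.

Let fe0 z : cone U bm z -> ev (f + fe) z != 0.
Proof.
move=> Wz; rewrite -(hsubmxK z) in Wz *.
by rewrite -rL //; exact/lt0r_neq0/L_gt0.
Qed.

Let nd0 x v : cone U bm (row_mx x v) -> fundamental_tensor L0 x v \in unitmx.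
Proof.
move=> Wz; apply: (kropina_regular asym apos rL00 Wz).
by rewrite rL0 // f0.
Qed.

Let nd x v : cone U bm (row_mx x v) -> fundamental_tensor L x v \in unitmx.
Proof.
move=> Wz; apply: (kropina_regular asym apos (em := em) (se := se) rL Wz).
exact/lt0r_neq0/L_gt0.
Qed.

Hypothesis ce : closed_form eta.

Let cle : closed_linear fe.
Proof.
apply: closed_linear_form => [k i|i j]; first exact: Y_e.
apply: evP => z Wz; rewrite !X_lift //; apply: ce => //.
by case: Wz.
Qed.

Let hf : euler f = f. Proof. exact: euler_fK. Qed.

Lemma randers_scalar_curvature K x v : U x -> region (kropina a b) c x v ->
  flag_curvature_at L0 K x v -> exists K', flag_curvature_at L K' x v.
Proof.
move=> Ux bv; have Wz : cone U bm (row_mx x v) by apply/coneP.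
exact: (scalar_curvature_add f0 hf cle fe0 rL0 rL nd0 nd Wz).
Qed.

Let ev_baseD_fe x v : cone U bm (row_mx x v) -> ev (baseD fe) (row_mx x v) =
  bilin (\matrix_(k, i) partial k (fun z => em z 0 i) x) v v.
Proof.
move=> Wz; rewrite baseDE ev_sum //; apply: eq_bigr => k _.
rewrite evM // ev_y // X_linear ev_linear // row_mxKr mulr_sumr; apply: eq_bigr => i _.
by rewrite !mxE X_lift // row_mxKl; ring.
Qed.

(** Here the spray of the Kropina metric vanishes, so that of the sum is a multiple
    of [y]; the multiple is the quotient of a quadratic form by the metric, hence
    homogeneous of degree one. *)
Lemma constant_projective_spray : (exists a0 b0, forall x, U x -> am x = a0 /\ bm x = b0) ->
  exists P : 'rV[R]_n -> 'rV[R]_n -> R,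
    (forall x v (t : R), U x -> region (kropina a b) c x v -> 0 < t ->
       P x (t *: v) = t * P x v) /\
    (forall x v (i : 'I_n), U x -> region (kropina a b) c x v ->
       spray L i x v = P x v * v 0 i).
Proof.
case=> a1 [b1 cst1].
have Xa k i j : X k (a_ oU sa F i j) = 0.
  apply: evP => z Wz; rewrite X_lift // ev0 //; have Uz : U (lsubmx z) by case: Wz.
  rewrite (partial_on k (g := fun=> a1 i j) oU Uz) ?partial_cst // => x Ux.
  by rewrite (cst1 x Ux).1.
have Xb k i : X k (b_ oU sb F i) = 0.
  apply: evP => z Wz; rewrite X_lift // ev0 //; have Uz : U (lsubmx z) by case: Wz.
  rewrite (partial_on k (g := fun=> b1 0 i) oU Uz) ?partial_cst // => x Ux.
  by rewrite (cst1 x Ux).2.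
have Xf k : X k f = 0.
  apply: (fB_reg (oU := oU) (sb := sb) (F := F)); rewrite mulr0.
  have := congr1 (X k) (fBK oU sa sb F).
  rewrite pdM X_linear X_quadratic /linear_form /quadratic_form !big1 => [|i _|i _].
  - by rewrite mul0r add0r.
  - by rewrite big1 // => j _; rewrite Xa !mul0r.
  - by rewrite Xb mul0r.
have XE k : X k (f * f) = 0 by rewrite pdM Xf mul0r mulr0 addr0.
have EL : euler_lagrange (fun=> 0 : F) (f * f).
  move=> l; rewrite XE /sprayD vertE baseDE !big1 ?mul0rn ?subr0 // => k _.
    by rewrite mul0r.
  by rewrite pdC XE raddf0 mulr0.
have [P [hP rP]] := spray_add f0 hf cle fe0 rL nd EL.
have PE x v : cone U bm (row_mx x v) -> ev P (row_mx x v) * L x v * 2 =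
    bilin (\matrix_(k, i) partial k (fun z => em z 0 i) x) v v.
  move=> Wz; rewrite rL // -evM // mulr_natr -evMn // hP -ev_baseD_fe //.
  by rewrite /sprayD vertE big1 ?mul0rn ?subr0 // => k _; rewrite mul0r.
exists (fun x v => ev P (row_mx x v)); split=> [x v t Ux bv t0|x v i Ux bv].
  have Wz : cone U bm (row_mx x v) by apply/coneP.
  have Wt : cone U bm (row_mx x (t *: v)).
    by apply/coneP; split=> //=; rewrite form_evalE pairingZr mulr_gt0.
  have Lt : L x (t *: v) = t * L x v.
    rewrite /= !alpha_sqr // !form_evalE !pairingZr bilinZl bilinZr.
    have tn := lt0r_neq0 t0; have bn := lt0r_neq0 bv; rewrite form_evalE in bn.
    by field; rewrite tn bn.
  have L1 := lt0r_neq0 (L_gt0 Wz); have := PE _ _ Wt.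
  rewrite bilinZl bilinZr -PE // Lt => e.
  have k0 : t * L x v * 2 != 0 by rewrite !mulf_neq0 ?pnatr_eq0 // lt0r_neq0.
  apply: (mulIf k0); transitivity (ev P (row_mx x (t *: v)) * (t * L x v) * 2).
    by ring.
  by rewrite e; ring.
have Wz : cone U bm (row_mx x v) by apply/coneP.
by rewrite rP // add0r evM // ev_y.
Qed.

(** The spray of the Kropina metric [f] is also a multiple of [y], and the multiple
    is smooth: since [f] is constant along its own spray it must be half of
    [baseD f / f]. *)
Lemma projectively_flat_kropina (P : 'rV[R]_n -> 'rV[R]_n -> R) :
  (forall x v (i : 'I_n), U x -> region (kropina a b) c x v ->
     spray L i x v = P x v * v 0 i) ->
  exists p : F, p * f *+ 2 = baseD f /\ euler_lagrange (fun i => p * y i) (f * f).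
Proof.
move=> HP; have [G [rG EL]] := spray_smooth rL0 nd0.
have [Q [hQ rQ]] := spray_add f0 hf cle fe0 rL nd EL.
have [p hp] := ev_half (baseD f) f0; exists p; split=> //.
have f_reg : GRing.lreg f by apply: ev_reg.
suff -> : (fun i => p * y i) = G by [].
apply/funext => i; apply: evP => z; rewrite -(hsubmxK z).
move: (lsubmx z) (rsubmx z) => x v Wz; have [Ux bv] := (coneP x v).1 Wz.
pose q := P x v - ev Q (row_mx x v).
have GE k : ev (G k) (row_mx x v) = q * v 0 k.
  have := rQ k x v Wz; rewrite HP // evD // evM // ev_y // => e.
  by rewrite mulrBl e addrK.
rewrite evM // ev_y // GE; congr (_ * _).
have [S0 _] := euler_lagrange_metric f_reg hf EL.
have := congr1 (fun g => ev g (row_mx x v)) S0.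
rewrite /sprayD evB // ev0 // -hp !evMn // evM // vertE ev_sum //.
have -> : \sum_k ev (G k * Y k f) (row_mx x v) = q * ev f (row_mx x v).
  rewrite -[in RHS]hf eulerE ev_sum // mulr_sumr; apply: eq_bigr => k _.
  by rewrite !evM // GE ev_y // mulrA.
have := f0 Wz; move: (ev f _) (ev p _) => u w u0 /eqP.
by rewrite -mulrnBl -mulrBl mulrn_eq0 mulf_eq0 (negPf u0) orbF subr_eq0 => /eqP.
Qed.

Lemma projectively_flat_constant (hn : (2 <= n)%N) (K : R) (P : 'rV[R]_n -> 'rV[R]_n -> R) p :
  (forall x v (i : 'I_n), U x -> region (kropina a b) c x v ->
     spray L i x v = P x v * v 0 i) ->
  (forall x v, U x -> region (kropina a b) c x v -> flag_curvature_at L0 K x v) ->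
  dom c p -> constant_chart a b p.
Proof.
move=> HP flag dp; have [q [hq EL]] := projectively_flat_kropina HP.
have flagW x v : cone U bm (row_mx x v) -> flag_curvature_at L0 K x v.
  by move=> /coneP[]; exact: flag.
have unit x : U x -> bilin (invmx (am x)) (bm x) (bm x) = 1.
  by move=> Ux; apply: unit_form (hb ac Ux).
have ode := metric_form_ode asym apos hq EL rL0 hn flagW nd0 unit.
apply: (@ode_constant_chart _ _ M a b c ac (projective_covector q)) => //.
- move=> k; exact: (smooth_projective_covector oU sb q unit k).
- move=> x j k Ux; exact: (projective_covector_ode asym apos hq EL rL0 hn flagW nd0 unit j k Ux).
- by move=> x l i j Ux; have [+ _] := ode x Ux l; apply.
- by move=> x l i Ux; have [_ +] := ode x Ux l; apply.
Qed.

End Chart.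
End RandersData.

(** * The global statements *)

Section RandersKropina.
Context {R : realType} {n : nat} (M : manifold R n) (a : riemannian_metric M)
  (b eta : one_form M).
Hypothesis hb : forall c x, atlas c -> chart_range c x -> form_norm a b c x = 1.
Hypothesis he : forall c x, atlas c -> chart_range c x -> form_norm a eta c x < 2^-1.

Definition randers_matrix (c : chart R n (carrier M)) x : 'M[R]_n := metric_comp a c x +
  2^-1 *: ((form_comp b c x)^T *m form_comp eta c x + (form_comp eta c x)^T *m form_comp b c x).

Lemma randers_matrixE c x i j : randers_matrix c x i j = metric_comp a c x i j +
  2^-1 * (form_comp b c x 0 i * form_comp eta c x 0 j
        + form_comp eta c x 0 i * form_comp b c x 0 j).
Proof. by rewrite !mxE !big_ord1 !mxE. Qed.

Lemma bilin_randers_matrix c x y : bilin (randers_matrix c x) y y =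
  bilin (metric_comp a c x) y y + form_eval b c x y * form_eval eta c x y.
Proof.
rewrite !form_evalE; set B := form_comp b c x; set E := form_comp eta c x.
transitivity (bilin (metric_comp a c x) y y
  + 2^-1 * (pairing B y * pairing E y + pairing E y * pairing B y)); last by field.
rewrite /pairing !mulr_suml -big_split mulr_sumr -big_split; apply: eq_bigr => i _ /=.
rewrite !mulr_sumr -big_split mulr_sumr -big_split; apply: eq_bigr => j _ /=.
by rewrite randers_matrixE -/B -/E; ring.
Qed.

Fact randers_matrix_smooth c : atlas c -> smooth (chart_range c) (randers_matrix c).
Proof.
move=> ac; have oU := @range_open _ _ _ c; apply/smooth_mxP => // i j.
have sb k := form_entry_smooth b ac k; have se k := form_entry_smooth eta ac k.
apply: (smooth_ext oU) => [x _|]; first by rewrite randers_matrixE.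
apply: smoothD => //; first exact: metric_entry_smooth.
apply: smoothM => //; first exact: smooth_cst.
by apply: smoothD => //; exact: smoothM.
Qed.

Fact randers_matrix_sym c x : atlas c -> chart_range c x ->
  (randers_matrix c x)^T = randers_matrix c x.
Proof.
move=> ac Ux; apply/matrixP => i j; rewrite mxE !randers_matrixE.
by rewrite (metric_entry_sym a ac Ux j i); ring.
Qed.

Fact randers_matrix_pos c x (y : 'rV[R]_n) : atlas c -> chart_range c x -> y != 0 ->
  0 < \sum_i \sum_j randers_matrix c x i j * y 0 i * y 0 j.
Proof.
move=> ac Ux y0; have := randers_metric_gt0 hb he ac Ux y0.
by rewrite -bilin_randers_matrix.
Qed.

Fact randers_matrix_change c c' x : atlas c -> atlas c' -> overlap c c' x ->
  randers_matrix c x = 'J (transition c c') x *m randers_matrix c' (transition c c' x)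
    *m ('J (transition c c') x)^T.
Proof.
move=> ac ac' Ox; rewrite /randers_matrix (metric_change a ac ac' Ox).
rewrite (form_change b ac ac' Ox) (form_change eta ac ac' Ox).
by rewrite !trmx_mul !trmxK mulmxDr mulmxDl -scalemxAr -scalemxAl mulmxDr mulmxDl !mulmxA.
Qed.

Definition randers_metric : riemannian_metric M := RiemannianMetric
  randers_matrix_smooth randers_matrix_sym randers_matrix_pos randers_matrix_change.

(** On [beta > 0] the form [eta] equals [beta eta / beta], so adding it to the
    metric only changes the numerator, by the quadratic form [beta eta]. *)
Lemma randers_is_kropina : is_kropina (add_form (kropina a b) eta).
Proof.
exists randers_metric, b => c x ac Ux; split=> // y /= by0.
rewrite !alpha_sqr // bilin_randers_matrix mulrDl; congr (_ + _).
by rewrite mulrC mulKf // lt0r_neq0.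
Qed.

Hypothesis ce : closed_form eta.

Lemma randers_scalar_flag_curvature : scalar_flag_curvature (kropina a b) ->
  scalar_flag_curvature (add_form (kropina a b) eta).
Proof.
case=> K flag; pose L c := value (add_form (kropina a b) eta) c.
exists (fun c x y => xget 0 [set K' | flag_curvature_at (L c) K' x y]) => c x y ac Ux Ry.
have [K' hK'] := randers_scalar_curvature hb he ac ce Ux Ry (flag c x y ac Ux Ry).
exact: (@xgetPex _ 0 [set K' | flag_curvature_at (L c) K' x y] (ex_intro _ K' hK')).
Qed.

Lemma constant_locally_projectively_flat : (forall p, constant_chart a b p) ->
  locally_projectively_flat (add_form (kropina a b) eta).
Proof.
move=> cst1 p; have [c [ac dp H]] := cst1 p; exists c; split=> //.
exact: (constant_projective_spray hb he ac ce H).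
Qed.

Lemma locally_projectively_flat_constant (hn : (2 <= n)%N) p :
  constant_flag_curvature (kropina a b) ->
  locally_projectively_flat (add_form (kropina a b) eta) -> constant_chart a b p.
Proof.
case=> K flag lpf; have [c [ac dp [P [_ HP]]]] := lpf p.
apply: (projectively_flat_constant hb he ac ce hn (K := K) HP) => // x v Ux bv.
exact: flag.
Qed.

Lemma standard_locally_standard i1 : (forall p, standard_chart a b i1 p) ->
  locally_standard i1 (add_form (kropina a b) eta) eta.
Proof.
move=> std p; have [c [ac dp H]] := std p; exists c; split=> // x Ux.
have [a1 b1] := H x Ux; have B y : form_eval b c x y = y 0 i1.
  by rewrite form_evalE b1 pairingC pairing_delta.
split=> [|y _]; first by apply/seteqP; split=> y /=; rewrite B.
rewrite /= B alpha_sqr // a1; congr (_ / _ + _).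
rewrite bilin_pairing mulmx1; by apply: eq_bigr => i _; rewrite expr2.
Qed.

Lemma half_space_covector (u : 'rV[R]_n) i1 :
  (forall y, (0 < pairing u y) = (0 < y 0 i1)) -> exists2 l, 0 < l & u = l *: delta_mx 0 i1.
Proof.
move=> H; have u1 : 0 < u 0 i1 by rewrite -pairing_delta H mxE !eqxx.
exists (u 0 i1) => //; apply/rowP => i; rewrite !mxE eqxx /=.
have [->|i1i] := eqVneq i i1; first by rewrite mulr1.
rewrite mulr0; apply/eqP/negPn/negP => ui.
(* This vector is in the half space of [delta_mx 0 i1] and on the boundary of the
   other one. *)
have := H (delta_mx 0 i1 - (u 0 i1 / u 0 i) *: delta_mx 0 i).
rewrite -scaleNr pairingDr pairingZr !pairing_delta mulNr divfK // subrr ltxx.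
by rewrite !mxE !eqxx (eq_sym i1) (negPf i1i) mulr0 addr0 ltr01.
Qed.

(** The half space determines the ray of [beta], the values then determine [alpha]
    up to the same factor, and the unit length fixes that factor. *)
Lemma locally_standard_standard i1 p :
  locally_standard i1 (add_form (kropina a b) eta) eta -> standard_chart a b i1 p.
Proof.
move=> ls; have [c [ac dp H]] := ls p; exists c; split=> // x Ux.
have [HR HV] := H x Ux.
have reg y : (0 < pairing (form_comp b c x) y) = (0 < y 0 i1).
  by apply/idP/idP; have := congr1 (fun S => S y) HR => /= ->.
have [l l0 bE] := half_space_covector reg.
have d0 : delta_mx 0 i1 != 0 :> 'rV[R]_n.
  by apply/rV0Pn; exists i1; rewrite mxE !eqxx oner_eq0.
have am1 : metric_comp a c x = l%:M.
  apply/subr0_eq; apply: bilin_eq0 => [i j|].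
    rewrite [LHS]mxE [RHS]mxE (metric_entry_sym a ac Ux i j); congr (_ + _).
    by rewrite !mxE eq_sym.
  apply: (polyl_eq0 (polyl_bilin _) d0) => v; rewrite pairingC pairing_delta => v1.
  have bv : region (add_form (kropina a b) eta) c x v by rewrite /= form_evalE reg.
  have := HV v bv; rewrite /= alpha_sqr // form_evalE => /addIr.
  rewrite bE pairingZl pairingC pairing_delta => e.
  have A : bilin (metric_comp a c x) v v = l * \sum_i v 0 i ^+ 2.
    have ln := lt0r_neq0 l0; have vn := lt0r_neq0 v1.
    move: e; move: (bilin _ v v) (\sum_i _) => A S e.
    have -> : A = A / (l * v 0 i1) * (l * v 0 i1) by field; rewrite ln vn.
    by rewrite e; field.
  rewrite bilin_pairing mulmxBr pairingC pairingDr pairingNr !(pairingC v) -bilin_pairing A.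
  rewrite mul_mx_scalar pairingZl /pairing; apply/eqP; rewrite subr_eq0; apply/eqP.
  by congr (_ * _); apply: eq_bigr => i _; rewrite expr2.
have l1 : l = 1.
  have := unit_form (hb ac Ux); rewrite am1 bE invmx_scalar bilinZl bilinZr bilin_delta.
  by have ln := lt0r_neq0 l0; rewrite mxE eqxx mulr1n mulfV // mulr1.
by rewrite am1 bE l1 scale1r.
Qed.

End RandersKropina.

Theorem theorem1p3 (R : realType) (n : nat) (hn : (2 <= n)%N)
    (M : manifold R n) (a : riemannian_metric M) (b : one_form M)
    (hb : forall (c : chart R n (carrier M)) (x : 'rV[R]_n),
        atlas c -> chart_range c x -> form_norm a b c x = 1) :
  exists eps : R, 0 < eps /\
    forall eta : one_form M, closed_form eta ->
      (forall (c : chart R n (carrier M)) (x : 'rV[R]_n),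
         atlas c -> chart_range c x -> form_norm a eta c x < eps) ->
      (scalar_flag_curvature (kropina a b) ->
         is_kropina (add_form (kropina a b) eta) /\
         scalar_flag_curvature (add_form (kropina a b) eta)) /\
      (constant_flag_curvature (kropina a b) ->
         (locally_projectively_flat (add_form (kropina a b) eta) <->
            flat_parallel a b) /\
         (flat_parallel a b <->
            locally_standard (Ordinal (ltnW hn))
              (add_form (kropina a b) eta) eta)).
Proof.
(* Below 1/2 the product of [beta] and [eta] is at most [alpha ^ 2 / 2]. *)
exists 2^-1; split; first by rewrite invr_gt0.
move=> eta ce he; split=> [sfc|cfc].
  by split; [exact: randers_is_kropina|exact: randers_scalar_flag_curvature].
case: n hn M a b hb eta ce he cfc => [//|m] hn M a b hb eta ce he cfc.
have -> : Ordinal (ltnW hn) = ord0 :> 'I_m.+1 by exact: val_inj.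
have cst_std p := constant_standard hb (p := p).
have fp_cst : flat_parallel a b -> forall p, constant_chart a b p.
  by move=> fp p; exact: flat_parallel_constant.
split; split.
- move=> lpf; apply: standard_flat_parallel => p.
  exact/cst_std/(locally_projectively_flat_constant hb he ce hn p cfc lpf).
- by move=> /fp_cst; exact: constant_locally_projectively_flat.
- by move=> /fp_cst cst1; apply: standard_locally_standard => p; exact: cst_std.
- move=> ls; apply: standard_flat_parallel => p.
  exact: (locally_standard_standard hb p ls).
Qed.
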